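(* Let $C\subset\mathbb{R}^2$ be an oval. (a) The function $\mathcal E_C$ is smooth on $\operatorname{int}(C)$, extends continuously to $\overline{\operatorname{int}(C)}$, is non-negative, and vanishes on $C$. Consequently $\mathcal C_{\operatorname{ART}}(C)$ is non-empty and compact. (b) If $F(x)=Ax+b$ is a nonsingular affine map of $\mathbb{R}^2$, then $$\mathcal E_{F(C)}(F(p))=|\det A|\,\mathcal E_C(p),\qquad \delta_{\operatorname{ART}}(F(C))=\delta_{\operatorname{ART}}(C),\qquad \mathcal C_{\operatorname{ART}}(F(C))=F\bigl(\mathcal C_{\operatorname{ART}}(C)\bigr).$$ (c) One has $\delta_{\operatorname{ART}}(C)=0$ if and only if $C$ is centrally symmetric. In that case $\mathcal E_C\equiv0$ and $\mathcal C_{\operatorname{ART}}(C)=\overline{\operatorname{int}(C)}$. If $C$ is not centrally symmetric, then $\delta_{\operatorname{ART}}(C)>0$ and $\mathcal C_{\operatorname{ART}}(C)\subset\operatorname{int}(C)$. (d) Every affine symmetry of $C$ preserves $\mathcal C_{\operatorname{ART}}(C)$. In particular, if $\mathcal C_{\operatorname{ART}}(C)=\{c_{\operatorname{ART}}(C)\}$ is a singleton, then $c_{\operatorname{ART}}(C)$ is an affine-equivariant centre and is fixed by every affine symmetry of $C$.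
   Context: An oval is a smooth ($C^\infty$), strictly convex simple closed curve $C\subset\mathbb{R}^2$ with positive curvature; $\operatorname{int}(C)$ is the open region it bounds. For $x\in C$, $\iota_C(x)\in C$ is the unique point different from $x$ whose tangent line is parallel to $T_xC$. $\Phi_C$ sends a line $\overline{xy}$ ($x\ne y\in C$) to $\overline{\iota_C(x)\iota_C(y)}$; $\Lambda_p$ is the pencil of lines through $p\in\operatorname{int}(C)$; $\operatorname{ART}_C(p)$ is the envelope of the line family $\Phi_C(\Lambda_p)$. Put $n(\theta)=(\cos\theta,\sin\theta)$, $\tau(\theta)=(-\sin\theta,\cos\theta)$. For each $\theta$ there is exactly one line of $\Phi_C(\Lambda_p)$ with normal $n(\theta)$, written $n(\theta)\cdot(z-p)=q_p(\theta)$, with $q_p$ smooth and $q_p(\theta+\pi)=-q_p(\theta)$. $\operatorname{ART}_C(p)$ is the closed front $X_p(\theta)=p+q_p(\theta)n(\theta)+q_p'(\theta)\tau(\theta)$, $\theta\in[0,\pi]$, with oriented area $A^*(\operatorname{ART}_C(p))=\frac12\oint[X_p,dX_p]=\frac12\int_0^\pi(q_p^2-(q_p')^2)\,d\theta$, where $[u,v]=\det(u,v)$. Energy: $\mathcal E_C(p)=-A^*(\operatorname{ART}_C(p))$ for $p\in\operatorname{int}(C)$ and $\mathcal E_C(p)=0$ for $p\in C$. With $A(C)>0$ the area enclosed by $C$, $$\delta_{\operatorname{ART}}(C)=\frac{\max_{p\in\overline{\operatorname{int}(C)}}\mathcal E_C(p)}{A(C)},\qquad \mathcal C_{\operatorname{ART}}(C)=\operatorname*{arg\,max}_{p\in\overline{\operatorname{int}(C)}}\mathcal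 E_C(p).$$ An affine symmetry of $C$ is a nonsingular affine map $F$ with $F(C)=C$. *)

(* Defs.v *)
From HB Require Import structures.
From mathcomp Require Import all_boot all_order all_algebra.
From mathcomp Require Import all_classical all_reals all_analysis.

Set Implicit Arguments.
Unset Strict Implicit.
Unset Printing Implicit Defensive.

Import Order.TTheory GRing.Theory Num.Theory.
Import numFieldNormedType.Exports.

Local Open Scope classical_set_scope.
Local Open Scope ring_scope.

Section Plane.
Context {R : realType}.
Local Notation plane := (R * R)%type.

Definition dotp (u v : plane) : R := u.1 * v.1 + u.2 * v.2.

Definition cross (u v : plane) : R := u.1 * v.2 - u.2 * v.1.

Definition line (x y : plane) : set plane :=
  [set z | exists t : R, z = x + t *: (y - x)].

Definition affine (A : 'M[R]_2) (b : plane) (p : plane) : plane :=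
  (A 0 0 * p.1 + A 0 1 * p.2 + b.1, A 1 0 * p.1 + A 1 1 * p.2 + b.2).

Definition affine_symmetry (C : set plane) (A : 'M[R]_2) (b : plane) : Prop :=
  \det A != 0 /\ affine A b @` C = C.

Definition centrally_symmetric (C : set plane) : Prop :=
  exists c : plane, (fun x => c - (x - c)) @` C = C.

Definition smooth_curve (g : R -> plane) : Prop :=
  forall (n : nat) (t : R), derivable (derive1n n g) t 1.

Definition curvature (g : R -> plane) (t : R) : R :=
  cross (derive1 g t) (derive1n 2 g t) /
  Num.sqrt (dotp (derive1 g t) (derive1 g t)) ^+ 3.

(* Counterclockwise parametrizations of [C] of period [T].  The last conjunct is
   strict convexity: away from the point of tangency, the curve lies strictly
   on the left of each of its tangent lines.  An oval always has such a
   parametrization, since a clockwise one can be reversed. *)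
Definition oval_param (C : set plane) (T : R) (g : R -> plane) : Prop :=
  [/\ 0 < T /\ (forall t, g (t + T) = g t),
      (forall s t, 0 <= s < T -> 0 <= t < T -> g s = g t -> s = t)
        /\ range g = C,
      smooth_curve g /\ (forall t, derive1 g t != 0),
      (forall t, 0 < curvature g t) &
      (forall s t, g s <> g t -> 0 < cross (derive1 g t) (g s - g t))].

Definition oval (C : set plane) : Prop := exists T g, oval_param C T g.

(* The union of the bounded connected components of the complement of [C],
   of which there is only one when [C] is a simple closed curve. *)
Definition region (C : set plane) : set plane :=
  [set p | (~` C) p /\ bounded_set (connected_component (~` C) p)].

Definition tangent_vector (C : set plane) (x v : plane) : Prop :=
  exists T g t, [/\ oval_param C T g, g t = x & derive1 g t = v].

Definition iota_of (C : set plane) (x : plane) : plane :=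
  get [set y | [/\ C y, y <> x &
    exists u v, [/\ tangent_vector C x u, tangent_vector C y v
                  & cross u v = 0]]].

(* A secant of an oval determines the pair of points [x], [y] up to order, so
   this is the single line through their images; lines that are not secant
   are sent to [set0]. *)
Definition Phi (C : set plane) (L : set plane) : set plane :=
  [set z | exists x y, [/\ C x, C y, x <> y, L = line x y
                         & line (iota_of C x) (iota_of C y) z]].

Definition pencil (p : plane) : set (set plane) :=
  [set L | (exists x y, x <> y /\ L = line x y) /\ L p].

Definition nvec (theta : R) : plane := (cos theta, sin theta).

Definition tauvec (theta : R) : plane := (- sin theta, cos theta).

Definition q_ART (C : set plane) (p : plane) (theta : R) : R :=
  get [set r | (Phi C @` pencil p) [set z | dotp (nvec theta) (z - p) = r]].

Definition ART (C : set plane) (p : plane) (theta : R) : plane :=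
  p + q_ART C p theta *: nvec theta
    + derive1 (q_ART C p) theta *: tauvec theta.

(* (1/2) \oint [X, dX] over the parameter interval [0, pi]. *)
Definition oriented_area (X : R -> plane) : R :=
  2^-1 * \int[lebesgue_measure]_(theta in `[0, pi])
    cross (X theta) (derive1 X theta).

Definition energy (C : set plane) (p : plane) : R :=
  if p \in region C then - oriented_area (ART C p) else 0.

Definition enclosed_area (C : set plane) : R :=
  fine ((lebesgue_measure \x lebesgue_measure)%E (region C)).

Definition argmax_energy (C : set plane) : set plane :=
  [set p | closure (region C) p /\
           forall p', closure (region C) p' -> energy C p' <= energy C p].

(* The supremum is a maximum as soon as [argmax_energy C] is non-empty. *)
Definition delta_ART (C : set plane) : R :=
  sup (energy C @` closure (region C)) / enclosed_area C.

Fixpoint Cn_on (U : set plane) (n : nat) (f : plane -> R) : Prop :=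
  if n is m.+1 then
    [/\ forall p, U p -> derivable f p (1, 0) /\ derivable f p (0, 1),
        Cn_on U m (fun p => 'D_((1, 0) : plane) f p) &
        Cn_on U m (fun p => 'D_((0, 1) : plane) f p)]
  else forall p, U p -> f x @[x --> p] --> f p.

Definition smooth_on (U : set plane) (f : plane -> R) : Prop :=
  forall n, Cn_on U n f.

End Plane.

(* Main.v *)
Require Import Defs.
From mathcomp Require Import all_boot all_order all_algebra.
From mathcomp Require Import all_classical all_reals all_analysis.
From mathcomp Require Import measurable_realfun zify ring lra.
Import Order.TTheory GRing.Theory Num.Theory.
Import numFieldNormedType.Exports.
Set Implicit Arguments.
Unset Strict Implicit.
Unset Printing Implicit Defensive.
Local Open Scope classical_set_scope.
Local Open Scope ring_scope.

(** An oval is parametrized by the angle [x] of its outward normal: [gam x] has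
    velocity [rho x * tau x] with [rho > 0], and [iota] is the shift [x + pi].
    For [p] inside and a direction [th] exactly one chord [gam s, gam t] through
    [p] has an image [gam (s + pi), gam (t + pi)] with normal [n th]; the ends
    [s, t] solve a 2x2 system with nonzero Jacobian, hence depend smoothly on
    [(p, th)], and so does [q]. Differentiating under the integral makes the
    energy [1/2 int (q'^2 - q^2)] smooth. It is continuous up to the curve by
    dominated convergence: at a point of [C] the limiting [q] is a pure
    [v . n th], whose energy vanishes.

    Since [q] is antiperiodic of antiperiod [pi], Wirtinger's inequality gives
    [energy >= 0], with equality only for [q = v . n], that is, when all image
    lines of the pencil of [p] are concurrent.

    Under an affine map [F] the image lines are carried along, which relates the
    two functions [q] by a change of the angle; the two densities then differ by
    a factor [det A] and an exact derivative.

    If the energy vanishes identically, take for [p] the intersection of two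
    diameters [gam x, gam (x + pi)]. Diameters are fixed by [Phi], so the image
    lines are concurrent at [p] itself, and each diameter touches the (constant)
    envelope at [p]. That point divides the diameter in the ratio
    [rho x : rho (x + pi)], so it does not depend on the other diameter: all
    diameters meet at a single point [c] in this ratio. Differentiating shows
    that the ratio is constant, hence equal to 1, and [c] is a centre. *)

(** * Calculus of real functions *)

Section FunDerive.
Context {R : realType} {V : normedModType R}.
Implicit Types (f g : V -> R) (x v : V) (a b : R).

Lemma is_deriveW f x v a b : is_derive x v f a -> a = b -> is_derive x v f b.
Proof. by move=> ? <-. Qed.

Lemma is_deriveD_fun f g x v a b : is_derive x v f a -> is_derive x v g b ->
  is_derive x v (fun y => f y + g y) (a + b).
Proof. by move=> df dg; exact: (@is_deriveD _ _ _ f g x v a b df dg). Qed.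

Lemma is_deriveN_fun f x v a : is_derive x v f a ->
  is_derive x v (fun y => - f y) (- a).
Proof. by move=> df; exact: (@is_deriveN _ _ _ f x v a df). Qed.

Lemma is_deriveB_fun f g x v a b : is_derive x v f a -> is_derive x v g b ->
  is_derive x v (fun y => f y - g y) (a - b).
Proof. by move=> df dg; apply: is_deriveD_fun => //; exact: is_deriveN_fun. Qed.

Lemma is_deriveM_fun f g x v a b : is_derive x v f a -> is_derive x v g b ->
  is_derive x v (fun y => f y * g y) (a * g x + f x * b).
Proof.
move=> df dg; have <- : f x *: b + g x *: a = a * g x + f x * b.
  by rewrite /GRing.scale /= addrC [_ * a]mulrC.
exact: (@is_deriveM _ _ f g x v a b df dg).
Qed.

Lemma is_deriveMl_fun f x v a b : is_derive x v f a ->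
  is_derive x v (fun y => b * f y) (b * a).
Proof.
move=> df; apply: (is_deriveW (is_deriveM_fun (is_derive_cst b x v) df)).
by rewrite mul0r add0r.
Qed.

Lemma is_deriveBr_fun f x v a b : is_derive x v f a ->
  is_derive x v (fun y => f y - b) a.
Proof.
move=> df; apply: (is_deriveW (is_deriveB_fun df (is_derive_cst b x v))).
by rewrite subr0.
Qed.

Lemma is_deriveBl_fun f x v a b : is_derive x v f a ->
  is_derive x v (fun y => b - f y) (- a).
Proof.
move=> df; apply: (is_deriveW (is_deriveB_fun (is_derive_cst b x v) df)).
by rewrite sub0r.
Qed.

Lemma is_deriveV_fun f x v a : f x != 0 -> is_derive x v f a ->
  is_derive x v (fun y => (f y)^-1) (- a * ((f x)^-1 * (f x)^-1)).
Proof.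
move=> fx0 df.
have -> : - a * ((f x)^-1 * (f x)^-1) = - (f x) ^- 2 *: a.
  by rewrite /GRing.scale /= exprSr expr1 invfM mulNr mulNr mulrC.
apply: DeriveDef; last by rewrite deriveV// derive_val.
by apply: derivableV => //; exact: ex_derive.
Qed.

Lemma is_derive_line f x v l :
  is_derive x v f l <-> is_derive (0 : R) 1 (fun h : R => f (h *: v + x)) l.
Proof.
have E : (fun h : R => h^-1 *: (f (h *: v + x) - f x)) =
  (fun h : R => h^-1 *: (f ((h *: (1 : R) + 0) *: v + x) - f ((0 : R) *: v + x))).
  by apply/funext => h /=; rewrite addr0 scale0r add0r [_%:A]mulr1.
split => -[df dl]; split.
- exact: (proj1 (derivable1P f x v)).
- by rewrite -dl /derive /= -E.
- exact: (proj2 (derivable1P f x v)).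
- by rewrite -dl /derive /= -E.
Qed.

Lemma is_derive_comp_fun (f : R -> R) g x v a b : is_derive x v g b ->
  is_derive (g x) 1 f a -> is_derive x v (fun y => f (g y)) (a * b).
Proof.
move=> /is_derive_line dg df; apply/is_derive_line.
have := @is_derive1_comp _ f (fun h : R => g (h *: v + x)) 0 a b.
by rewrite /= scale0r add0r; apply.
Qed.

End FunDerive.

Section Smooth.
Context {R : realType}.
Implicit Types (f g h : R -> R) (x y a b c l : R).

Fixpoint smooth_upto n f : Prop :=
  if n is m.+1 then
    exists2 g : R -> R, (forall x : R, is_derive x 1 f (g x)) & smooth_upto m g
  else True.

Definition smooth f := forall n, smooth_upto n f.

Lemma smooth_uptoW n f : smooth_upto n.+1 f -> smooth_upto n f.
Proof.
elim: n f => [//|n IH] f [g fg sg]; exists g => //.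
exact: IH.
Qed.

Lemma smooth_upto_cst n (c : R) : smooth_upto n (fun=> c).
Proof.
elim: n c => [//|n IH] c; exists (fun=> 0); last exact: IH.
by move=> x; exact: is_derive_cst.
Qed.

Lemma smooth_upto_id n : smooth_upto n (fun x => x).
Proof.
case: n => [//|n]; exists (fun=> 1); last exact: smooth_upto_cst.
by move=> x; exact: is_derive_id.
Qed.

Lemma smooth_uptoD n f g :
  smooth_upto n f -> smooth_upto n g -> smooth_upto n (fun x => f x + g x).
Proof.
elim: n f g => [//|n IH] f g [f' ff' sf'] [g' gg' sg'].
exists (fun x => f' x + g' x); last exact: IH.
by move=> x; exact: is_deriveD_fun.
Qed.

Lemma smooth_uptoN n f : smooth_upto n f -> smooth_upto n (fun x => - f x).
Proof.
elim: n f => [//|n IH] f [f' ff' sf'].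
exists (fun x => - f' x); last exact: IH.
by move=> x; exact: is_deriveN_fun.
Qed.

Lemma smooth_uptoM n f g :
  smooth_upto n f -> smooth_upto n g -> smooth_upto n (fun x => f x * g x).
Proof.
elim: n f g => [//|n IH] f g sf sg.
have sf0 := smooth_uptoW sf; have sg0 := smooth_uptoW sg.
move: sf sg => [f' ff' sf'] [g' gg' sg'].
exists (fun x => f' x * g x + f x * g' x).
  by move=> x; exact: is_deriveM_fun.
by apply: smooth_uptoD; exact: IH.
Qed.

Lemma smooth_upto_comp n f g :
  smooth_upto n f -> smooth_upto n g -> smooth_upto n (fun x => f (g x)).
Proof.
elim: n f g => [//|n IH] f g sf sg.
have sg0 := smooth_uptoW sg.
move: sf sg => [f' ff' sf'] [g' gg' sg'].
exists (fun x => f' (g x) * g' x).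
  by move=> x; exact: is_derive_comp_fun.
by apply: smooth_uptoM => //; exact: IH.
Qed.

Lemma smooth_uptoV n f : (forall x, f x != 0) ->
  smooth_upto n f -> smooth_upto n (fun x => (f x)^-1).
Proof.
move=> f0; elim: n => [//|n IH] sf.
have sf0 := smooth_uptoW sf.
case: sf => f' ff' sf'.
exists (fun x => - f' x * ((f x)^-1 * (f x)^-1)).
  by move=> x; exact: is_deriveV_fun.
apply: smooth_uptoM; first exact: smooth_uptoN.
by apply: smooth_uptoM; exact: IH.
Qed.

Lemma smooth_upto_trig n : smooth_upto n (@sin R) /\ smooth_upto n (@cos R).
Proof.
elim: n => [//|n [IHs IHc]]; split.
  by exists cos => // x; exact: is_derive_sin.
exists (fun x => - sin x); last exact: smooth_uptoN.
by move=> x; exact: is_derive_cos.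
Qed.

Lemma smooth_cst (c : R) : smooth (fun=> c).
Proof. by move=> n; exact: smooth_upto_cst. Qed.

Lemma smooth_id : smooth (fun x => x).
Proof. by move=> n; exact: smooth_upto_id. Qed.

Lemma smoothD f g : smooth f -> smooth g -> smooth (fun x => f x + g x).
Proof. by move=> sf sg n; exact: smooth_uptoD. Qed.

Lemma smoothN f : smooth f -> smooth (fun x => - f x).
Proof. by move=> sf n; exact: smooth_uptoN. Qed.

Lemma smoothM f g : smooth f -> smooth g -> smooth (fun x => f x * g x).
Proof. by move=> sf sg n; exact: smooth_uptoM. Qed.

Lemma smooth_comp f g : smooth f -> smooth g -> smooth (fun x => f (g x)).
Proof. by move=> sf sg n; exact: smooth_upto_comp. Qed.

Lemma smoothV f : (forall x, f x != 0) -> smooth f -> smooth (fun x => (f x)^-1).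
Proof. by move=> f0 sf n; exact: smooth_uptoV. Qed.

Lemma smooth_sin : smooth (@sin R).
Proof. by move=> n; have [] := smooth_upto_trig n. Qed.

Lemma smooth_cos : smooth (@cos R).
Proof. by move=> n; have [] := smooth_upto_trig n. Qed.

Lemma is_derive_unique f g h : (forall x : R, is_derive x 1 f (g x)) ->
  (forall x : R, is_derive x 1 f (h x)) -> g = h.
Proof.
move=> fg fh; apply/funext => x.
by have [_ <-] := fg x; have [_ <-] := fh x.
Qed.

Lemma smooth_derive f g : (forall x : R, is_derive x 1 f (g x)) ->
  smooth f -> smooth g.
Proof.
by move=> fg sf n; have [h fh] := sf n.+1; rewrite (is_derive_unique fg fh).
Qed.

Lemma smooth_ex_derive f : smooth f ->
  exists2 g : R -> R, (forall x : R, is_derive x 1 f (g x)) & smooth g.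
Proof.
move=> sf; have [g fg _] := sf 1%N; exists g => //.
exact: smooth_derive sf.
Qed.

Lemma smooth_of_derive f g : (forall x : R, is_derive x 1 f (g x)) ->
  smooth g -> smooth f.
Proof. by move=> fg sg [//|n]; exists g. Qed.

Lemma is_derive_continuous f x l : is_derive x 1 f l -> {for x, continuous f}.
Proof.
by case=> df _; apply: differentiable_continuous; exact/derivable1_diffP.
Qed.

Lemma smooth_continuous f : smooth f -> continuous f.
Proof.
move=> /smooth_ex_derive[g fg _] x; exact: is_derive_continuous.
Qed.

Lemma smooth_inverse f f' g : cancel f g -> cancel g f -> 
  (forall x : R, is_derive x 1 f (f' x)) -> (forall x, f' x != 0) -> smooth f ->
  (forall x, is_derive x 1 g (f' (g x))^-1) /\ smooth g.
Proof.
move=> fgK gfK df f'0 sf.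
have dg x : is_derive x 1 g (f' (g x))^-1.
  rewrite -{1}(gfK x).
  apply: (@is_derive_inverse _ f g (f' (g x)) (g x) _ _ (df (g x)) (f'0 _)).
  - by near=> y; exact: fgK.
  - by near=> y; exact: smooth_continuous.
split=> // n; elim: n => [//|n IH].
exists (fun x => (f' (g x))^-1) => //.
apply: (@smooth_uptoV _ (fun x => f' (g x))) => //; apply: smooth_upto_comp => //.
exact: smooth_derive df sf n.
Unshelve. all: by end_near. Qed.

End Smooth.

Section Calculus.
Context {R : realType}.
Implicit Types (f g : R -> R) (x y a b c l : R).

Lemma mean_value f f' a b : (forall x : R, is_derive x 1 f (f' x)) -> a < b ->
  exists c, a < c < b /\ f b - f a = f' c * (b - a).
Proof.
move=> df ab; have [|c cab E] := @MVT R f f' a b ab (fun x _ => df x).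
  by apply: continuous_subspaceT => x; exact: is_derive_continuous.
by exists c; split => //; move: cab; rewrite in_itv.
Qed.

Lemma derive_pos_lt f f' a b : (forall x : R, is_derive x 1 f (f' x)) ->
  (forall x, a < x < b -> 0 < f' x) -> a < b -> f a < f b.
Proof.
move=> df f'0 ab; have [c [cab E]] := mean_value df ab.
by rewrite -subr_gt0 E mulr_gt0 ?f'0 ?subr_gt0.
Qed.

Lemma derive_ge0_le f f' a b : (forall x : R, is_derive x 1 f (f' x)) ->
  (forall x, a < x < b -> 0 <= f' x) -> a <= b -> f a <= f b.
Proof.
move=> df f'0; rewrite le_eqVlt => /predU1P[->//|ab].
have [c [cab E]] := mean_value df ab.
by rewrite -subr_ge0 E mulr_ge0 ?f'0 ?subr_ge0// ltW.
Qed.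

Let G f a x := \int[lebesgue_measure]_(t in `[a, x]) f t.

Let integrable_seg f a b : continuous f ->
  lebesgue_measure.-integrable `[a, b] (EFin \o f).
Proof.
move=> cf; apply: continuous_compact_integrable; first exact: segment_compact.
exact: continuous_subspaceT.
Qed.

Let G_cat f a b x : continuous f -> a <= b -> b <= x ->
  G f a x = G f a b + G f b x.
Proof.
move=> cf ab bx.
have := @Rintegral_itvB R f (BLeft a) (BRight x) b (integrable_seg a x cf).
rewrite !bnd_simp => /(_ ab bx) /eqP; rewrite subr_eq addrC => /eqP.
rewrite Rintegral_itv_obnd_cbnd//.
apply: (integrableS _ _ _ (integrable_seg b x cf)) => //.
by apply: subset_itvr; rewrite bnd_simp.
Qed.

Lemma continuous_primitive f : continuous f ->
  exists F, forall x : R, is_derive x 1 F (f x).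
Proof.
move=> cf.
pose F x := let a := - (`|x| + 1) in G f a x - G f a 0.
exists F => x.
pose M := - (`|x| + 3).
have xM : - `|x| <= x by rewrite lerNl ler_normr lexx orbT.
have x0 : 0 <= `|x| by [].
have FE : \near x, G f M x - G f M 0 = F x.
  near=> z; rewrite /F /=; set a := - (`|z| + 1).
  have zx : `|z - x| < 1 by near: z; exact: (@cvgr_distC_lt _ _ _ _ _ id).
  have z1 : `|z| <= `|x| + 1.
    rewrite -(subrK x z) addrC (le_trans (ler_normD _ _))// lerD2l//; exact: ltW.
  have z2 : - `|z| <= z by rewrite lerNl ler_normr lexx orbT.
  have z0 : 0 <= `|z| by [].
  have Ma : M <= a by rewrite /M /a; lra.
  have az : a <= z by rewrite /a; lra.
  have a0 : a <= 0 by rewrite /a; lra.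
  rewrite (G_cat cf Ma az) (G_cat cf Ma a0); lra.
apply: near_eq_is_derive FE _.
have -> : f x = f x - 0 by rewrite subr0.
apply: is_deriveB_fun.
  have Mx : M < x by rewrite /M; lra.
  have x1 : x < x + 1 by lra.
  have [] := @continuous_FTC1_closed R f M x _ x1 (integrable_seg M _ cf) Mx (cf x).
  by move=> dG EG; apply: (DeriveDef dG); rewrite -derive1E EG.
Unshelve. all: by end_near. Qed.

Lemma Rintegral_derive f F a b : a < b -> continuous f ->
  (forall x : R, is_derive x 1 F (f x)) ->
  \int[lebesgue_measure]_(t in `[a, b]) f t = F b - F a.
Proof.
move=> ab cf dF.
have cF : continuous F by move=> x; exact: is_derive_continuous.
rewrite /Rintegral (@continuous_FTC2 R f F)//.
- exact: continuous_subspaceT.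
- split.
  + by move=> x _; have [] := dF x.
  + by apply: cvg_at_right_filter; exact: cF.
  + by apply: cvg_at_left_filter; exact: cF.
- by move=> x _; rewrite derive1E; have [_ ->] := dF x.
Qed.

Lemma cos_eq1 x : cos x = 1 -> exists k : int, x = k%:~R * (pi *+ 2).
Proof.
move=> cx; have p0 := @pi_gt0 R; pose P : R := pi *+ 2.
have P0 : 0 < P by rewrite /P mulrn_wgt0.
pose k := Num.floor (x / P); pose e := x - k%:~R * P.
have cosk (m : int) z : cos (z + m%:~R * P) = cos z.
  have H (n : nat) w : cos (w + n%:R * P) = cos w.
    by rewrite mulr_natl (periodicn (@cosD2pi R)).
  case: m => n; first by rewrite -pmulrn H.
  by rewrite NegzE mulrNz mulNr -pmulrn -(H n.+1 (z - _)) subrK.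
have ce : cos e = 1.
  by rewrite -(cosk k) subrK.
have e0 : 0 <= e by rewrite subr_ge0 -ler_pdivlMr// ge_floor.
have eP : e < P.
  rewrite ltrBlDr -[X in _ < X + _]mul1r -mulrDl -ltr_pdivrMr//.
  by have := lt_succ_floor (x / P); rewrite intrD addrC.
exists k; suff : e = 0 by move/eqP; rewrite subr_eq0 => /eqP.
have [ep|pe] := leP e pi.
  by apply: (@cos_inj R); rewrite ?in_itv/= ?e0 ?ep ?lexx ?pi_ge0// cos0.
have : P - e = 0.
  apply: (@cos_inj R); rewrite ?in_itv/= ?lexx ?pi_ge0//.
    by rewrite subr_ge0 (ltW eP)/= /P mulr2n; lra.
  by rewrite cos0 -ce -(cosN e) addrC cosD2pi.
by lra.
Qed.

Lemma cos_sin_eq x y : cos x = cos y -> sin x = sin y ->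
  exists k : int, x = y + k%:~R * (pi *+ 2).
Proof.
move=> c s; have : cos (x - y) = 1 by rewrite cosB c s -!expr2 cos2Dsin2.
by move=> /cos_eq1[k E]; exists k; rewrite -E addrC subrK.
Qed.

Lemma unit_angle a b : a ^+ 2 + b ^+ 2 = 1 -> exists x, a = cos x /\ b = sin x.
Proof.
move=> ab1.
have a1 : -1 <= a <= 1.
  by rewrite -ler_norml -(@ler_pXn2r _ 2)// ?nnegrE// expr1n real_normK ?num_real// -ab1 lerDl sqr_ge0.
have ca := acosK a1.
have s2 : (sin (acos a)) ^+ 2 = b ^+ 2 by rewrite sin2cos2 ca; lra.
move/eqP: s2; rewrite eqf_sqr => /orP[/eqP sb|/eqP sb].
  by exists (acos a); rewrite ca sb.
by exists (- acos a); rewrite cosN sinN ca sb opprK.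
Qed.

Lemma angle_lift v1 v2 : smooth v1 -> smooth v2 ->
  (forall x, v1 x ^+ 2 + v2 x ^+ 2 != 0) ->
  exists phi phi' m : R -> R,
    [/\ smooth phi, smooth m, forall x : R, is_derive x 1 phi (phi' x),
        forall x, 0 < m x &
        forall x, v1 x = m x * cos (phi x) /\ v2 x = m x * sin (phi x)].
Proof.
move=> s1 s2 v0.
have [w1 d1 sw1] := smooth_ex_derive s1.
have [w2 d2 sw2] := smooth_ex_derive s2.
pose N : R -> R := fun x => v1 x ^+ 2 + v2 x ^+ 2.
have Npos x : 0 < N x by rewrite lt_neqAle eq_sym v0 addr_ge0// sqr_ge0.
pose k : R -> R := fun x => (v1 x * w2 x - v2 x * w1 x) * (N x)^-1.
have sN : smooth N by apply: smoothD; apply: smoothM.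
have sk : smooth k.
  apply: smoothM; last exact: smoothV.
  by apply: smoothD; [exact: smoothM|apply: smoothN; exact: smoothM].
have [psi dpsi] := continuous_primitive (smooth_continuous sk).
have [] := @unit_angle (v1 0 / Num.sqrt (N 0)) (v2 0 / Num.sqrt (N 0)).
  by rewrite !expr_div_n !sqr_sqrtr ?ltW// -mulrDl mulfV// gt_eqF.
move=> a [a1 a2].
pose phi : R -> R := fun x => psi x + (a - psi 0).
have dphi (x : R) : is_derive x 1 phi (k x).
  by rewrite -[k x]addr0; apply: is_deriveD_fun; exact: is_derive_cst.
have sphi : smooth phi by apply: smooth_of_derive dphi sk.
have phi0 : phi 0 = a by rewrite /phi addrC subrK.
pose u : R -> R := fun x => - v1 x * sin (phi x) + v2 x * cos (phi x).
pose m : R -> R := fun x => v1 x * cos (phi x) + v2 x * sin (phi x).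
have ds (x : R) : is_derive x 1 (fun y => sin (phi y)) (cos (phi x) * k x).
  by apply: is_derive_comp_fun.
have dc (x : R) : is_derive x 1 (fun y => cos (phi y)) (- sin (phi x) * k x).
  by apply: is_derive_comp_fun.
have S0 : 0 < Num.sqrt (N 0) by rewrite sqrtr_gt0.
have v10 : v1 0 = Num.sqrt (N 0) * cos a by rewrite -a1 mulrC divfK// gt_eqF.
have v20 : v2 0 = Num.sqrt (N 0) * sin a by rewrite -a2 mulrC divfK// gt_eqF.
have u0 : u 0 = 0 by rewrite /u phi0 v10 v20; ring.
have m0 : 0 < m 0.
  rewrite /m phi0 v10 v20.
  have -> : Num.sqrt (N 0) * cos a * cos a + Num.sqrt (N 0) * sin a * sin a =
    Num.sqrt (N 0) * (cos a ^+ 2 + sin a ^+ 2) by ring.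
  by rewrite cos2Dsin2 mulr1.
pose du : R -> R := fun x => - w1 x * sin (phi x) + - v1 x * (cos (phi x) * k x)
     + (w2 x * cos (phi x) + v2 x * (- sin (phi x) * k x)).
have udu (x : R) : is_derive x 1 u (du x).
  by apply: is_deriveD_fun; apply: is_deriveM_fun => //; exact: is_deriveN_fun.
have csN x : u x ^+ 2 + m x ^+ 2 = N x.
  have : cos (phi x) ^+ 2 = 1 - sin (phi x) ^+ 2 by exact: cos2sin2.
  rewrite /u /m /N => E; ring: E.
have uE x : u x = 0.
  pose q : R -> R := fun x => u x * u x * (N x)^-1.
  have dq (y : R) : is_derive y 1 q 0.
    pose n := v1 y * w1 y + v2 y * w2 y.
    have dN : is_derive y 1 N (n *+ 2).
      apply: (is_deriveW (is_deriveD_fun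
        (is_deriveM_fun (d1 y) (d1 y)) (is_deriveM_fun (d2 y) (d2 y)))).
      rewrite /n; ring.
    rewrite /q; apply: (is_deriveW (is_deriveM_fun
       (is_deriveM_fun (udu y) (udu y)) (is_deriveV_fun (f := N) (v0 y) dN))).
    have -> : du y = u y * n * (N y)^-1.
      rewrite /du /k /u /n.
      have : N y != 0 by exact: v0.
      by rewrite /N => ?; field.
    by field; exact: v0.
  have : q x = q 0 by apply: is_derive_0_is_cst.
  rewrite /q u0 !mul0r => /eqP; rewrite mulf_eq0 invr_eq0 (negbTE (v0 x)) orbF.
  by rewrite mulf_eq0 orbb => /eqP.
have mN x : m x ^+ 2 = N x by rewrite -csN uE expr0n add0r.
have mn0 x : m x != 0.
  by apply: contraTneq (Npos x) => mx; rewrite -mN mx expr0n ltxx.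
have sm : smooth m.
  apply: smoothD; apply: smoothM => //; apply: smooth_comp => //.
    exact: smooth_cos.
  exact: smooth_sin.
have cm := smooth_continuous sm.
have mpos x : 0 < m x.
  rewrite lt_neqAle eq_sym mn0 /= leNgt; apply/negP => mx.
  have [x0|x0] := leP 0 x.
    have [||c _ /eqP] := @IVT R m 0 x 0 x0; last by rewrite (negbTE (mn0 _)).
      exact: continuous_subspaceT.
    by rewrite ge_min le_max (ltW mx) (ltW m0) orbT.
  have [||c _ /eqP] := @IVT R m x 0 0 (ltW x0); last by rewrite (negbTE (mn0 _)).
    exact: continuous_subspaceT.
  by rewrite ge_min le_max (ltW mx) (ltW m0) orbT.
exists phi, k, m; split => // x.
have E : cos (phi x) ^+ 2 + sin (phi x) ^+ 2 = 1 by exact: cos2Dsin2.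
have U := uE x; rewrite /u in U.
split; rewrite /m.
  transitivity (v1 x * (cos (phi x) ^+ 2 + sin (phi x) ^+ 2)); first by rewrite E mulr1.
  transitivity (v1 x * (cos (phi x) ^+ 2 + sin (phi x) ^+ 2) + sin (phi x) *
    (- v1 x * sin (phi x) + v2 x * cos (phi x))); first by rewrite U mulr0 addr0.
  ring.
transitivity (v2 x * (cos (phi x) ^+ 2 + sin (phi x) ^+ 2)); first by rewrite E mulr1.
transitivity (v2 x * (cos (phi x) ^+ 2 + sin (phi x) ^+ 2) - cos (phi x) *
    (- v1 x * sin (phi x) + v2 x * cos (phi x))); first by rewrite U mulr0 subr0.
ring.
Qed.

Lemma derive_of_polar v1 v2 w1 w2 phi phi' m x : smooth m ->
  (forall x : R, is_derive x 1 v1 (w1 x)) ->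
  (forall x : R, is_derive x 1 v2 (w2 x)) ->
  (forall x : R, is_derive x 1 phi (phi' x)) ->
  (forall x, v1 x = m x * cos (phi x) /\ v2 x = m x * sin (phi x)) ->
  v1 x * w2 x - v2 x * w1 x = phi' x * m x ^+ 2.
Proof.
move=> /smooth_ex_derive[m' dm _] d1 d2 dphi E.
have e1 : v1 = fun x => m x * cos (phi x) by apply/funext => y; case: (E y).
have e2 : v2 = fun x => m x * sin (phi x) by apply/funext => y; case: (E y).
have dc : is_derive x 1 (fun y => cos (phi y)) (- sin (phi x) * phi' x).
  by apply: is_derive_comp_fun.
have ds : is_derive x 1 (fun y => sin (phi y)) (cos (phi x) * phi' x).
  by apply: is_derive_comp_fun.
have -> : w1 x = m' x * cos (phi x) + m x * (- sin (phi x) * phi' x).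
  have [_ <-] := d1 x; rewrite e1.
  by have [_ ->] := is_deriveM_fun (dm x) dc.
have -> : w2 x = m' x * sin (phi x) + m x * (cos (phi x) * phi' x).
  have [_ <-] := d2 x; rewrite e2.
  by have [_ ->] := is_deriveM_fun (dm x) ds.
rewrite e1 e2.
transitivity (phi' x * m x ^+ 2 * (cos (phi x) ^+ 2 + sin (phi x) ^+ 2)); first ring.
by rewrite cos2Dsin2 mulr1.
Qed.

End Calculus.

Section PlaneCurves.
Context {R : realType}.
Local Notation plane := (R * R)%type.
Implicit Types (g : R -> plane) (x t : R).

Lemma is_derive_cvgP {V W : normedModType R} (f : V -> W) (x v : V) (l : W) :
  is_derive x v f l <->
  h^-1 *: (f (h *: v + x) - f x) @[h --> (0 : R)^'] --> l.
Proof.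
split=> [[df dl]|cl].
  rewrite -dl; exact: df.
by split; [apply/cvg_ex; exists l|exact: cvg_lim cl].
Qed.

Lemma is_derive_pair (f g : R -> R) x (a b : R) :
  is_derive x 1 f a -> is_derive x 1 g b ->
  is_derive x 1 (fun y => (f y, g y)) (a, b).
Proof.
move=> /is_derive_cvgP df /is_derive_cvgP dg; apply/is_derive_cvgP.
exact: cvg_pair df dg.
Qed.

Lemma is_derive_fst g x l :
  is_derive x 1 g l -> is_derive x 1 (fun y => (g y).1) l.1.
Proof.
move=> /is_derive_cvgP dg; apply/is_derive_cvgP.
exact: (cvg_comp _ _ dg (@cvg_fst _ _ (nbhs l.1) (nbhs l.2) _)).
Qed.

Lemma is_derive_snd g x l :
  is_derive x 1 g l -> is_derive x 1 (fun y => (g y).2) l.2.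
Proof.
move=> /is_derive_cvgP dg; apply/is_derive_cvgP.
exact: (cvg_comp _ _ dg (@cvg_snd _ _ (nbhs l.1) (nbhs l.2) _)).
Qed.

Lemma smooth_curveP g : smooth_curve g <->
  smooth (fun t => (g t).1) /\ smooth (fun t => (g t).2).
Proof.
split=> [sg|[s1 s2] n].
  have d n (t : R) : is_derive t 1 (derive1n n g) (derive1n n.+1 g t).
    by split; [exact: sg|rewrite derive1nS derive1E].
  split=> k.
    suff H m : smooth_upto k (fun t => (derive1n m g t).1) by exact: (H 0%N).
    elim: k m => [//|k IH] m; exists (fun t => (derive1n m.+1 g t).1); last exact: IH.
    by move=> x; apply: is_derive_fst.
  suff H m : smooth_upto k (fun t => (derive1n m g t).2) by exact: (H 0%N).
  elim: k m => [//|k IH] m; exists (fun t => (derive1n m.+1 g t).2); last exact: IH.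
  by move=> x; apply: is_derive_snd.
suff : smooth (fun t => (derive1n n g t).1) /\ smooth (fun t => (derive1n n g t).2).
  move=> [/smooth_ex_derive[a da _] /smooth_ex_derive[b db _]] t.
  have [] := is_derive_pair (da t) (db t).
  rewrite (_ : (fun y => _) = derive1n n g)//; apply/funext => y.
  by rewrite -surjective_pairing.
elim: n => [//|n [/smooth_ex_derive[a da sa] /smooth_ex_derive[b db sb]]].
suff E : derive1n n.+1 g = fun t => (a t, b t) by rewrite E.
apply/funext => t; have [_] := is_derive_pair (da t) (db t).
rewrite (_ : (fun y => _) = derive1n n g); last first.
  by apply/funext => y; rewrite -surjective_pairing.
by rewrite derive1nS derive1E.
Qed.

End PlaneCurves.

(** * Ovals parametrized by the angle of the normal *)

Section SupportParam.
Context {R : realType}.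
Local Notation plane := (R * R)%type.
Implicit Types (C : set plane) (x t : R).

(* [x |-> (g1 x, g2 x)] parametrizes [C] by the angle of the outward normal;
   [rho] is the radius of curvature. *)
Definition support_param C (g1 g2 rho : R -> R) : Prop :=
  [/\ forall x : R, is_derive x 1 g1 (- (rho x * sin x)),
      forall x : R, is_derive x 1 g2 (rho x * cos x),
      (forall x, 0 < rho x) /\ smooth rho,
      (forall x, g1 (x + pi *+ 2) = g1 x) /\ (forall x, g2 (x + pi *+ 2) = g2 x) &
      range (fun x => (g1 x, g2 x)) = C].

Lemma periodic_int (V : Type) (f : R -> V) (T : R) :
  (forall x, f (x + T) = f x) -> forall (k : int) x, f (x + k%:~R * T) = f x.
Proof.
move=> fT; have H (n : nat) x : f (x + n%:R * T) = f x.
  elim: n x => [|n IH] x; first by rewrite mul0r addr0.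
  by rewrite -[n.+1]addn1 natrD mulrDl mul1r addrA fT.
case=> n x; first by rewrite -pmulrn H.
by rewrite NegzE mulrNz mulNr -pmulrn -(H n.+1 (x - _)) subrK.
Qed.

Lemma is_derive_shift_fun (f : R -> R) (x c a : R) :
  is_derive (x + c) 1 f a -> is_derive x 1 (fun y => f (y + c)) a.
Proof.
move=> df; rewrite -[a]mulr1.
apply: (@is_derive_comp_fun _ _ f (fun y => y + c)) => //.
rewrite -[X in is_derive _ _ _ X]addr0.
exact: is_deriveD_fun.
Qed.

Lemma derive_at_min (f f' : R -> R) (x : R) :
  (forall y : R, is_derive y 1 f (f' y)) -> (forall y, f x <= f y) -> f' x = 0.
Proof.
move=> df fmin; have [_ <-] := df x.
have ab : x - 1 <= x + 1 by lra.
have xab : x \in `]x - 1, x + 1[ by rewrite in_itv/=; lra.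
by have [_ ->] := derive1_at_min ab (fun y _ => @ex_derive _ _ _ _ _ _ _ (df y)) xab (fun y _ => fmin y).
Qed.

Lemma reduce_period (T x y : R) : 0 < T ->
  exists k : int, y <= x + k%:~R * T < y + T.
Proof.
move=> T0; exists (- Num.floor ((x - y) / T)).
rewrite mulrNz mulNr.
have := ge_floor ((x - y) / T); have := lt_succ_floor ((x - y) / T).
rewrite ltr_pdivrMr// ler_pdivlMr// intrD mulrDl mul1r => a b; lra.
Qed.

Lemma tangent_derivative C T (g : R -> plane) t : oval_param C T g ->
  is_derive t 1 (fun s => (g s).1) (derive1 g t).1 /\
  is_derive t 1 (fun s => (g s).2) (derive1 g t).2.
Proof.
move=> [_ _ [sg _] _ _].
have dg : is_derive t 1 g (derive1 g t).
  by split; [exact: (sg 0%N t)|rewrite derive1E].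
by split; [exact: is_derive_fst|exact: is_derive_snd].
Qed.

Lemma tangent_lift C T (g : R -> plane) : oval_param C T g ->
  exists phi phi' m : R -> R,
  [/\ smooth phi /\ smooth m, forall x : R, is_derive x 1 phi (phi' x),
    forall x, 0 < phi' x, forall x, 0 < m x &
    forall x, (derive1 g x).1 = m x * cos (phi x) /\
              (derive1 g x).2 = m x * sin (phi x)].
Proof.
move=> Hg; have [_ _ [sg g0] curv _] := Hg.
have [s1 s2] := (proj1 (smooth_curveP g)) sg.
have sv1 : smooth (fun t => (derive1 g t).1).
  by apply: smooth_derive s1 => t; have [] := tangent_derivative t Hg.
have sv2 : smooth (fun t => (derive1 g t).2).
  by apply: smooth_derive s2 => t; have [] := tangent_derivative t Hg.
have [|phi [phi' [m [sphi sm dphi m0 E]]]] := angle_lift sv1 sv2.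
  move=> t; apply: contra_neq (g0 t) => /eqP.
  rewrite paddr_eq0 ?sqr_ge0// !sqrf_eq0 => /andP[/eqP a /eqP b].
  by rewrite [LHS]surjective_pairing a b.
exists phi, phi', m; split => // t.
have dv t1 : is_derive t1 1 (derive1 g) (derive1n 2 g t1).
  by split; [exact: (sg 1%N t1)|rewrite derive1nS derive1E].
have d1 (t1 : R) := is_derive_fst (dv t1).
have d2 (t1 : R) := is_derive_snd (dv t1).
have := curv t; rewrite /curvature /cross.
rewrite (derive_of_polar t sm d1 d2 dphi E).
case: (ltP 0 (phi' t)) => // le0; apply: contraTT => _; rewrite -leNgt.
apply: mulr_le0_ge0; first by rewrite mulr_le0_ge0// sqr_ge0.
by rewrite invr_ge0 exprn_ge0// sqrtr_ge0.
Qed.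

Lemma oval_support C : oval C -> exists g1 g2 rho, support_param C g1 g2 rho.
Proof.
move=> [T [g Hg]]; have [[T0 gT] [ginj grange] [sg g0] _ gconv] := Hg.
have [phi [phi' [m [[sphi sm] dphi phi'0 m0 E]]]] := tangent_lift Hg.
have inc x y : x < y -> phi x < phi y by apply: derive_pos_lt.
have pi2 : 0 < (pi *+ 2 : R) by rewrite mulrn_wgt0// pi_gt0.
have vT t : derive1 g (t + T) = derive1 g t.
  rewrite /derive1.
  have -> // : (fun h => h^-1 *: (g (h + (t + T)) - g (t + T))) =
    (fun h => h^-1 *: (g (h + t) - g t)).
  by apply/funext => h; rewrite addrA !gT.
have mT t : m (t + T) = m t.
  have sq s : m s ^+ 2 = (derive1 g s).1 ^+ 2 + (derive1 g s).2 ^+ 2.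
    by have [-> ->] := E s; rewrite !exprMn -mulrDr cos2Dsin2 mulr1.
  apply/eqP; rewrite -(@eqrXn2 _ 2)// ?ltW//.
  by rewrite !sq vT.
have csT t : cos (phi (t + T)) = cos (phi t) /\ sin (phi (t + T)) = sin (phi t).
  have mn : m t != 0 by rewrite gt_eqF.
  have [a b] := E t; have [] := E (t + T); rewrite vT mT a b.
  by move=> /(mulfI mn) -> /(mulfI mn) ->.
have [c cE] : exists c, forall t, phi (t + T) = phi t + c.
  pose D : R -> R := fun t => phi (t + T) - phi t.
  have dD (t : R) : is_derive t 1 D (phi' (t + T) - phi' t).
    apply: is_deriveB_fun => //.
    exact: is_derive_shift_fun.
  have sD0 : (fun t => sin (D t)) = fun=> 0.
    by apply/funext => t; have [a b] := csT t; rewrite /D sinB a b; ring.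
  have cD1 t : cos (D t) = 1.
    have [a b] := csT t; rewrite /D cosB a b -!expr2; exact: cos2Dsin2.
  have D'0 t : phi' (t + T) - phi' t = 0.
    have := is_derive_comp_fun (dD t) (is_derive_sin (D t)).
    rewrite sD0 cD1 mul1r => -[_ <-]; exact: derive_cst.
  exists (D 0) => t; have -> : D 0 = D t.
    by apply: is_derive_0_is_cst => s; rewrite -(D'0 s).
  by rewrite /D; ring.
have c0 : 0 < c by rewrite -(ltrD2l (phi 0)) addr0 -cE inc// ltrDl.
have cZ (k : int) t : phi (t + k%:~R * T) = phi t + k%:~R * c.
  have H (n : nat) s : phi (s + n%:R * T) = phi s + n%:R * c.
    elim: n s => [|n IH] s; first by rewrite !mul0r !addr0.
    by rewrite -[n.+1]addn1 natrD !mulrDl !mul1r addrA cE IH addrA.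
  case: k => n; first by rewrite -pmulrn H.
  by rewrite NegzE mulrNz !mulNr -pmulrn; apply: (canRL (addrK _)); rewrite -H subrK.
have surj y : exists t, phi t = y.
  have [k /andP[k1 k2]] := reduce_period y (phi 0) c0.
  have [||t _ te] := @IVT R phi 0 T (y + k%:~R * c) (ltW T0).
  - by apply: continuous_subspaceT => t; exact: smooth_continuous.
  - have := cE 0; rewrite add0r => pT.
    by rewrite ge_min le_max pT k1 (ltW k2) orbT.
  by exists (t + (- k)%:~R * T); rewrite cZ te mulrNz mulNr addrK.
have [psi psiK] := choice surj.
have phiK : cancel phi psi.
  move=> t; apply/eqP; rewrite eq_le !leNgt; apply/andP.
  by split; apply/negP => /inc; rewrite psiK ltxx.
have gk (k : int) t : g (t + k%:~R * T) = g t by apply: periodic_int.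
have c2pi : c = pi *+ 2.
  have [k ck] : exists k : int, c = k%:~R * (pi *+ 2).
    have [a b] := csT 0; have [k] := cos_sin_eq a b.
    by rewrite cE => /addrI ->; exists k.
  pose t := psi (phi 0 + pi *+ 2).
  have phit : phi t = phi 0 + pi *+ 2 by rewrite psiK.
  have t0 : 0 < t.
    by rewrite ltNge le_eqVlt; apply/negP => /predU1P[H|/inc];
      move: phit; [rewrite H|move=> ->] => [/eqP|]; lra.
  have gt0 : g t = g 0.
    apply: contrapT => ne.
    have [a b] := E t; have [a' b'] := E 0.
    have ct : cos (phi t) = cos (phi 0) by rewrite phit cosD2pi.
    have st : sin (phi t) = sin (phi 0) by rewrite phit sinD2pi.
    have p1 := gconv t 0 ne; have p2 := gconv 0 t (fun e => ne (esym e)).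
    rewrite /cross a b ct st in p2; rewrite /cross a' b' in p1.
    have q1 : 0 < cos (phi 0) * ((g 0).2 - (g t).2) - sin (phi 0) * ((g 0).1 - (g t).1).
      by rewrite -(pmulr_rgt0 _ (m0 t)) mulrBr !mulrA.
    have q2 : 0 < cos (phi 0) * ((g t).2 - (g 0).2) - sin (phi 0) * ((g t).1 - (g 0).1).
      by rewrite -(pmulr_rgt0 _ (m0 0)) mulrBr !mulrA.
    have := addr_gt0 q1 q2; rewrite (_ : _ + _ = 0) ?ltxx//; ring.
  have [j] := reduce_period t 0 T0; rewrite add0r => tj.
  have tj0 : t + j%:~R * T = 0.
    by apply: ginj; rewrite ?lexx//= gk.
  have tE : t = 0 + (- j)%:~R * T by move: tj0; rewrite mulrNz mulNr; lra.
  have := cZ (- j) 0; rewrite -tE phit => /addrI e.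
  have jk : - j * k = 1.
    apply: (@intr_inj R); rewrite intrM; apply: (@mulIf _ (pi *+ 2 : R)).
      by rewrite gt_eqF.
    by rewrite -mulrA -ck mul1r.
  have k0 : 0 < k by rewrite -(@ltr0z R) -(pmulr_lgt0 _ pi2) -ck.
  have : (`|- j| * `|k|)%N = 1%N by rewrite -abszM jk.
  move=> /eqP; rewrite muln_eq1 => /andP[_ /eqP k1].
  by rewrite ck -(gtz0_abs k0) k1 mul1r.
have psiD y : psi (y + pi *+ 2) = psi y + T.
  by rewrite -[LHS]phiK psiK -(psiK y) -c2pi -cE !phiK.
have phi'n x : phi' x != 0 by rewrite gt_eqF.
have [dpsi spsi] := smooth_inverse phiK psiK dphi phi'n sphi.
pose s : R -> R := fun x => psi (x + pi / 2).
have ds (x : R) : is_derive x 1 s (phi' (s x))^-1.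
  exact: is_derive_shift_fun.
have ss : smooth s.
  by apply: smooth_comp => //; apply: smoothD; [exact: smooth_id|exact: smooth_cst].
exists (fun x => (g (s x)).1), (fun x => (g (s x)).2), (fun x => m (s x) * (phi' (s x))^-1).
split.
- move=> x; have [d1 _] := tangent_derivative (s x) Hg.
  apply: (is_deriveW (is_derive_comp_fun (ds x) d1)).
  have [-> _] := E (s x); rewrite psiK cosDpihalf; ring.
- move=> x; have [_ d1] := tangent_derivative (s x) Hg.
  apply: (is_deriveW (is_derive_comp_fun (ds x) d1)).
  have [_ ->] := E (s x); rewrite psiK sinDpihalf; ring.
- split; first by move=> x; rewrite mulr_gt0// invr_gt0.
  apply: smoothM; first exact: smooth_comp.
  apply: smoothV; first by move=> x; exact: phi'n.
  apply: smooth_comp => //; exact: smooth_derive dphi sphi.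
- by split=> x; rewrite /s addrAC psiD gT.
- rewrite -grange eqEsubset; split=> p [x _ <-]; first by exists (s x); rewrite -?surjective_pairing.
  by exists (phi x - pi / 2) => //; rewrite /s subrK phiK -surjective_pairing.
Qed.

Lemma tangent_vector_direction C g1 g2 rho x v : support_param C g1 g2 rho ->
  tangent_vector C (g1 x, g2 x) v ->
  v != 0 /\ exists l, v = (- l * sin x, l * cos x).
Proof.
move=> [d1 d2 [rho0 _] [p1 p2] rg] [T [g [t [Hg gt <-]]]].
have [_ [_ gr] [_ g0] _ gconv] := Hg.
split; first exact: g0.
set w := derive1 g t.
pose f : R -> R := fun y => w.1 * (g2 y - g2 x) - w.2 * (g1 y - g1 x).
have df (y : R) : is_derive y 1 f (w.1 * (rho y * cos y) + w.2 * (rho y * sin y)).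
  apply: (is_deriveW (is_deriveB_fun (is_deriveM_fun (is_derive_cst _ _ _)
     (is_deriveBr_fun _ (d2 y))) (is_deriveM_fun (is_derive_cst _ _ _)
     (is_deriveBr_fun _ (d1 y))))).
  ring.
have fx : f x = 0 by rewrite /f !subrr !mulr0 subr0.
have f0 y : f x <= f y.
  rewrite fx; have [s _ gs] : range g (g1 y, g2 y) by rewrite gr -rg; exists y.
  case: (pselect (g s = g t)) => [e|ne].
    by move: e; rewrite gs gt => -[e1 e2]; rewrite /f e1 e2 !subrr !mulr0 subr0.
  by have := gconv s t ne; rewrite gs gt /cross /= => /ltW.
have : w.1 * (rho x * cos x) + w.2 * (rho x * sin x) = 0.
  exact: derive_at_min df f0.
move=> /eqP; rewrite mulrCA [w.2 * _]mulrCA -mulrDr mulf_eq0 gt_eqF//= => /eqP e.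
have E : cos x ^+ 2 + sin x ^+ 2 = 1 by exact: cos2Dsin2.
exists (w.2 * cos x - w.1 * sin x); rewrite [LHS]surjective_pairing; congr pair.
  transitivity (w.1 * (cos x ^+ 2 + sin x ^+ 2)); first by rewrite E mulr1.
  by have -> : w.1 * (cos x ^+ 2 + sin x ^+ 2) = - (w.2 * cos x - w.1 * sin x) * sin x + cos x * (w.1 * cos x + w.2 * sin x) by [ring]; rewrite e mulr0 addr0.
transitivity (w.2 * (cos x ^+ 2 + sin x ^+ 2)); first by rewrite E mulr1.
by have -> : w.2 * (cos x ^+ 2 + sin x ^+ 2) = (w.2 * cos x - w.1 * sin x) * cos x + sin x * (w.1 * cos x + w.2 * sin x) by [ring]; rewrite e mulr0 addr0.
Qed.

End SupportParam.

Section MoreCalculus.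
Context {R : realType}.
Implicit Types (f g : R -> R) (a b x : R).

Lemma mean_value_seg f f' a b :
  (forall x : R, a <= x <= b -> is_derive x 1 f (f' x)) -> a < b ->
  exists c, a < c < b /\ f b - f a = f' c * (b - a).
Proof.
move=> df ab; have [||c cab E] := @MVT R f f' a b ab.
- by move=> x; rewrite in_itv/= => /andP[ax xb]; apply: df; rewrite !ltW.
- apply: derivable_within_continuous => x; rewrite in_itv/= => /df xx.
  exact: ex_derive.
by exists c; split => //; move: cab; rewrite in_itv.
Qed.

Lemma derive_neg_gt f f' a b : (forall x : R, is_derive x 1 f (f' x)) ->
  (forall x, a < x < b -> f' x < 0) -> a < b -> f b < f a.
Proof.
move=> df f'0 ab; have [c [cab E]] := mean_value df ab.
by rewrite -subr_lt0 E nmulr_rlt0 ?f'0 ?subr_gt0.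
Qed.

Lemma sin_lt0 x : pi < x < pi *+ 2 -> sin x < 0.
Proof.
move=> /andP[a b]; rewrite -(subrK pi x) sinDpi oppr_lt0 sin_gt0_pi//.
by rewrite subr_gt0 a ltrBlDr -mulr2n.
Qed.

Lemma cvg_pair2 (T : Type) (F : set_system T) (FF : Filter F) (f g : T -> R) a b :
  f @ F --> a -> g @ F --> b -> (f x, g x) @[x --> F] --> (a, b).
Proof. exact: cvg_pair. Qed.

Lemma collinear_segment (a b p : R * R) : a <> b -> cross (a - p) (b - p) = 0 ->
  exists l : R, p = (a.1 + l * (b.1 - a.1), a.2 + l * (b.2 - a.2)).
Proof.
case: a b p => [a1 a2] [b1 b2] [p1 p2] ab; rewrite /cross /= => c.
have N0 : (b1 - a1) ^+ 2 + (b2 - a2) ^+ 2 != 0.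
  apply/negP; rewrite paddr_eq0 ?sqr_ge0// !sqrf_eq0 !subr_eq0 => /andP[/eqP e /eqP e'].
  by apply: ab; rewrite e e'.
exists (((p1 - a1) * (b1 - a1) + (p2 - a2) * (b2 - a2)) / ((b1 - a1) ^+ 2 + (b2 - a2) ^+ 2)).
have c' : (a1 - p1) * (b2 - p2) = (a2 - p2) * (b1 - p1) by apply/eqP; rewrite -subr_eq0 c.
congr pair; apply: (mulIf N0); rewrite mulrDl mulrAC divfK//.
  have : (a1 - p1) * (b2 - p2) * (b2 - a2) = (a2 - p2) * (b1 - p1) * (b2 - a2) by rewrite c'.
  by lra.
have : (a1 - p1) * (b2 - p2) * (b1 - a1) = (a2 - p2) * (b1 - p1) * (b1 - a1) by rewrite c'.
by lra.
Qed.

End MoreCalculus.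

Section SupportGeometry.
Context {R : realType}.
Local Notation plane := (R * R)%type.
Variables (C : set plane) (g1 g2 rho : R -> R).
Hypothesis HS : support_param C g1 g2 rho.
Implicit Types (p : plane) (x y z : R).

Definition gap p x : R := cos x * (g1 x - p.1) + sin x * (g2 x - p.2).
Definition gam x : plane := (g1 x, g2 x).

Lemma dg1 x : is_derive x 1 g1 (- (rho x * sin x)). Proof. by case: HS. Qed.
Lemma dg2 x : is_derive x 1 g2 (rho x * cos x). Proof. by case: HS. Qed.
Lemma rho_gt0 x : 0 < rho x. Proof. by case: HS => _ _ []. Qed.
Lemma smooth_rho : smooth rho. Proof. by case: HS => _ _ []. Qed.
Lemma gam_in x : C (gam x). Proof. by case: HS => _ _ _ _ <-; exists x. Qed.
Lemma gam_surj p : C p -> exists x, p = gam x.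
Proof. by case: HS => _ _ _ _ <- [x _ <-]; exists x. Qed.

Lemma gam_period x : gam (x + pi *+ 2) = gam x.
Proof. by case: HS => _ _ _ [a b] _; rewrite /gam a b. Qed.

Lemma g1_period x : g1 (x + pi *+ 2) = g1 x. Proof. by case: (gam_period x). Qed.
Lemma g2_period x : g2 (x + pi *+ 2) = g2 x. Proof. by case: (gam_period x). Qed.

Lemma smooth_g1 : smooth g1.
Proof.
apply: (smooth_of_derive dg1); apply: smoothN; apply: smoothM.
  exact: smooth_rho.
exact: smooth_sin.
Qed.

Lemma smooth_g2 : smooth g2.
Proof.
apply: (smooth_of_derive dg2); apply: smoothM.
  exact: smooth_rho.
exact: smooth_cos.
Qed.

Lemma gap_period p x : gap p (x + pi *+ 2) = gap p x.
Proof. by rewrite /gap cosD2pi sinD2pi g1_period g2_period. Qed.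

Let D x y := cos x * g1 y + sin x * g2 y.

Let dD x y : is_derive y 1 (D x) (- (rho y * sin (y - x))).
Proof.
apply: (is_deriveW (is_deriveD_fun (is_deriveMl_fun _ (dg1 y))
  (is_deriveMl_fun _ (dg2 y)))).
by rewrite sinB /cst; ring.
Qed.

Lemma support_decr x y z : x <= y -> y < z -> z <= x + pi ->
  cos x * g1 z + sin x * g2 z < cos x * g1 y + sin x * g2 y.
Proof.
move=> xy yz zx; apply: (derive_neg_gt (dD x)) => // t /andP[ty tz].
rewrite oppr_lt0 mulr_gt0 ?rho_gt0// sin_gt0_pi//; apply/andP; split; lra.
Qed.

Lemma support_incr x y z : x + pi <= y -> y < z -> z <= x + pi *+ 2 ->
  cos x * g1 y + sin x * g2 y < cos x * g1 z + sin x * g2 z.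
Proof.
move=> xy yz zx; apply: (derive_pos_lt (dD x)) => // t /andP[ty tz].
by rewrite oppr_gt0 nmulr_llt0 ?rho_gt0// sin_lt0//; apply/andP; split; lra.
Qed.

Lemma support_lt x y : x < y < x + pi *+ 2 ->
  0 < cos x * (g1 x - g1 y) + sin x * (g2 x - g2 y).
Proof.
move=> /andP[xy yx].
have -> : cos x * (g1 x - g1 y) + sin x * (g2 x - g2 y) = D x x - D x y.
  by rewrite /D; ring.
rewrite subr_gt0; have [yp|yp] := leP y (x + pi); first exact: support_decr.
have -> : D x x = D x (x + pi *+ 2) by rewrite /D g1_period g2_period.
by apply: support_incr => //; exact: ltW.
Qed.

Lemma gap_gam x y : x < y < x + pi *+ 2 -> 0 < gap (gam y) x.
Proof. exact: support_lt. Qed.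

Lemma gap_gam' x y : y < x < y + pi *+ 2 -> 0 < gap (gam y) x.
Proof.
move=> /andP[yx xy]; rewrite -gam_period; apply: support_lt.
by rewrite xy ltrD2r.
Qed.

Lemma gap_gamxx x : gap (gam x) x = 0.
Proof. by rewrite /gap !subrr !mulr0 addr0. Qed.

Lemma gam_reduce x y : exists2 z, y <= z < y + pi *+ 2 & exists k : int, z = x + k%:~R * (pi *+ 2).
Proof.
have pi2 : 0 < (pi *+ 2 : R) by rewrite mulrn_wgt0// pi_gt0.
by have [k yk] := reduce_period x y pi2; exists (x + k%:~R * (pi *+ 2)) => //; exists k.
Qed.

Lemma gam_periodz (k : int) x : gam (x + k%:~R * (pi *+ 2)) = gam x.
Proof. by apply: periodic_int => y; exact: gam_period. Qed.

Lemma gap_gam_ge0 x y : 0 <= gap (gam y) x.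
Proof.
have [z /andP[xz zx] [k zE]] := gam_reduce y x.
rewrite -(gam_periodz k) -zE; move: xz; rewrite le_eqVlt => /predU1P[<-|xz].
  by rewrite gap_gamxx.
by apply/ltW/gap_gam; rewrite xz.
Qed.

Lemma gap_gam_eq0 x y : gap (gam y) x = 0 -> exists k : int, y = x + k%:~R * (pi *+ 2).
Proof.
have [z /andP[xz zx] [k zE]] := gam_reduce y x.
rewrite -(gam_periodz k) -zE; move: xz; rewrite le_eqVlt => /predU1P[xz _|xz].
  by exists (- k); rewrite xz zE mulrNz mulNr addrK.
by move=> e; have := @gap_gam x z; rewrite xz zx e ltxx => /(_ isT).
Qed.

Lemma gam_inj x y : gam x = gam y -> exists k : int, y = x + k%:~R * (pi *+ 2).
Proof. by move=> e; apply: gap_gam_eq0; rewrite -e gap_gamxx. Qed.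

Lemma gam_neq x y : x < y < x + pi *+ 2 -> gam x <> gam y.
Proof. by move=> /gap_gam + e; rewrite -e gap_gamxx ltxx. Qed.

Lemma triple_cross x y z : x < y -> y < z -> z < x + pi *+ 2 ->
  0 < cross (gam y - gam x) (gam z - gam x).
Proof.
move=> xy yz zx.
pose a : R -> R := fun t => cos x * (g2 t - g2 x) - sin x * (g1 t - g1 x).
pose b : R -> R := fun t => cos x * (g1 x - g1 t) + sin x * (g2 x - g2 t).
have b0 t : x < t < x + pi *+ 2 -> 0 < b t by exact: support_lt.
have da (t : R) : is_derive t 1 a (rho t * cos (t - x)).
  apply: (is_deriveW (is_deriveB_fun
   (is_deriveMl_fun _ (is_deriveBr_fun _ (dg2 t)))
   (is_deriveMl_fun _ (is_deriveBr_fun _ (dg1 t))))).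
  by rewrite cosB /cst; ring.
have db (t : R) : is_derive t 1 b (rho t * sin (t - x)).
  apply: (is_deriveW (is_deriveD_fun
   (is_deriveMl_fun _ (is_deriveBl_fun _ (dg1 t)))
   (is_deriveMl_fun _ (is_deriveBl_fun _ (dg2 t))))).
  by rewrite sinB /cst; ring.
pose m : R -> R := fun t => a t * (b t)^-1.
pose m' : R -> R := fun t => (rho t * cos (t - x) * b t - a t * (rho t * sin (t - x))) / (b t) ^+ 2.
have E1 : cos x ^+ 2 = 1 - sin x ^+ 2 by exact: cos2sin2.
have [t|c [/andP[yc cz] E]] := @mean_value_seg R m m' y z _ yz.
  move=> /andP[yt tz]; have bt : b t != 0.
    by rewrite gt_eqF// b0// (lt_le_trans xy yt) (le_lt_trans tz zx).
  apply: (is_deriveW (is_deriveM_fun (da t) (is_deriveV_fun (f := b) bt (db t)))).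
  by rewrite /m'; field.
have m'c : m' c < 0.
  have N0 : rho c * cos (c - x) * b c - a c * (rho c * sin (c - x)) < 0.
    have -> : rho c * cos (c - x) * b c - a c * (rho c * sin (c - x)) =
       - (rho c * gap (gam x) c).
      by rewrite /a /b /gap /gam /= cosB sinB; ring: E1.
    by rewrite oppr_lt0 mulr_gt0 ?rho_gt0// gap_gam'//; apply/andP; split; lra.
  rewrite /m' nmulr_rlt0// invr_gt0 exprn_gt0// b0// (lt_trans xy yc).
  exact: lt_trans cz zx.
have mm : m z - m y < 0 by rewrite E nmulr_rlt0// subr_gt0.
have by0 : 0 < b y by apply: b0; rewrite xy; lra.
have bz0 : 0 < b z by apply: b0; rewrite zx; lra.
have -> : cross (gam y - gam x) (gam z - gam x) = (m y - m z) * (b y * b z).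
  transitivity (a y * b z - b y * a z).
    by rewrite /a /b /cross /gam /=; ring: E1.
  by rewrite /m; field; rewrite !gt_eqF.
by rewrite mulr_gt0 ?mulr_gt0// -opprB oppr_gt0.
Qed.

Lemma dgap p x :
  is_derive x 1 (gap p) (- sin x * (g1 x - p.1) + cos x * (g2 x - p.2)).
Proof.
apply: (is_deriveW (is_deriveD_fun
   (is_deriveM_fun (is_derive_cos x) (is_deriveBr_fun _ (dg1 x)))
   (is_deriveM_fun (is_derive_sin x) (is_deriveBr_fun _ (dg2 x))))).
by ring.
Qed.

Lemma gap_ge0_eq0 p x : (forall y, 0 <= gap p y) -> gap p x = 0 -> p = gam x.
Proof.
move=> p0 px0.
have := derive_at_min (dgap p) (x := x); rewrite px0 => /(_ p0) d.
move: px0; rewrite /gap => e; rewrite [p]surjective_pairing /gam; congr pair.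
  apply/esym/eqP; rewrite -subr_eq0; apply/eqP.
  transitivity ((cos x ^+ 2 + sin x ^+ 2) * (g1 x - p.1)); first by rewrite cos2Dsin2 mul1r.
  transitivity (cos x * (cos x * (g1 x - p.1) + sin x * (g2 x - p.2)) -
     sin x * (- sin x * (g1 x - p.1) + cos x * (g2 x - p.2))); first by ring.
  by rewrite e d !mulr0 subr0.
apply/esym/eqP; rewrite -subr_eq0; apply/eqP.
transitivity ((cos x ^+ 2 + sin x ^+ 2) * (g2 x - p.2)); first by rewrite cos2Dsin2 mul1r.
transitivity (sin x * (cos x * (g1 x - p.1) + sin x * (g2 x - p.2)) +
     cos x * (- sin x * (g1 x - p.1) + cos x * (g2 x - p.2))); first by ring.
by rewrite e d !mulr0 addr0.
Qed.

Lemma gap_lip p q x : `|gap p x - gap q x| <= `|p.1 - q.1| + `|p.2 - q.2|.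
Proof.
have -> : gap p x - gap q x = cos x * (q.1 - p.1) + sin x * (q.2 - p.2).
  by rewrite /gap; ring.
rewrite (le_trans (ler_normD _ _))// !normrM [`|q.1 - _|]distrC [`|q.2 - _|]distrC.
by rewrite lerD// ler_piMl// ?cos_max ?sin_max.
Qed.

Definition inner : set plane := [set p | forall x, 0 < gap p x].

Lemma open_inner : open inner.
Proof.
rewrite openE => p Hp /=.
have cg : continuous (gap p) by move=> x; exact: is_derive_continuous (dgap p x).
have pi2 : 0 <= (pi *+ 2 : R) by rewrite mulrn_wge0// pi_ge0.
have [c _ cmin] := EVT_min pi2 (continuous_subspaceT cg).
pose e := gap p c / 2; have e0 : 0 < e by rewrite divr_gt0// Hp.
apply/nbhs_ballP; exists e => //= q [/= q1 q2] x.
have [z /andP[z0 zpi] [k zE]] := gam_reduce x 0.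
have -> : gap q x = gap q z.
  by rewrite zE periodic_int// => y; exact: gap_period.
have := cmin z; rewrite in_itv/= z0 -[pi *+ 2]add0r (ltW zpi) => /(_ isT) cz.
have := gap_lip p q z; rewrite ler_norml => /andP[_ ?].
move: q1 q2; rewrite /ball/= => q1 q2; rewrite /e in q1 q2; lra.
Qed.

Lemma inner_compl p : inner p -> ~ C p.
Proof.
by move=> ip /gam_surj[x px]; have := ip x; rewrite px gap_gamxx ltxx.
Qed.

Lemma gap_ge0_bounded : exists M : R, forall p, (forall x, 0 <= gap p x) ->
  `|p.1| <= M /\ `|p.2| <= M.
Proof.
exists (`|g1 0| + `|g1 pi| + `|g2 (pi / 2)| + `|g2 (- (pi / 2))|) => p ip.
have := ip 0; have := ip pi; have := ip (pi / 2); have := ip (- (pi / 2)).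
rewrite /gap cosN sinN cos0 sin0 cospi sinpi cos_pihalf sin_pihalf => a b c d.
have n1 := normr_ge0 (g1 0); have n2 := normr_ge0 (g1 pi).
have n3 := normr_ge0 (g2 (pi / 2)); have n4 := normr_ge0 (g2 (- (pi / 2))).
have := ler_norm (g1 0); have := ler_norm (- g1 pi).
have := ler_norm (g2 (pi / 2)); have := ler_norm (- g2 (- (pi / 2))).
rewrite !normrN !ler_norml => *; split; apply/andP; split; lra.
Qed.

Lemma gap_ge0_cases p : (forall x, 0 <= gap p x) -> inner p \/ C p.
Proof.
move=> p0; case: (pselect (inner p)) => [|/existsNP[x /negP]]; first by left.
rewrite -leNgt => px; right.
by rewrite (@gap_ge0_eq0 p x p0); [exact: gam_in|apply/eqP; rewrite eq_le px p0].
Qed.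

Lemma closed_gap_ge0 : closed [set p | forall x, 0 <= gap p x].
Proof.
move=> p /= clp x; rewrite leNgt; apply/negP => px.
pose e := - gap p x / 2; have e0 : 0 < e by rewrite divr_gt0// oppr_gt0.
have [q [/= q0 [/= q1 q2]]] := clp _ (nbhsx_ballx p e e0).
have := gap_lip p q x; rewrite ler_norml => /andP[? _]; have := q0 x.
move: q1 q2; rewrite /ball/= /e => *; lra.
Qed.

Lemma region_inner : region C = inner.
Proof.
rewrite eqEsubset; split => p /=.
  move=> [Cp bp]; apply: contrapT => /existsNP[x /negP]; rewrite -leNgt => px.
  pose ray : R -> plane := fun s => (p.1 + s * cos x, p.2 + s * sin x).
  have rC : ray @` `[0, +oo[ `<=` ~` C.
    move=> _ [s /= s0 <-] /gam_surj[y ry].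
    have := gap_gam_ge0 x y; rewrite -ry.
    have -> : gap (ray s) x = gap p x - s * (cos x ^+ 2 + sin x ^+ 2) by rewrite /gap /=; ring.
    move: s0; rewrite in_itv/= andbT cos2Dsin2 mulr1 le_eqVlt => /predU1P[s0|s0]; last lra.
    by move: ry; rewrite -s0 /ray !mul0r !addr0 -surjective_pairing => rp; move: Cp; rewrite rp; case; exact: gam_in.
  have cr : continuous ray.
    have ca (u v : R) : continuous (fun s : R => u + s * v).
    by move=> s; apply: cvgD; [exact: cvg_cst|apply: cvgM; [exact: cvg_id|exact: cvg_cst]].
  by move=> s; apply: cvg_pair2; exact: ca.
  have conr : connected (ray @` `[0, +oo[).
    apply: connected_continuous_connected; last exact: continuous_subspaceT.
    by apply/connected_intervalP; exact: interval_is_interval.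
  have r0 : (ray @` `[0, +oo[) p.
    exists 0; first by rewrite /= in_itv/= lexx.
    by rewrite /ray !mul0r !addr0 -surjective_pairing.
  have sub := connected_component_max r0 rC conr.
  have [M [Mr HM]] := bp.
  pose B : R := `|M| + 1; have B0 : M < B by rewrite /B (le_lt_trans (ler_norm _))// ltrDl.
  pose s : R := (B + `|p.1| + `|p.2| + 1) * 2.
  have s0 : 0 <= s.
    by rewrite mulr_ge0// !addr_ge0.
  have := HM B B0 (ray s); rewrite /globally /= => /(_ (sub _ _)).
  have : (ray @` `[0, +oo[) (ray s) by exists s => //=; rewrite in_itv/= s0.
  move=> rs /(_ rs); rewrite prod_normE ge_max => /andP[/= b1 b2].
  have c1 : `|s * cos x| <= B + `|p.1|.
    have -> : s * cos x = (p.1 + s * cos x) - p.1 by ring.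
    by rewrite (le_trans (ler_normB _ _))// lerD2r.
  have c2 : `|s * sin x| <= B + `|p.2|.
    have -> : s * sin x = (p.2 + s * sin x) - p.2 by ring.
    by rewrite (le_trans (ler_normB _ _))// lerD2r.
  rewrite (normrM s) (ger0_norm s0) in c1; rewrite (normrM s) (ger0_norm s0) in c2.
  have cs : 1 <= `|cos x| + `|sin x|.
    rewrite -(@cos2Dsin2 R x) -!(@real_normK _ (_ x)) ?num_real// !expr2.
    by rewrite lerD// ler_piMr// ?cos_max ?sin_max.
  have : s * 1 <= s * (`|cos x| + `|sin x|) by rewrite ler_wpM2l.
  have := normr_ge0 p.1; have := normr_ge0 p.2; have := normr_ge0 M.
  have sE : s = (B + `|p.1| + `|p.2| + 1) * 2 by [].
  have BE : B = `|M| + 1 by [].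
  clearbody s B; rewrite mulrDr mulr1 => *; lra.
move=> ip; split; first exact: inner_compl.
have [M HM] := gap_ge0_bounded.
suff sub : connected_component (~` C) p `<=` inner.
  exists M; split; first exact: num_real.
  move=> B MB q /sub iq; have [q1 q2] := HM q (fun x => ltW (iq x)).
  by rewrite /= prod_normE ge_max (le_trans q1) ?(le_trans q2)// ltW.
set K := connected_component _ _.
have conK : connected K by exact: component_connected.
have KC : K `<=` ~` C by exact: connected_component_sub.
have Kp : K p by apply: connected_component_refl; exact: inner_compl.
have E : K `&` inner = K.
  apply: conK; first by exists p.
  - by exists inner => //; exact: open_inner.
  - exists [set p | forall x, 0 <= gap p x]; first exact: closed_gap_ge0.
    rewrite eqEsubset; split=> q [Kq iq]; split=> //.
      by move=> x; exact: ltW.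
    by case: (gap_ge0_cases iq) => // /(KC _ Kq).
by rewrite -E => q [].
Qed.

Lemma inner_mid p q (l : R) : inner p -> (forall x, 0 <= gap q x) -> 0 < l -> l <= 1 ->
  inner (q.1 + l * (p.1 - q.1), q.2 + l * (p.2 - q.2)).
Proof.
move=> ip q0 l0 l1 x; have -> : gap (q.1 + l * (p.1 - q.1), q.2 + l * (p.2 - q.2)) x =
   (1 - l) * gap q x + l * gap p x by rewrite /gap /=; ring.
by rewrite ltr_wpDl ?mulr_gt0 ?ip// mulr_ge0// subr_ge0.
Qed.

Lemma inner_chord x y (l : R) : x < y < x + pi *+ 2 -> 0 < l < 1 ->
  inner (g1 x + l * (g1 y - g1 x), g2 x + l * (g2 y - g2 x)).
Proof.
move=> xy /andP[l0 l1] z.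
have -> : gap (g1 x + l * (g1 y - g1 x), g2 x + l * (g2 y - g2 x)) z =
  (1 - l) * gap (gam x) z + l * gap (gam y) z by rewrite /gap /=; ring.
have a := gap_gam_ge0 z x; have b := gap_gam_ge0 z y.
rewrite lt_neqAle addr_ge0 ?mulr_ge0 ?subr_ge0// ?ltW// andbT eq_sym.
rewrite paddr_eq0 ?mulr_ge0 ?subr_ge0// ?ltW//; apply/negP => /andP[].
rewrite !mulf_eq0 subr_eq0 [1 == l]gt_eqF// [l == 0]gt_eqF//= => /eqP e1 /eqP e2.
apply: (gam_neq xy).
by rewrite (gap_ge0_eq0 (gap_gam_ge0^~ x) e1) (gap_ge0_eq0 (gap_gam_ge0^~ y) e2).
Qed.

Lemma inner_nonempty : exists p, inner p.
Proof.
have p0 := @pi_gt0 R.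
exists (g1 0 + 2^-1 * (g1 pi - g1 0), g2 0 + 2^-1 * (g2 pi - g2 0)).
by apply: inner_chord; lra.
Qed.

Lemma closure_inner : closure inner = [set p | forall x, 0 <= gap p x].
Proof.
rewrite eqEsubset; split.
  rewrite closureE; apply: smallest_sub; first exact: closed_gap_ge0.
  by move=> p ip x; exact: ltW.
move=> p p0 B /nbhs_ballP[e /= e0 eB].
have [w iw] := inner_nonempty.
pose M := `|w.1 - p.1| + `|w.2 - p.2| + 1.
have n1 := normr_ge0 (w.1 - p.1); have n2 := normr_ge0 (w.2 - p.2).
have M0 : 0 < M by rewrite /M; lra.
pose l := Num.min 1 (e / M).
have l0 : 0 < l by rewrite /l lt_min ltr01 divr_gt0.
have l1 : l <= 1 by rewrite /l ge_min lexx.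
exists (p.1 + l * (w.1 - p.1), p.2 + l * (w.2 - p.2)); split.
  exact: inner_mid.
have lM : l * M <= e by rewrite -ler_pdivlMr// /l ge_min lexx orbT.
apply: eB; split; rewrite /ball/= opprD addrA subrr add0r normrN normrM (gtr0_norm l0).
  by apply: lt_le_trans lM; rewrite ltr_pM2l// /M; lra.
by apply: lt_le_trans lM; rewrite ltr_pM2l// /M; lra.
Qed.

End SupportGeometry.

Lemma cvg_apply {R : realType} (T : Type) (F : set_system T) (FF : Filter F)
    (g : R -> R) (f : T -> R) (a : R) : continuous g ->
  f x @[x --> F] --> a -> g (f x) @[x --> F] --> g a.
Proof. by move=> cg fa; apply: (continuous_cvg FF (cg a) fa). Qed.

Lemma crossC {R : realType} (u v : R * R) : cross u v = - cross v u.
Proof. by rewrite /cross; ring. Qed.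

(** * The chord through a point whose image has a given direction *)

Section Chords.
Context {R : realType}.
Local Notation plane := (R * R)%type.
Variables (C : set plane) (g1 g2 rho : R -> R).
Hypothesis HS : support_param C g1 g2 rho.
Implicit Types (p q : plane) (x y th s t : R).

Local Notation gm := (gam g1 g2).
Local Notation gp := (gap g1 g2).
Local Notation inn := (inner g1 g2).

Definition antipode_gap th s t : R :=
  cos th * (g1 (s + pi) - g1 (t + pi)) + sin th * (g2 (s + pi) - g2 (t + pi)).

(* For [p] inside the curve, [gm s] and [gm t] are the ends of the chord
   through [p] whose image under [Phi] has normal angle [th]. *)
Definition chord p th s t : Prop :=
  [/\ th < t < th + pi, th + pi < s < th + pi *+ 2,
      antipode_gap th s t = 0 & cross (gm s - p) (gm t - p) = 0].

Definition admissible p th : Prop :=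
  [/\ forall x, 0 <= gp p x, 0 < gp p th & 0 < gp p (th + pi)].

Lemma inner_admissible p th : inn p -> admissible p th.
Proof. by move=> ip; split => // x; exact: ltW. Qed.

Lemma near_cross_pos p c : 0 < gp p c -> exists2 d : R, 0 < d &
  forall q x y, `|q.1 - p.1| < d -> `|q.2 - p.2| < d -> `|x - c| < d ->
    `|y - c| < d -> x < y -> 0 < cross (gm x - q) (gm y - q).
Proof.
move=> pc.
pose K : plane * R * R -> R := fun z =>
  cos z.2 * (g1 z.1.2 - z.1.1.1) + sin z.2 * (g2 z.1.2 - z.1.1.2).
have cg1 := smooth_continuous (smooth_g1 HS).
have cg2 := smooth_continuous (smooth_g2 HS).
have c2 : (fun z : plane * R * R => z.2) @ nbhs (p, c, c) --> c by exact: cvg_snd.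
have c1 : (fun z : plane * R * R => z.1) @ nbhs (p, c, c) --> (p, c) by exact: cvg_fst.
have c12 : (fun z : plane * R * R => z.1.2) @ nbhs (p, c, c) --> c.
  exact: (cvg_comp _ _ c1 (@cvg_snd _ _ (nbhs p) (nbhs c) _)).
have c11 : (fun z : plane * R * R => z.1.1) @ nbhs (p, c, c) --> p.
  exact: (cvg_comp _ _ c1 (@cvg_fst _ _ (nbhs p) (nbhs c) _)).
have c111 : (fun z : plane * R * R => z.1.1.1) @ nbhs (p, c, c) --> p.1.
  exact: (cvg_comp _ _ c11 (@cvg_fst _ _ (nbhs p.1) (nbhs p.2) _)).
have c112 : (fun z : plane * R * R => z.1.1.2) @ nbhs (p, c, c) --> p.2.
  exact: (cvg_comp _ _ c11 (@cvg_snd _ _ (nbhs p.1) (nbhs p.2) _)).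
have cK : K @ nbhs (p, c, c) --> gp p c.
  apply: cvgD; apply: cvgM.
  - exact: (continuous_cvg _ (@continuous_cos R c) c2).
  - by apply: cvgB => //; exact: (continuous_cvg _ (cg1 c) c12).
  - exact: (continuous_cvg _ (@continuous_sin R c) c2).
  - by apply: cvgB => //; exact: (continuous_cvg _ (cg2 c) c12).
have : \forall z \near nbhs (p, c, c), 0 < K z by apply: (cvgr_gt _ cK).
move=> /nbhs_ballP[d /= d0 Hd].
exists d => // q x y q1 q2 xc yc xy.
pose f : R -> R := fun u => (g1 x - q.1) * (g2 u - q.2) - (g2 x - q.2) * (g1 u - q.1).
have df (u : R) : is_derive u 1 f (rho u * K (q, x, u)).
  apply: (is_deriveW (is_deriveB_fun
    (is_deriveMl_fun _ (is_deriveBr_fun _ (dg2 HS u)))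
    (is_deriveMl_fun _ (is_deriveBr_fun _ (dg1 HS u))))).
  by rewrite /K /cst /=; ring.
have fx : f x = 0 by rewrite /f; ring.
rewrite /cross /= -/(f y) -fx; apply: derive_pos_lt df _ xy => u /andP[xu uy].
rewrite mulr_gt0 ?(rho_gt0 HS)//; apply: Hd.
have uc : `|u - c| < d.
  move: xc yc; rewrite !ltr_norml => /andP[a b] /andP[a' b']; apply/andP; split; lra.
by split => //=; [split => //=; [split => //=|]|]; rewrite /ball/= distrC.
Qed.

Lemma chord_param p s t : t < s < t + pi *+ 2 -> cross (gm s - p) (gm t - p) = 0 ->
  exists l, [/\ p = (g1 t + l * (g1 s - g1 t), g2 t + l * (g2 s - g2 t)),
     0 <= gp p t -> 0 <= l, 0 < gp p t -> 0 < l,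
     0 <= gp p s -> l <= 1 & 0 < gp p s -> l < 1].
Proof.
move=> ts; have sts : s < t + pi *+ 2 < s + pi *+ 2 by move: ts => /andP[a b]; apply/andP; split; lra.
have ne : gm t <> gm s by exact: (gam_neq HS ts).
move=> c; have c' : cross (gm t - p) (gm s - p) = 0.
  by rewrite -[RHS]oppr0 -c /cross; ring.
have [l lE] := collinear_segment ne c'; exists l.
have At : gp p t = l * gp (gm s) t.
  by rewrite lE /gap /gam /=; ring.
have As : gp p s = (1 - l) * gp (gm t) s.
  by rewrite lE /gap /gam /=; ring.
have G1 : 0 < gp (gm s) t by exact: (gap_gam HS).
have G2 : 0 < gp (gm t) s by exact: (gap_gam' HS).
split => //.
- by rewrite At pmulr_lge0.
- by rewrite At pmulr_lgt0.
- by rewrite As pmulr_lge0// subr_ge0.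
- by rewrite As pmulr_lgt0// subr_gt0.
Qed.

(* Chords cut off nested arcs: they cannot meet inside the curve. *)
Lemma nested_chords p s t s' t' : (forall x, 0 <= gp p x) ->
  t' < t -> t < s -> s < s' -> s' < t' + pi *+ 2 ->
  cross (gm s - p) (gm t - p) = 0 -> cross (gm s' - p) (gm t' - p) = 0 -> False.
Proof.
move=> p0 tt ts ss st c c'.
have [|l [pE l0 _ l1 _]] := chord_param _ c; first by apply/andP; split; lra.
have {}l0 := l0 (p0 _); have {}l1 := l1 (p0 _).
have a : 0 < cross (gm t - gm t') (gm s' - gm t') by apply: (triple_cross HS) => //; lra.
have b : 0 < cross (gm s - gm t') (gm s' - gm t') by apply: (triple_cross HS) => //; lra.
have E : cross (gm s' - p) (gm t' - p) = (1 - l) * cross (gm t - gm t') (gm s' - gm t')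
    + l * cross (gm s - gm t') (gm s' - gm t').
  by rewrite pE /cross /gam /=; ring.
move: c'; rewrite E => /eqP; rewrite paddr_eq0; last 2 first.
- by apply: mulr_ge0; [rewrite subr_ge0|exact: ltW].
- by apply: mulr_ge0 => //; exact: ltW.
rewrite !mulf_eq0 !(gt_eqF a) !(gt_eqF b) !orbF subr_eq0 => /andP[/eqP <-].
by rewrite oner_eq0.
Qed.

Let D x y : R := cos x * g1 y + sin x * g2 y.

Let D_period x y : D x (y + pi *+ 2) = D x y.
Proof. by rewrite /D (g1_period HS) (g2_period HS). Qed.

Let antip_s th s : D th (s + pi) = D th (s - pi).
Proof. by rewrite -(D_period th (s - pi)); congr D; rewrite mulr2n; ring. Qed.

Let chord_eq p th s t : chord p th s t -> D th (s - pi) = D th (t + pi).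
Proof.
case=> _ _ + _; rewrite /antipode_gap -antip_s /D => e.
by apply/eqP; rewrite -subr_eq0 -e; apply/eqP; ring.
Qed.

Let D_decr x y (z : R) : x <= y -> y < z -> z <= x + pi -> D x z < D x y.
Proof. exact: (support_decr HS). Qed.

Let D_incr x y (z : R) : x + pi <= y -> y < z -> z <= x + pi *+ 2 -> D x y < D x z.
Proof. exact: (support_incr HS). Qed.

Lemma chord_unique p th s t s' t' : (forall x, 0 <= gp p x) ->
  chord p th s t -> chord p th s' t' -> s = s' /\ t = t'.
Proof.
move=> p0.
suff H s1 t1 s2 t2 : chord p th s1 t1 -> chord p th s2 t2 -> s1 < s2 -> False.
  move=> c c'; have ss : s = s'.
    by case: (ltgtP s s') => // h; exfalso; [exact: H c c' h|exact: H c' c h].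
  split=> //; have := chord_eq c; rewrite ss (chord_eq c').
  case: c => /andP[a b] _ _ _; case: c' => /andP[a' b'] _ _ _ e.
  case: (ltgtP t t') => // h; exfalso.
    have : D th (t + pi) < D th (t' + pi) by apply: D_incr; lra.
    by rewrite e ltxx.
  have : D th (t' + pi) < D th (t + pi) by apply: D_incr; lra.
  by rewrite e ltxx.
move=> c c' ss.
have e := chord_eq c; have e' := chord_eq c'.
case: c => /andP[a1 a2] /andP[b1 b2] _ c; case: c' => /andP[a1' a2'] /andP[b1' b2'] _ c'.
have d : D th (s2 - pi) < D th (s1 - pi) by apply: D_decr; lra.
have tt : t2 < t1.
  rewrite ltNge; apply/negP; rewrite le_eqVlt => /predU1P[h|h].
    by move: d; rewrite e e' h ltxx.
  have : D th (t1 + pi) < D th (t2 + pi) by apply: D_incr; lra.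
  by rewrite -e -e'; lra.
by apply: (nested_chords p0 tt _ ss _ c c'); lra.
Qed.

Let D_cont x : continuous (D x).
Proof.
have := smoothD (smoothM (smooth_cst (cos x)) (smooth_g1 HS))
  (smoothM (smooth_cst (sin x)) (smooth_g2 HS)).
exact: smooth_continuous.
Qed.

Let D_range x y : D x (x + pi) <= D x y <= D x x.
Proof.
have H u v : 0 <= gp (gm u) v by exact: (gap_gam_ge0 HS).
apply/andP; split.
  by have := H y (x + pi); rewrite /gap /gam /D cosDpi sinDpi /=; lra.
by have := H y x; rewrite /gap /gam /D /=; lra.
Qed.

(* The other end of the chord cut by the line through [gam (th + u)] with
   normal angle [th]. *)
Let reflect_arc th : exists sg : R -> R,
  [/\ forall u : R, 0 <= u <= pi -> 0 <= sg u <= pi /\ D th (th - sg u) = D th (th + u),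
    (forall u v : R, 0 <= u <= pi -> 0 <= v <= pi -> u < v -> sg u < sg v),
    {within `[0, pi], continuous sg}, sg 0 = 0 & sg pi = pi].
Proof.
have p0 : 0 < (pi : R) := pi_gt0 R.
have ml (w : R) : D th (th - w) = D th (th + pi *+ 2 - w).
  by rewrite -(D_period th (th - w)); congr D; ring.
have Hincr (v w : R) : 0 <= v -> v < w -> w <= pi -> D th (th - w) < D th (th - v).
  by move=> v0 vw wp; rewrite !ml; apply: D_incr; lra.
have Hdecr (v w : R) : 0 <= v -> v < w -> w <= pi -> D th (th + w) < D th (th + v).
  by move=> v0 vw wp; apply: D_decr; lra.
have ex (u : R) : exists w : R, 0 <= u <= pi -> 0 <= w <= pi /\ D th (th - w) = D th (th + u).
  have [|||x xi E] := @IVT R (D th) (th - pi) th (D th (th + u)).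
  - lra.
  - apply: continuous_subspaceT; exact: D_cont.
  - have /andP[a b] := D_range th (th + u).
    have -> : D th (th - pi) = D th (th + pi).
      by rewrite ml; congr D; ring.
    by rewrite ge_min le_max a b orbT.
  exists (th - x) => _; move: xi; rewrite in_itv/= => /andP[a b]; split; first by lra.
  by rewrite -E; congr D; ring.
have ex' (w : R) : exists u : R, 0 <= w <= pi -> 0 <= u <= pi /\ D th (th - w) = D th (th + u).
  have [|||x xi E] := @IVT R (D th) th (th + pi) (D th (th - w)).
  - lra.
  - apply: continuous_subspaceT; exact: D_cont.
  - have /andP[a b] := D_range th (th - w).
    by rewrite ge_min le_max a b orbT.
  exists (x - th) => _; move: xi; rewrite in_itv/= => /andP[a b]; split; first by lra.
  by rewrite -E; congr D; ring.
have [sg Hsg] := choice ex.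
have uniqw (v w : R) : 0 <= v <= pi -> 0 <= w <= pi -> D th (th - v) = D th (th - w) -> v = w.
  move=> v0 w0 e; case: (ltgtP v w) => // h; exfalso.
    by have := @Hincr v w; rewrite e ltxx; lra.
  by have := @Hincr w v; rewrite e ltxx; lra.
have s0 : sg 0 = 0.
  have [|a b] := Hsg 0; first by rewrite lexx ltW.
  by apply: uniqw => //; [rewrite lexx ltW|rewrite b; congr D; ring].
have spi : sg pi = pi.
  have [|a b] := Hsg pi; first by rewrite lexx ltW.
  apply: uniqw => //; first by rewrite lexx ltW.
  by rewrite b ml; congr D; ring.
have slt (u v : R) : 0 <= u <= pi -> 0 <= v <= pi -> u < v -> sg u < sg v.
  move=> u0 v0 uv; rewrite ltNge; apply/negP.
  have [/andP[a1 a2] a] := Hsg _ u0; have [/andP[b1 b2] b] := Hsg _ v0.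
  have : D th (th - sg v) < D th (th - sg u) by rewrite a b Hdecr//; lra.
  move=> h; rewrite le_eqVlt => /predU1P[e|l]; first by move: h; rewrite e ltxx.
  by have := Hincr _ _ b1 l a2; rewrite ltNge ltW.
exists sg; split => //.
have mono : {in `[0, pi] &, {mono sg : x y / x <= y}}.
  apply: le_mono_in => u v; rewrite !in_itv/= => u0 v0; exact: slt.
apply: segment_inc_surj_continuous mono _.
move=> w /=; rewrite s0 spi !in_itv/= => w0.
have [u /(_ w0)[u0 E]] := ex' w; exists u; first by rewrite /= in_itv.
have [a b] := Hsg _ u0.
by apply: uniqw => //; rewrite b E.
Qed.

Lemma chord_exists p th : admissible p th -> exists s t, chord p th s t.
Proof.
move=> [p0 pth ppi]; have pi0 : 0 < (pi : R) := pi_gt0 R.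
have [sg [Hsg slt csg s0 spi]] := reflect_arc th.
have [d1 d10 Hd1] := near_cross_pos pth.
have [d2 d20 Hd2] := near_cross_pos ppi.
pose c : R := th + pi.
pose K : R -> R := fun u => cross (gm (c + u) - p) (gm (c - sg u) - p).
have cg1 := smooth_continuous (smooth_g1 HS).
have cg2 := smooth_continuous (smooth_g2 HS).
have cK : {within `[0, pi], continuous K}.
  have ca (g : R -> R) : continuous g -> {within `[0, pi], continuous (fun u : R => g (c + u))}.
    move=> cg; apply: continuous_subspaceT => u; apply: (@cvg_apply R R (nbhs u) _ g (fun u : R => c + u) (c + u) cg).
    by apply: cvgD; [exact: cvg_cst|exact: cvg_id].
  have cb (g : R -> R) : continuous g -> {within `[0, pi], continuous (fun u : R => g (c - sg u))}.
    move=> cg u; apply: (@cvg_apply R _ (nbhs u) _ g (fun u : R => c - sg u) (c - sg u) cg).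
    by apply: cvgB; [exact: cvg_cst|exact: csg].
  move=> u; apply: cvgB; apply: cvgM; apply: cvgB; try exact: cvg_cst.
  - exact: ca cg1 u.
  - exact: cb cg2 u.
  - exact: ca cg2 u.
  - exact: cb cg1 u.
have pp (q d : R) : 0 < d -> `|q - q| < d by rewrite subrr normr0.
(* near [u = 0] both ends are close to [gam (th + pi)] and [K < 0] *)
pose e2 : R := Num.min d2 pi / 2.
have e20 : 0 < e2 by rewrite divr_gt0// lt_min d20.
have e2d : e2 * 2 <= d2 by rewrite divfK// ge_min lexx.
have e2pi : e2 * 2 <= pi by rewrite divfK// ge_min lexx orbT.
have [|||u0 + su0] := @IVT R sg 0 pi e2.
- exact: ltW.
- exact: csg.
- 
  by rewrite s0 spi ge_min le_max; lra.
rewrite in_itv/= => u0i.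
have u00 : 0 < u0.
  rewrite lt_neqAle eq_sym; move: u0i => /andP[-> _]; rewrite andbT.
  by apply/eqP => e; move: su0; rewrite e s0; lra.
pose u1 : R := Num.min u0 e2.
have u10 : 0 < u1 by rewrite lt_min u00.
have u1e : u1 <= e2 by rewrite ge_min lexx orbT.
have u1u : u1 <= u0 by rewrite ge_min lexx.
have u1i : 0 <= u1 <= pi by lra.
have su10 : 0 < sg u1 by rewrite -s0 slt// lexx ltW.
have su1 : sg u1 <= e2.
  move: u1u; rewrite le_eqVlt => /predU1P[->|l]; first by rewrite su0.
  by rewrite -su0 ltW// slt.
have K1 : K u1 < 0.
  have := Hd2 p (c - sg u1) (c + u1) (pp _ _ d20) (pp _ _ d20).
  rewrite /K -/c (addrC c u1) (addrC c (- sg u1)) !addrK normrN !ger0_norm; last 2 first.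
  - exact: ltW.
  - exact: ltW.
  by move=> h; rewrite crossC oppr_lt0; apply: h; lra.
(* near [u = pi] they are close to [gam th] and [K > 0] *)
pose e1 : R := Num.min d1 pi / 2.
have e10 : 0 < e1 by rewrite divr_gt0// lt_min d10.
have e1d : e1 * 2 <= d1 by rewrite divfK// ge_min lexx.
have e1pi : e1 * 2 <= pi by rewrite divfK// ge_min lexx orbT.
have [|||v0 + sv0] := @IVT R sg 0 pi (pi - e1).
- exact: ltW.
- exact: csg.
- 
  by rewrite s0 spi ge_min le_max; lra.
rewrite in_itv/= => v0i.
have v0pi : v0 < pi.
  rewrite lt_neqAle; move: v0i => /andP[_ ->]; rewrite andbT.
  by apply/eqP => e; move: sv0; rewrite e spi; lra.
pose v1 : R := Num.max v0 (pi - e1).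
have v1pi : v1 < pi by rewrite gt_max v0pi; lra.
have v1e : pi - e1 <= v1 by rewrite le_max lexx orbT.
have v1v : v0 <= v1 by rewrite le_max lexx.
have v1i : 0 <= v1 <= pi by lra.
have sv1pi : sg v1 < pi by rewrite -spi slt// lexx ltW.
have sv1 : pi - e1 <= sg v1.
  move: v1v; rewrite le_eqVlt => /predU1P[<-|l]; first by rewrite sv0.
  by rewrite -sv0 ltW// slt.
have K2 : 0 < K v1.
  have := Hd1 p (th - (pi - v1)) (th + (pi - sg v1)) (pp _ _ d10) (pp _ _ d10).
  rewrite /K (_ : c + v1 = th - (pi - v1) + pi *+ 2) ?(gam_period HS); last by rewrite /c; ring.
  rewrite (_ : c - sg v1 = th + (pi - sg v1)); last by rewrite /c; ring.
  have -> : th - (pi - v1) - th = - (pi - v1) by ring.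
  have -> : th + (pi - sg v1) - th = pi - sg v1 by ring.
  rewrite normrN !ger0_norm; last 2 first.
  - by rewrite subr_ge0 ltW.
  - by rewrite subr_ge0 ltW.
  by apply; lra.
have u1v1 : u1 <= v1 by move: u1e v1e e1pi e2pi; lra.
have [||u + Ku] := @IVT R K u1 v1 0 u1v1.
- apply: (continuous_subspaceW _ cK) => x /=; rewrite !in_itv/= => /andP[a b].
  by apply/andP; split; lra.
- by rewrite ge_min le_max !(ltW K1) !(ltW K2) orbT.
rewrite in_itv/= => /andP[ua ub].
have u0' : 0 < u := lt_le_trans u10 ua.
have upi : u < pi := le_lt_trans ub v1pi.
have ui : 0 <= u <= pi by rewrite !ltW.
have [sgu E] := Hsg u ui.
have sgu0 : 0 < sg u by rewrite -s0 slt// lexx ltW.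
have sgupi : sg u < pi by rewrite -spi slt// lexx ltW.
exists (c + u), (c - sg u); split => //; rewrite /c.
- by move: sgu0 sgupi; lra.
- by move: u0' upi; lra.
rewrite /antipode_gap.
have -> : th + pi + u + pi = th + u + pi *+ 2 by ring.
have -> : th + pi - sg u + pi = th - sg u + pi *+ 2 by ring.
rewrite !(g1_period HS) !(g2_period HS).
by move: E; rewrite /D; lra.
Qed.

End Chords.

Section ChordContinuity.
Context {R : realType}.
Local Notation plane := (R * R)%type.
Variables (C : set plane) (g1 g2 rho : R -> R).
Hypothesis HS : support_param C g1 g2 rho.
Implicit Types (p q : plane) (x y th s t : R).

Local Notation gm := (gam g1 g2).
Local Notation gp := (gap g1 g2).
Local Notation chord := (chord g1 g2).
Local Notation agap := (antipode_gap g1 g2).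

Let cg1 : continuous g1 := smooth_continuous (smooth_g1 HS).
Let cg2 : continuous g2 := smooth_continuous (smooth_g2 HS).

Lemma antipode_gap_cvg (I : Type) (F : set_system I) (FF : Filter F)
    (Th S T : I -> R) th s t :
  Th i @[i --> F] --> th -> S i @[i --> F] --> s -> T i @[i --> F] --> t ->
  agap (Th i) (S i) (T i) @[i --> F] --> agap th s t.
Proof.
move=> cTh cS cT.
have cSp : S i + pi @[i --> F] --> s + pi by apply: cvgD => //; exact: cvg_cst.
have cTp : T i + pi @[i --> F] --> t + pi by apply: cvgD => //; exact: cvg_cst.
apply: cvgD; apply: cvgM.
- exact: (cvg_apply FF (@continuous_cos R) cTh).
- by apply: cvgB; exact: (cvg_apply FF cg1).
- exact: (cvg_apply FF (@continuous_sin R) cTh).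
- by apply: cvgB; exact: (cvg_apply FF cg2).
Qed.

Lemma chord_cross_cvg (I : Type) (F : set_system I) (FF : Filter F)
    (P : I -> plane) (S T : I -> R) p s t :
  (P i).1 @[i --> F] --> p.1 -> (P i).2 @[i --> F] --> p.2 ->
  S i @[i --> F] --> s -> T i @[i --> F] --> t ->
  cross (gm (S i) - P i) (gm (T i) - P i) @[i --> F] --> cross (gm s - p) (gm t - p).
Proof.
move=> cP1 cP2 cS cT.
apply: cvgB; apply: cvgM; apply: cvgB => //.
- exact: (cvg_apply FF cg1).
- exact: (cvg_apply FF cg2).
- exact: (cvg_apply FF cg2).
- exact: (cvg_apply FF cg1).
Qed.

Let multiple_2pi (a b : R) (k : int) : a = b + k%:~R * (pi *+ 2) ->
  b <= a -> a < b + pi *+ 4 -> a = b \/ a = b + pi *+ 2.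
Proof.
move=> -> h1 h2; have p0 : 0 < (pi *+ 2 : R) by rewrite mulrn_wgt0// pi_gt0.
have k0 : 0 <= k by rewrite -(@ler0z R) -(pmulr_lge0 _ p0) -(lerD2l b) addr0.
have k2 : k < 2.
  rewrite -(@ltr_int R) -(ltr_pM2r p0) -(ltrD2l b).
  by rewrite (_ : 2%:~R * _ = pi *+ 4)// -[2%:~R]/(2%:R) mulr_natl -mulrnA.
by case: k k0 k2 {h1 h2} => [[|[|n]]|n]//= _ _; [left; rewrite mul0r addr0|right; rewrite mul1r].
Qed.

Lemma degenerate_chord th a b : th <= b <= th + pi -> th + pi <= a <= th + pi *+ 2 ->
  agap th a b = 0 ->
  [\/ th < b < th + pi /\ th + pi < a < th + pi *+ 2,
      b = th /\ a = th + pi *+ 2 | b = th + pi /\ a = th + pi].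
Proof.
have p0 : 0 < (pi : R) := pi_gt0 R.
move=> /andP[b1 b2] /andP[a1 a2] e.
have E1 x : gp (gm (x + pi)) th = cos th * (g1 (th + pi + pi) - g1 (x + pi)) + sin th * (g2 (th + pi + pi) - g2 (x + pi)).
  by rewrite -addrA -mulr2n (g1_period HS) (g2_period HS).
have E2 x : gp (gm (x + pi)) (th + pi) = cos th * (g1 (x + pi) - g1 (th + pi)) + sin th * (g2 (x + pi) - g2 (th + pi)).
  by rewrite /gap /gam cosDpi sinDpi /=; ring.
have E3 : agap th a (th + pi) = - gp (gm (a + pi)) th by rewrite E1 /antipode_gap; ring.
have E4 : agap th a th = gp (gm (a + pi)) (th + pi) by rewrite E2.
have E5 : agap th (th + pi) b = gp (gm (b + pi)) th by rewrite E1.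
have E6 : agap th (th + pi *+ 2) b = - gp (gm (b + pi)) (th + pi).
  rewrite E2 /antipode_gap (_ : th + pi *+ 2 + pi = th + pi + pi *+ 2); last by ring.
  by rewrite (g1_period HS) (g2_period HS); ring.
have [bt|bt] := eqVneq b th.
  move: e; rewrite bt E4 => /(gap_gam_eq0 HS)[k ak]; apply: Or32; split=> //.
  by have := multiple_2pi ak; case; lra.
have [bp|bp] := eqVneq b (th + pi).
  move: e; rewrite bp E3 => /eqP; rewrite oppr_eq0 => /eqP /(gap_gam_eq0 HS)[k ak].
  by apply: Or33; split=> //; have := multiple_2pi ak; case; lra.
have [at_|at_] := eqVneq a (th + pi).
  move: e; rewrite at_ E5 => /(gap_gam_eq0 HS)[k ak]; apply: Or33; split=> //.
  by have := multiple_2pi ak; case; lra.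
have [ap|ap] := eqVneq a (th + pi *+ 2).
  move: e; rewrite ap E6 => /eqP; rewrite oppr_eq0 => /eqP /(gap_gam_eq0 HS)[k bk].
  by apply: Or32; split=> //; have := multiple_2pi bk; case; lra.
apply: Or31; rewrite !lt_neqAle b1 b2 a1 a2 bp ap !andbT.
by rewrite eq_sym bt eq_sym at_.
Qed.

Lemma chord_cvg (I : Type) (F : set_system I) (FF : Filter F)
    (P : I -> plane) (Th S T : I -> R) p th s t :
  (P i).1 @[i --> F] --> p.1 -> (P i).2 @[i --> F] --> p.2 ->
  Th i @[i --> F] --> th -> admissible g1 g2 p th -> chord p th s t ->
  (\forall i \near F, chord (P i) (Th i) (S i) (T i)) ->
  S i @[i --> F] --> s /\ T i @[i --> F] --> t.
Proof.
move=> cP1 cP2 cTh [p0 pth ppi] cst cST; have pi0 : 0 < (pi : R) := pi_gt0 R.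
suff H (e : R) : 0 < e -> \forall i \near F, `|S i - s| < e /\ `|T i - t| < e.
  by split; apply/cvgrPdistC_lt => e /H; apply: filterS => i [].
move=> e0.
pose B : set (R * R) := `[th + pi - 1, th + pi *+ 2 + 1] `*` `[th - 1, th + pi + 1].
pose far : set (R * R) := [set z | e <= `|z.1 - s|] `|` [set z | e <= `|z.2 - t|].
have cK : compact (B `&` far).
  apply: compact_closedI.
    by apply: compact_setX; exact: segment_compact.
  apply: closedU.
    apply: (@closed_comp _ _ (fun z : R * R => `|z.1 - s|) [set x | e <= x]).
      move=> z _; apply: cvg_norm; apply: cvgB; [exact: cvg_fst|exact: cvg_cst].
    exact: closed_ge.
  apply: (@closed_comp _ _ (fun z : R * R => `|z.2 - t|) [set x | e <= x]).
    move=> z _; apply: cvg_norm; apply: cvgB; [exact: cvg_snd|exact: cvg_cst].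
  exact: closed_ge.
have [d1 d10 Hd1] := near_cross_pos HS pth.
have [d2 d20 Hd2] := near_cross_pos HS ppi.
have cov := (proj1 (compact_near_coveringP _) cK) I F
   (fun i z => ~ chord (P i) (Th i) z.1 z.2) FF.
have {}cov : \forall i \near F, B `&` far `<=` (fun z => ~ chord (P i) (Th i) z.1 z.2).
  apply: cov => -[a b] [_ fab].
  pose G := filter_prod (nbhs (a, b)) F.
  have FG : Filter G by exact: filter_prod_filter.
  have c1 : (fun y : (R * R) * I => y.1) @ G --> (a, b) by exact: cvg_fst.
  have c11 : (fun y : (R * R) * I => y.1.1) @ G --> a.
    exact: (cvg_comp _ _ c1 (@cvg_fst _ _ (nbhs a) (nbhs b) _)).
  have c12 : (fun y : (R * R) * I => y.1.2) @ G --> b.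
    exact: (cvg_comp _ _ c1 (@cvg_snd _ _ (nbhs a) (nbhs b) _)).
  have c2 : (fun y : (R * R) * I => y.2) @ G --> F by exact: cvg_snd.
  have cTh' : (fun y : (R * R) * I => Th y.2) @ G --> th by exact: (cvg_comp _ _ c2 cTh).
  have cP1' : (fun y : (R * R) * I => (P y.2).1) @ G --> p.1 by exact: (cvg_comp _ _ c2 cP1).
  have cP2' : (fun y : (R * R) * I => (P y.2).2) @ G --> p.2 by exact: (cvg_comp _ _ c2 cP2).
  suff : \forall y \near G, ~ chord (P y.2) (Th y.2) y.1.1 y.1.2 by [].
  have cA := antipode_gap_cvg FG cTh' c11 c12.
  have cC := chord_cross_cvg FG cP1' cP2' c11 c12.
  have cTp : (fun y : (R * R) * I => Th y.2 + pi) @ G --> th + pi.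
    by apply: cvgD => //; exact: cvg_cst.
  have cT2p : (fun y : (R * R) * I => Th y.2 + pi *+ 2) @ G --> th + pi *+ 2.
    by apply: cvgD => //; exact: cvg_cst.
  have [A0|A0] := eqVneq (agap th a b) 0; last first.
    by apply: filterS (cvgr_neq0 _ cA A0) => y /eqP yA [_ _ /yA].
  have [C0|C0] := eqVneq (cross (gm a - p) (gm b - p)) 0; last first.
    by apply: filterS (cvgr_neq0 _ cC C0) => y /eqP yA [_ _ _ /yA].
  have near_lt (f g : (R * R) * I -> R) (u v : R) : f @ G --> u -> g @ G --> v -> u < v ->
      \forall y \near G, f y < g y.
    move=> cf cg uv; have cgf : g y - f y @[y --> G] --> v - u by exact: cvgB.
    have vu : 0 < v - u by rewrite subr_gt0.
    by apply: filterS (cvgr_gt _ cgf _ vu) => y; rewrite subr_gt0.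
  have near_dist (f : (R * R) * I -> R) (u d : R) : f @ G --> u -> 0 < d ->
      \forall y \near G, `|f y - u| < d by move=> cf d0; exact: cvgr_distC_lt.
  have [b1|b1] := ltP b th.
    by apply: filterS (near_lt _ _ _ _ c12 cTh' b1) => y yb [/andP[h _] _ _ _]; lra.
  have [b2|b2] := ltP (th + pi) b.
    by apply: filterS (near_lt _ _ _ _ cTp c12 b2) => y yb [/andP[_ h] _ _ _]; lra.
  have [a1|a1] := ltP a (th + pi).
    by apply: filterS (near_lt _ _ _ _ c11 cTp a1) => y yb [_ /andP[h _] _ _]; lra.
  have [a2|a2] := ltP (th + pi *+ 2) a.
    by apply: filterS (near_lt _ _ _ _ cT2p c11 a2) => y yb [_ /andP[_ h] _ _]; lra.
  have [|||[bth apth]|[bth apth]|[bth ath]] := @degenerate_chord th a b.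
  - by rewrite b1 b2.
  - by rewrite a1 a2.
  - exact: A0.
  - have cab : chord p th a b by split.
    have [sa tb] := chord_unique HS p0 cab cst.
    by move: fab => []; rewrite /= ?sa ?tb subrr normr0 leNgt e0.
  - have N1 := filterI (near_dist _ _ _ cP1' d10) (near_dist _ _ _ cP2' d10).
    have N2 := filterI (near_dist _ _ _ c11 d10) (near_dist _ _ _ c12 d10).
    apply: (filterS2 _ _ (N1 FG) (N2 FG)) => y [n1 n2] [n3 n4] [/andP[h1 h2] /andP[h3 h4] _ h].
    have := Hd1 (P y.2) (y.1.1 - pi *+ 2) y.1.2 n1 n2.
    rewrite bth in n4; rewrite apth in n3.
    have -> : y.1.1 - pi *+ 2 - th = y.1.1 - (th + pi *+ 2) by ring.
    rewrite -(gam_period HS (y.1.1 - pi *+ 2)) subrK => /(_ n3 n4).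
    by rewrite h ltxx => K; suff : false by []; apply: K; lra.
  - have N1 := filterI (near_dist _ _ _ cP1' d20) (near_dist _ _ _ cP2' d20).
    have N2 := filterI (near_dist _ _ _ c11 d20) (near_dist _ _ _ c12 d20).
    apply: (filterS2 _ _ (N1 FG) (N2 FG)) => y [n1 n2] [n3 n4] [/andP[h1 h2] /andP[h3 h4] _ h].
    rewrite bth in n4; rewrite ath in n3.
    have := Hd2 (P y.2) y.1.2 y.1.1 n1 n2 n4 n3.
    by rewrite crossC h oppr0 ltxx => K; suff : false by []; apply: K; lra.
have N : \forall i \near F, `|Th i - th| < 1 by exact: cvgr_distC_lt.
apply: filterS3 cov cST N => i ci si; rewrite ltr_norml => /andP[n1 n2].
have [/andP[h1 h2] /andP[h3 h4] _ _] := si.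
apply: contrapT => /not_andP nst; apply: (ci (S i, T i)) => //; split.
  by split; rewrite /= in_itv/=; apply/andP; split; lra.
by case: nst => /negP; rewrite -leNgt; [left|right].
Qed.

End ChordContinuity.

Lemma cvg_proj1 (I : Type) (U V : topologicalType) (F : set_system I)
    (Z : I -> U * V) (z : U * V) :
  Z i @[i --> F] --> z -> (Z i).1 @[i --> F] --> z.1.
Proof. by case: z => a b cZ; exact: (cvg_comp _ _ cZ cvg_fst). Qed.

Lemma cvg_proj2 (I : Type) (U V : topologicalType) (F : set_system I)
    (Z : I -> U * V) (z : U * V) :
  Z i @[i --> F] --> z -> (Z i).2 @[i --> F] --> z.2.
Proof. by case: z => a b cZ; exact: (cvg_comp _ _ cZ cvg_snd). Qed.

Section ImplicitDerivative.
Context {R : realType}.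

Lemma derive_of_increment (S N D : R -> R) (n d : R) :
  N h @[h --> (0 : R)] --> n -> D h @[h --> (0 : R)] --> d -> d != 0 ->
  (\forall h \near (0 : R), D h * (S h - S 0) = N h * h) ->
  is_derive (0 : R) 1 S (n / d).
Proof.
move=> hN hD d0 E; apply/is_derive_cvgP.
have nD : \forall h \near (0 : R), D h != 0 by exact: cvgr_neq0 hD d0.
have c : N h / D h @[h --> (0 : R)^'] --> n / d.
  apply: (@cvg_within_filter _ _ (fun h => N h / D h)).
  by apply: cvgM => //; exact: cvgV.
apply: cvg_trans c; apply: near_eq_cvg; near=> h.
have h0 : h != 0 by near: h; exact: nbhs_dnbhs_neq.
have e : D h * (S h - S 0) = N h * h by near: h; exact: cvg_within E.
have Dh : D h != 0 by near: h; exact: cvg_within nD.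
rewrite addr0 [h *: 1]mulr1; apply: (mulfI h0); rewrite /GRing.scale/= mulVKf//.
by apply: (mulIf Dh); rewrite mulrA divfK// mulrC -e mulrC.
Unshelve. all: by end_near. Qed.

(* Cramer's rule applied to a linear system for the increments of [S] and [T]
   whose coefficients converge. *)
Lemma implicit_derive2 (S T A1 B1 C1 A2 B2 C2 : R -> R) (a1 b1 c1 a2 b2 c2 : R) :
  A1 h @[h --> (0 : R)] --> a1 -> B1 h @[h --> (0 : R)] --> b1 ->
  C1 h @[h --> (0 : R)] --> c1 -> A2 h @[h --> (0 : R)] --> a2 ->
  B2 h @[h --> (0 : R)] --> b2 -> C2 h @[h --> (0 : R)] --> c2 ->
  (\forall h \near (0 : R),
     A1 h * (S h - S 0) + B1 h * (T h - T 0) + C1 h * h = 0 /\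
     A2 h * (S h - S 0) + B2 h * (T h - T 0) + C2 h * h = 0) ->
  a1 * b2 - a2 * b1 != 0 ->
  is_derive (0 : R) 1 S ((b1 * c2 - c1 * b2) / (a1 * b2 - a2 * b1)) /\
  is_derive (0 : R) 1 T ((a2 * c1 - a1 * c2) / (a1 * b2 - a2 * b1)).
Proof.
move=> hA1 hB1 hC1 hA2 hB2 hC2 E D0.
have hD : A1 h * B2 h - A2 h * B1 h @[h --> (0 : R)] --> a1 * b2 - a2 * b1.
  by apply: cvgB; exact: cvgM.
split.
  have hN : B1 h * C2 h - C1 h * B2 h @[h --> (0 : R)] --> b1 * c2 - c1 * b2.
    by apply: cvgB; exact: cvgM.
  apply: (derive_of_increment hN hD D0); apply: filterS E => h [e1 e2].
  apply/eqP; rewrite -subr_eq0; apply/eqP.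
  transitivity (B2 h * (A1 h * (S h - S 0) + B1 h * (T h - T 0) + C1 h * h) -
    B1 h * (A2 h * (S h - S 0) + B2 h * (T h - T 0) + C2 h * h)); first ring.
  by rewrite e1 e2 !mulr0 subr0.
have hN : A2 h * C1 h - A1 h * C2 h @[h --> (0 : R)] --> a2 * c1 - a1 * c2.
  by apply: cvgB; exact: cvgM.
apply: (derive_of_increment hN hD D0); apply: filterS E => h [e1 e2].
apply/eqP; rewrite -subr_eq0; apply/eqP.
transitivity (A1 h * (A2 h * (S h - S 0) + B2 h * (T h - T 0) + C2 h * h) -
    A2 h * (A1 h * (S h - S 0) + B1 h * (T h - T 0) + C1 h * h)); first ring.
by rewrite e1 e2 !mulr0 subr0.
Qed.

Lemma antipode_increment (cs cs' sn sn' as_ as' at_ at' bs bs' bt bt' kc ks kas kat kbs kbt dS dT d h : R) :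
  cs' - cs = kc * (h * d) -> sn' - sn = ks * (h * d) ->
  as' - as_ = kas * dS -> at' - at_ = kat * dT ->
  bs' - bs = kbs * dS -> bt' - bt = kbt * dT ->
  cs * (as_ - at_) + sn * (bs - bt) = 0 ->
  cs' * (as' - at') + sn' * (bs' - bt') = 0 ->
  (cs' * kas + sn' * kbs) * dS + (- (cs' * kat + sn' * kbt)) * dT
    + d * (kc * (as_ - at_) + ks * (bs - bt)) * h = 0.
Proof.
move=> h1 h2 h3 h4 h5 h6 e e'.
transitivity (cs' * (as' - as_) + sn' * (bs' - bs) - (cs' * (at' - at_) + sn' * (bt' - bt))
  + ((cs' - cs) * (as_ - at_) + (sn' - sn) * (bs - bt))).
  by rewrite h1 h2 h3 h4 h5 h6; ring.
transitivity (cs' * (as' - at') + sn' * (bs' - bt') - (cs * (as_ - at_) + sn * (bs - bt))).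
  by ring.
by rewrite e e' subrr.
Qed.

Lemma cross_increment (x x' y y' u u' v v' p p' q q' kx ky ku kv dS dT d d' h : R) :
  x' - x = kx * dS -> y' - y = ky * dS -> u' - u = ku * dT -> v' - v = kv * dT ->
  p' - p = h * d -> q' - q = h * d' ->
  (x - p) * (v - q) - (y - q) * (u - p) = 0 ->
  (x' - p') * (v' - q') - (y' - q') * (u' - p') = 0 ->
  (kx * (v' - q') - ky * (u' - p')) * dS + ((x - p) * kv - (y - q) * ku) * dT
    + (d' * (u' - p') - d * (v' - q') + (d * (y - q) - d' * (x - p))) * h = 0.
Proof.
move=> h1 h2 h3 h4 h5 h6 e e'.
transitivity (((x' - x) - (p' - p)) * (v' - q') + (x - p) * ((v' - v) - (q' - q))
  - ((y' - y) - (q' - q)) * (u' - p') - (y - q) * ((u' - u) - (p' - p))).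
  by rewrite h1 h2 h3 h4 h5 h6; ring.
transitivity ((x' - p') * (v' - q') - (y' - q') * (u' - p')
   - ((x - p) * (v - q) - (y - q) * (u - p))); first by ring.
by rewrite e e' subrr.
Qed.

Lemma secant (f : R -> R) (x a : R) : is_derive x 1 f a ->
  exists k : R -> R, [/\ forall z, f z - f x = k z * (z - x), k x = a &
    forall (X : R -> R), X 0 = x -> X h @[h --> (0 : R)] --> x ->
      k (X h) @[h --> (0 : R)] --> a].
Proof.
move=> /is_derive1_caratheodory[k [kE kc kx]]; exists k; split => // X _ cX.
by rewrite -kx; apply: (continuous_cvg _ kc cX).
Qed.

End ImplicitDerivative.

Section ChordDerivative.
Context {R : realType}.
Local Notation plane := (R * R)%type.
Variables (C : set plane) (g1 g2 rho : R -> R).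
Hypothesis HS : support_param C g1 g2 rho.
Implicit Types (p q : plane) (x y th s t : R).

Local Notation gm := (gam g1 g2).
Local Notation gp := (gap g1 g2).
Local Notation inn := (inner g1 g2).
Local Notation chrd := (chord g1 g2).
Local Notation adm := (admissible g1 g2).

Definition chord_ends (z : plane * R) : R * R :=
  get [set w | chrd z.1 z.2 w.1 w.2].
Definition chord_start z := (chord_ends z).1.
Definition chord_stop z := (chord_ends z).2.
Local Notation S := chord_start.
Local Notation T := chord_stop.

Lemma chord_endsP z : adm z.1 z.2 -> chrd z.1 z.2 (S z) (T z).
Proof.
move=> /(chord_exists HS)[s [t st]].
by have := @getPex _ [set w | chrd z.1 z.2 w.1 w.2] (ex_intro _ (s, t) st).
Qed.

Lemma chord_ends_cvg (I : Type) (F : set_system I) (FF : Filter F)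
    (Z : I -> plane * R) (z : plane * R) :
  Z i @[i --> F] --> z -> adm z.1 z.2 ->
  (\forall i \near F, adm (Z i).1 (Z i).2) ->
  S (Z i) @[i --> F] --> S z /\ T (Z i) @[i --> F] --> T z.
Proof.
move=> cZ az aZ.
have c1 := cvg_proj1 cZ; have c2 := cvg_proj2 cZ.
have c11 := cvg_proj1 c1; have c12 := cvg_proj2 c1.
apply: (chord_cvg HS FF c11 c12 c2 az (chord_endsP az)).
by apply: filterS aZ => i /chord_endsP.
Qed.

(* Along [th] constant, [gam (s + pi)] moves with normal velocity [chord_coef1 th s]
   per unit of [s], and [gam s] moves away from the line through [p] and
   [gam t] at rate [chord_coef2 p s t]. *)
Definition chord_coef1 th s : R := rho (s + pi) * (cos th * sin s - sin th * cos s).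
Definition chord_coef2 p s t : R :=
  - (rho s * (cos s * (g1 t - p.1) + sin s * (g2 t - p.2))).
Definition chord_det (z : plane * R) : R :=
  chord_coef1 z.2 (T z) * chord_coef2 z.1 (S z) (T z) - chord_coef1 z.2 (S z) * chord_coef2 z.1 (T z) (S z).

Lemma chord_coef1_start_lt0 p th s t : chrd p th s t -> chord_coef1 th s < 0.
Proof.
case=> _ /andP[a b] _ _; rewrite /chord_coef1 nmulr_llt0 ?(rho_gt0 HS)//.
have -> : cos th * sin s - sin th * cos s = sin (s - th) by rewrite sinB; ring.
by apply: sin_lt0; apply/andP; split; lra.
Qed.

Lemma chord_coef1_stop_gt0 p th s t : chrd p th s t -> 0 < chord_coef1 th t.
Proof.
case=> /andP[a b] _ _ _; rewrite /chord_coef1 mulr_gt0 ?(rho_gt0 HS)//.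
have -> : cos th * sin t - sin th * cos t = sin (t - th) by rewrite sinB; ring.
by apply: sin_gt0_pi; apply/andP; split; lra.
Qed.

Lemma chord_coef2_param p th s t : (forall x, 0 <= gp p x) -> chrd p th s t ->
  exists l, [/\ 0 <= l <= 1, inn p -> 0 < l < 1,
    p = (g1 t + l * (g1 s - g1 t), g2 t + l * (g2 s - g2 t)),
    chord_coef2 p s t = l * (rho s * gp (gm t) s) &
    chord_coef2 p t s = (1 - l) * (rho t * gp (gm s) t)].
Proof.
move=> p0 [/andP[a b] /andP[a' b'] _ c].
have [|l [pE l0 l0' l1 l1']] := chord_param HS _ c; first by apply/andP; split; lra.
exists l; split => //.
- by rewrite l0// l1.
- by move=> ip; rewrite l0'// l1'.
- by rewrite /chord_coef2 pE /gap /=; ring.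
- by rewrite /chord_coef2 pE /gap /=; ring.
Qed.

Lemma chord_gaps_gt0 p th s t : chrd p th s t ->
  0 < rho s * gp (gm t) s /\ 0 < rho t * gp (gm s) t.
Proof.
move=> [/andP[a b] /andP[a' b'] _ _]; split; rewrite mulr_gt0 ?(rho_gt0 HS)//.
  by apply: (gap_gam' HS); apply/andP; split; lra.
by apply: (gap_gam HS); apply/andP; split; lra.
Qed.

Lemma chord_det_gt0 z : adm z.1 z.2 -> 0 < chord_det z.
Proof.
move=> az; have cz := chord_endsP az; have [p0 _ _] := az.
have [l [l01 _ _ E1 E2]] := chord_coef2_param p0 cz; rewrite /chord_det E1 E2.
have [k1 k2] := chord_gaps_gt0 cz.
have H (c1 c2 m1 m2 : R) : c1 < 0 -> 0 < c2 -> 0 < m1 -> 0 < m2 ->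
    0 < c2 * (l * m1) - c1 * ((1 - l) * m2).
  move=> c10 c20 m10 m20; move: l01 => /andP[l0 l1].
  have -> : c2 * (l * m1) - c1 * ((1 - l) * m2) = l * (c2 * m1) + (1 - l) * (- c1 * m2) by ring.
  have u1 : 0 < c2 * m1 by rewrite mulr_gt0.
  have u2 : 0 < - c1 * m2 by rewrite mulr_gt0// oppr_gt0.
  move: l0; rewrite le_eqVlt => /predU1P[<-|l0]; first by rewrite mul0r add0r subr0 mul1r.
  by apply: ltr_pwDl; [exact: mulr_gt0|rewrite mulr_ge0 ?subr_ge0// ltW].
exact: H (chord_coef1_start_lt0 cz) (chord_coef1_stop_gt0 cz) k1 k2.
Qed.

Lemma line_cvg (z d : plane * R) : h *: d + z @[h --> (0 : R)] --> z.
Proof.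
have : h *: d + z @[h --> (0 : R)] --> (0 : R) *: d + z.
  by apply: cvgD; [apply: cvgZr_tmp; exact: cvg_id|exact: cvg_cst].
by rewrite scale0r add0r.
Qed.

Lemma line_near_adm (z d : plane * R) : inn z.1 ->
  \forall h \near (0 : R), adm (h *: d + z).1 (h *: d + z).2.
Proof.
move=> iz; have c1 := cvg_proj1 (@line_cvg z d).
have ni : nbhs z.1 inn by apply: open_nbhs_nbhs; split=> //; exact: (open_inner HS).
have : \forall h \near (0 : R), inn (h *: d + z).1 by exact: c1 _ ni.
by apply: filterS => h; exact: inner_admissible.
Qed.

Definition rate1 (d z : plane * R) : R := d.2 *
  (- sin z.2 * (g1 (S z + pi) - g1 (T z + pi)) + cos z.2 * (g2 (S z + pi) - g2 (T z + pi))).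
Definition rate2 (d z : plane * R) : R :=
  d.1.1 * (g2 (S z) - g2 (T z)) - d.1.2 * (g1 (S z) - g1 (T z)).

Lemma chord_ends_derive (z d : plane * R) : inn z.1 ->
  is_derive z d S ((rate1 d z * chord_coef2 z.1 (T z) (S z) - chord_coef1 z.2 (T z) * rate2 d z) / chord_det z) /\
  is_derive z d T ((rate1 d z * chord_coef2 z.1 (S z) (T z) - chord_coef1 z.2 (S z) * rate2 d z) / chord_det z).
Proof.
move=> iz; have az : adm z.1 z.2 by exact: inner_admissible.
have na := line_near_adm d iz.
have [cS cT] := chord_ends_cvg _ (@line_cvg z d) az na.
pose Z (h : R) := h *: d + z.
have Z0 : Z 0 = z by rewrite /Z scale0r add0r.
pose s := S z; pose t := T z; pose p := z.1; pose th := z.2.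
have cZ2 : (Z h).2 @[h --> (0 : R)] --> th := cvg_proj2 (@line_cvg z d).
have cZ1 : (Z h).1 @[h --> (0 : R)] --> p := cvg_proj1 (@line_cvg z d).
have cZ11 := cvg_proj1 cZ1; have cZ12 := cvg_proj2 cZ1.
have dap x : is_derive x 1 (fun y => g1 (y + pi)) (rho (x + pi) * sin x).
  apply: is_derive_shift_fun; apply: (is_deriveW (dg1 HS _)).
  by rewrite sinDpi mulrN opprK.
have dbp x : is_derive x 1 (fun y => g2 (y + pi)) (- (rho (x + pi) * cos x)).
  apply: is_derive_shift_fun; apply: (is_deriveW (dg2 HS _)).
  by rewrite cosDpi mulrN.
have [kas [kasE _ /(_ _ _ cS) kasc]] := secant (dap s).
have [kat [katE _ /(_ _ _ cT) katc]] := secant (dap t).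
have [kbs [kbsE _ /(_ _ _ cS) kbsc]] := secant (dbp s).
have [kbt [kbtE _ /(_ _ _ cT) kbtc]] := secant (dbp t).
have [k1s [k1sE _ /(_ _ _ cS) k1sc]] := secant (dg1 HS s).
have [k1t [k1tE _ /(_ _ _ cT) k1tc]] := secant (dg1 HS t).
have [k2s [k2sE _ /(_ _ _ cS) k2sc]] := secant (dg2 HS s).
have [k2t [k2tE _ /(_ _ _ cT) k2tc]] := secant (dg2 HS t).
have [kc [kcE _ /(_ _ _ cZ2) kcc]] := secant (is_derive_cos th).
have [ks [ksE _ /(_ _ _ cZ2) ksc]] := secant (is_derive_sin th).
pose a := g1 (s + pi) - g1 (t + pi); pose b := g2 (s + pi) - g2 (t + pi).
have ccos : cos (Z h).2 @[h --> (0 : R)] --> cos th by exact: (cvg_apply _ (@continuous_cos R)).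
have csin : sin (Z h).2 @[h --> (0 : R)] --> sin th by exact: (cvg_apply _ (@continuous_sin R)).
have cg1 := smooth_continuous (smooth_g1 HS).
have cg2 := smooth_continuous (smooth_g2 HS).
have cst0 (c : R) : c @[h --> (0 : R)] --> c by exact: cvg_cst.
have S0 : S (0 *: d + z) = s by rewrite scale0r add0r.
have T0 : T (0 *: d + z) = t by rewrite scale0r add0r.
have th0 : (Z 0).2 = th by rewrite Z0.
have cTg1 : g1 (T (Z h)) - (Z h).1.1 @[h --> (0 : R)] --> g1 t - p.1.
  by apply: cvgB => //; exact: (cvg_apply _ cg1 cT).
have cTg2 : g2 (T (Z h)) - (Z h).1.2 @[h --> (0 : R)] --> g2 t - p.2.
  by apply: cvgB => //; exact: (cvg_apply _ cg2 cT).
have hA1 : cos (Z h).2 * kas (S (Z h)) + sin (Z h).2 * kbs (S (Z h)) @[h --> (0 : R)]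
    --> cos th * (rho (s + pi) * sin s) + sin th * (- (rho (s + pi) * cos s)).
  by apply: cvgD; apply: cvgM => //; [exact: kasc|exact: kbsc].
have hB1 : - (cos (Z h).2 * kat (T (Z h)) + sin (Z h).2 * kbt (T (Z h))) @[h --> (0 : R)]
    --> - (cos th * (rho (t + pi) * sin t) + sin th * (- (rho (t + pi) * cos t))).
  by apply: cvgN; apply: cvgD; apply: cvgM => //; [exact: katc|exact: kbtc].
have hC1 : d.2 * (kc (Z h).2 * a + ks (Z h).2 * b) @[h --> (0 : R)]
    --> d.2 * (- sin th * a + cos th * b).
  apply: cvgM => //; apply: cvgD; apply: cvgM => //; [exact: kcc|exact: ksc].
have hA2 : k1s (S (Z h)) * (g2 (T (Z h)) - (Z h).1.2)
    - k2s (S (Z h)) * (g1 (T (Z h)) - (Z h).1.1) @[h --> (0 : R)]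
    --> - (rho s * sin s) * (g2 t - p.2) - rho s * cos s * (g1 t - p.1).
  by apply: cvgB; apply: cvgM => //; [exact: k1sc|exact: k2sc].
have hB2 : (g1 s - p.1) * k2t (T (Z h)) - (g2 s - p.2) * k1t (T (Z h)) @[h --> (0 : R)]
    --> (g1 s - p.1) * (rho t * cos t) - (g2 s - p.2) * (- (rho t * sin t)).
  by apply: cvgB; apply: cvgM => //; [exact: k2tc|exact: k1tc].
have hC2 : d.1.2 * (g1 (T (Z h)) - (Z h).1.1) - d.1.1 * (g2 (T (Z h)) - (Z h).1.2)
    + (d.1.1 * (g2 s - p.2) - d.1.2 * (g1 s - p.1)) @[h --> (0 : R)]
    --> d.1.2 * (g1 t - p.1) - d.1.1 * (g2 t - p.2)
        + (d.1.1 * (g2 s - p.2) - d.1.2 * (g1 s - p.1)).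
  by apply: cvgD => //; apply: cvgB; apply: cvgM.
have az' : adm (Z 0).1 (Z 0).2 by rewrite Z0.
have [_ _ e10 e20] := chord_endsP az.
have E : \forall h \near (0 : R),
     (cos (Z h).2 * kas (S (Z h)) + sin (Z h).2 * kbs (S (Z h))) * (S (Z h) - S (Z 0))
     + (- (cos (Z h).2 * kat (T (Z h)) + sin (Z h).2 * kbt (T (Z h)))) * (T (Z h) - T (Z 0))
     + (d.2 * (kc (Z h).2 * a + ks (Z h).2 * b)) * h = 0 /\
     (k1s (S (Z h)) * (g2 (T (Z h)) - (Z h).1.2)
       - k2s (S (Z h)) * (g1 (T (Z h)) - (Z h).1.1)) * (S (Z h) - S (Z 0))
     + ((g1 s - p.1) * k2t (T (Z h)) - (g2 s - p.2) * k1t (T (Z h))) * (T (Z h) - T (Z 0))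
     + (d.1.2 * (g1 (T (Z h)) - (Z h).1.1) - d.1.1 * (g2 (T (Z h)) - (Z h).1.2)
    + (d.1.1 * (g2 s - p.2) - d.1.2 * (g1 s - p.1))) * h = 0.
  apply: filterS na => h ah; have [_ _ e1 e2] := chord_endsP ah.
  rewrite -/(Z h) in e1 e2; rewrite Z0 -/s -/t.
  have Zh2 : (Z h).2 - th = h * d.2 by rewrite /Z /th /= addrK.
  have Zh11 : (Z h).1.1 - p.1 = h * d.1.1 by rewrite /Z /p /= addrK.
  have Zh12 : (Z h).1.2 - p.2 = h * d.1.2 by rewrite /Z /p /= addrK.
  have kc' := kcE (Z h).2; rewrite Zh2 in kc'.
  have ks' := ksE (Z h).2; rewrite Zh2 in ks'.
  split.
    exact: (antipode_increment kc' ks' (kasE _) (katE _) (kbsE _) (kbtE _) e10 e1).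
  exact: (cross_increment (k1sE _) (k2sE _) (k1tE _) (k2tE _) Zh11 Zh12 e20 e2).
have cz := chord_endsP az.
have Dd := chord_det_gt0 az.
have E1 : cos th * (rho (s + pi) * sin s) + sin th * (- (rho (s + pi) * cos s)) = chord_coef1 th s.
  by rewrite /chord_coef1; ring.
have E2 : - (cos th * (rho (t + pi) * sin t) + sin th * (- (rho (t + pi) * cos t))) = - chord_coef1 th t.
  by rewrite /chord_coef1; ring.
have E3 : - (rho s * sin s) * (g2 t - p.2) - rho s * cos s * (g1 t - p.1) = chord_coef2 p s t.
  by rewrite /chord_coef2; ring.
have E4 : (g1 s - p.1) * (rho t * cos t) - (g2 s - p.2) * (- (rho t * sin t)) = - chord_coef2 p t s.
  by rewrite /chord_coef2; ring.
have E5 : d.1.2 * (g1 t - p.1) - d.1.1 * (g2 t - p.2)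
    + (d.1.1 * (g2 s - p.2) - d.1.2 * (g1 s - p.1)) = rate2 d z.
  by rewrite /rate2 -/s -/t; ring.
rewrite E1 in hA1; rewrite E2 in hB1; rewrite E3 in hA2; rewrite E4 in hB2; rewrite E5 in hC2.
have E6 : chord_coef1 th s * - chord_coef2 p t s - chord_coef2 p s t * - chord_coef1 th t = chord_det z.
  by rewrite /chord_det -/s -/t -/th -/p; ring.
have D0 : chord_coef1 th s * - chord_coef2 p t s - chord_coef2 p s t * - chord_coef1 th t != 0.
  by rewrite E6 gt_eqF.
have [dS dT] := implicit_derive2 hA1 hB1 hC1 hA2 hB2 hC2 E D0.
split; apply/is_derive_line.
  apply: (is_deriveW dS); rewrite E6; congr (_ / _).
  by rewrite /rate1 -/s -/t -/a -/b -/p -/th; ring.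
apply: (is_deriveW dT); rewrite E6; congr (_ / _).
by rewrite /rate1 -/s -/t -/a -/b -/p -/th; ring.
Qed.
End ChordDerivative.

Section ChordFunctions.
Context {R : realType}.
Local Notation plane := (R * R)%type.
Variables (C : set plane) (g1 g2 rho : R -> R).
Hypothesis HS : support_param C g1 g2 rho.
Implicit Types (p q : plane) (x y th s t : R) (z d : plane * R) (f g : plane * R -> R).

Local Notation inn := (inner g1 g2).
Local Notation adm := (admissible g1 g2).
Local Notation S := (chord_start g1 g2).
Local Notation T := (chord_stop g1 g2).
Local Notation det := (chord_det g1 g2 rho).

(* An algebra of functions of [(p, th)] that is closed under all partial
   derivatives, because the derivatives of [S] and [T] belong to it. *)
Inductive chord_fun : (plane * R -> R) -> Prop :=
| chord_fun_cst c : chord_fun (fun=> c)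
| chord_fun_p1 : chord_fun (fun z => z.1.1)
| chord_fun_p2 : chord_fun (fun z => z.1.2)
| chord_fun_angle phi : smooth phi -> chord_fun (fun z => phi z.2)
| chord_fun_start phi : smooth phi -> chord_fun (fun z => phi (S z))
| chord_fun_stop phi : smooth phi -> chord_fun (fun z => phi (T z))
| chord_funD f g : chord_fun f -> chord_fun g -> chord_fun (fun z => f z + g z)
| chord_funM f g : chord_fun f -> chord_fun g -> chord_fun (fun z => f z * g z)
| chord_fun_detV : chord_fun (fun z => (det z)^-1).

Lemma chord_funN f : chord_fun f -> chord_fun (fun z => - f z).
Proof.
move=> hf; have -> : (fun z => - f z) = (fun z => -1 * f z).
  by apply/funext => z; rewrite mulN1r.
by apply: chord_funM => //; exact: chord_fun_cst.
Qed.

Lemma chord_funB f g : chord_fun f -> chord_fun g -> chord_fun (fun z => f z - g z).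
Proof. by move=> hf hg; apply: chord_funD => //; exact: chord_funN. Qed.

Lemma smooth_shift (phi : R -> R) c : smooth phi -> smooth (fun x => phi (x + c)).
Proof.
move=> sphi; apply: (@smooth_comp _ phi (fun x => x + c)) => //.
by apply: smoothD; [exact: smooth_id|exact: smooth_cst].
Qed.

Let srho := smooth_rho HS.
Let sg1 := smooth_g1 HS.
Let sg2 := smooth_g2 HS.
Let scos := @smooth_cos R.
Let ssin := @smooth_sin R.

Lemma coef_closed (P : (plane * R -> R) -> Prop) :
  P (fun z => z.1.1) -> P (fun z => z.1.2) ->
  (forall phi, smooth phi -> P (fun z => phi z.2)) ->
  (forall phi, smooth phi -> P (fun z => phi (S z))) ->
  (forall phi, smooth phi -> P (fun z => phi (T z))) ->
  (forall f g, P f -> P g -> P (fun z => f z + g z)) ->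
  (forall f g, P f -> P g -> P (fun z => f z * g z)) ->
  (forall f, P f -> P (fun z => - f z)) ->
  [/\ P (fun z => chord_coef1 rho z.2 (S z)), P (fun z => chord_coef1 rho z.2 (T z)),
    P (fun z => chord_coef2 g1 g2 rho z.1 (S z) (T z)) &
    P (fun z => chord_coef2 g1 g2 rho z.1 (T z) (S z))].
Proof.
move=> P1 P2 Pa Ps Pt PD PM PN; have sr := smooth_shift pi srho.
have PB f g : P f -> P g -> P (fun z => f z - g z).
  by move=> Pf Pg; apply: (PD _ _) => //; exact: PN.
split.
- apply: (PM _ _); first exact: (Ps _ sr).
  by apply: (PB _ _); apply: (PM _ _); (exact: Pa || exact: Ps).
- apply: (PM _ _); first exact: (Pt _ sr).
  by apply: (PB _ _); apply: (PM _ _); (exact: Pa || exact: Pt).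
- apply: (PN _); apply: (PM _ _); first exact: Ps.
  by apply: (PD _ _); apply: (PM _ _); [exact: Ps|apply: (PB _ _) => //; exact: Pt|exact: Ps|apply: (PB _ _) => //; exact: Pt].
- apply: (PN _); apply: (PM _ _); first exact: Pt.
  by apply: (PD _ _); apply: (PM _ _); [exact: Pt|apply: (PB _ _) => //; exact: Ps|exact: Pt|apply: (PB _ _) => //; exact: Ps].
Qed.

Lemma chord_fun_coef : [/\ chord_fun (fun z => chord_coef1 rho z.2 (S z)),
  chord_fun (fun z => chord_coef1 rho z.2 (T z)),
  chord_fun (fun z => chord_coef2 g1 g2 rho z.1 (S z) (T z)) &
  chord_fun (fun z => chord_coef2 g1 g2 rho z.1 (T z) (S z))].
Proof.
apply: coef_closed; [exact: chord_fun_p1|exact: chord_fun_p2|exact: chord_fun_angle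
  |exact: chord_fun_start|exact: chord_fun_stop|exact: chord_funD|exact: chord_funM
  |exact: chord_funN].
Qed.

Lemma chord_fun_rates d :
  chord_fun (rate1 g1 g2 d) /\ chord_fun (rate2 g1 g2 d).
Proof.
have s1 := smooth_shift pi sg1; have s2 := smooth_shift pi sg2.
split.
  apply: chord_funM; first exact: chord_fun_cst.
  apply: chord_funD; apply: chord_funM.
  - by apply: chord_funN; exact: chord_fun_angle.
  - by apply: chord_funB; [exact: (chord_fun_start s1)|exact: (chord_fun_stop s1)].
  - exact: chord_fun_angle.
  - by apply: chord_funB; [exact: (chord_fun_start s2)|exact: (chord_fun_stop s2)].
apply: chord_funB; apply: chord_funM; try exact: chord_fun_cst.
  by apply: chord_funB; [exact: chord_fun_start|exact: chord_fun_stop].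
by apply: chord_funB; [exact: chord_fun_start|exact: chord_fun_stop].
Qed.

Let has_derivative f := forall d, exists2 f', chord_fun f' &
  forall z, inn z.1 -> is_derive z d f (f' z).

Let has_derivativeD f g : has_derivative f -> has_derivative g ->
  has_derivative (fun z => f z + g z).
Proof.
move=> hf hg d; have [f' f'c df] := hf d; have [g' g'c dg] := hg d.
exists (fun z => f' z + g' z); first exact: chord_funD.
by move=> z iz; apply: is_deriveD_fun; [exact: df|exact: dg].
Qed.

Let has_derivativeM f g : chord_fun f -> chord_fun g ->
  has_derivative f -> has_derivative g -> has_derivative (fun z => f z * g z).
Proof.
move=> cf cg hf hg d; have [f' f'c df] := hf d; have [g' g'c dg] := hg d.
exists (fun z => f' z * g z + f z * g' z).
  by apply: chord_funD; exact: chord_funM.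
by move=> z iz; apply: is_deriveM_fun; [exact: df|exact: dg].
Qed.

Let has_derivative_cst c : has_derivative (fun=> c).
Proof.
move=> d; exists (fun=> 0); first exact: chord_fun_cst.
by move=> z _; exact: is_derive_cst.
Qed.

Let has_derivative_line f (l : plane * R -> R) :
  (forall z d (h : R), f (h *: d + z) = h * l d + f z) -> has_derivative f.
Proof.
move=> fl d; exists (fun=> l d); first exact: chord_fun_cst.
move=> z _; apply/is_derive_line.
have -> : (fun h : R => f (h *: d + z)) = (fun h => h * l d + f z).
  by apply/funext => h; rewrite fl.
have dh : is_derive (0 : R) 1 (fun h : R => h * l d) (l d).
  apply: (is_deriveW (is_deriveM_fun (is_derive_id _ _) (is_derive_cst _ _ _))).
  by rewrite mul1r mulr0 addr0.
by apply: (is_deriveW (is_deriveD_fun dh (is_derive_cst _ _ _))); rewrite addr0.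
Qed.

Let has_derivative_p1 : has_derivative (fun z => z.1.1).
Proof. exact: (has_derivative_line (l := fun d => d.1.1)). Qed.

Let has_derivative_p2 : has_derivative (fun z => z.1.2).
Proof. exact: (has_derivative_line (l := fun d => d.1.2)). Qed.

Let has_derivative_comp (phi : R -> R) f : smooth phi ->
  (forall psi, smooth psi -> chord_fun (fun z => psi (f z))) ->
  has_derivative f -> has_derivative (fun z => phi (f z)).
Proof.
move=> /smooth_ex_derive[phi' dphi sphi'] cf hf d; have [f' f'c df] := hf d.
exists (fun z => phi' (f z) * f' z).
  by apply: chord_funM => //; exact: cf.
by move=> z iz; exact: (is_derive_comp_fun (df z iz) (dphi _)).
Qed.

Let has_derivative_angle phi : smooth phi -> has_derivative (fun z => phi z.2).
Proof.
move=> sphi; apply: (has_derivative_comp (f := fun z => z.2) sphi).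
  by move=> psi; exact: chord_fun_angle.
exact: (has_derivative_line (l := fun d => d.2)).
Qed.

Let has_derivative_start phi : smooth phi -> has_derivative (fun z => phi (S z)).
Proof.
move=> sphi; apply: (has_derivative_comp (f := S) sphi).
  by move=> psi; exact: chord_fun_start.
move=> d; exists (fun z => (rate1 g1 g2 d z * chord_coef2 g1 g2 rho z.1 (T z) (S z)
    - chord_coef1 rho z.2 (T z) * rate2 g1 g2 d z) * (det z)^-1); last first.
  by move=> z iz; have [] := chord_ends_derive HS d iz.
have [c1 c2 c3 c4] := chord_fun_coef; have [r1 r2] := chord_fun_rates d.
by apply: chord_funM; [apply: chord_funB; exact: chord_funM|exact: chord_fun_detV].
Qed.

Let has_derivative_stop phi : smooth phi -> has_derivative (fun z => phi (T z)).
Proof.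
move=> sphi; apply: (has_derivative_comp (f := T) sphi).
  by move=> psi; exact: chord_fun_stop.
move=> d; exists (fun z => (rate1 g1 g2 d z * chord_coef2 g1 g2 rho z.1 (S z) (T z)
    - chord_coef1 rho z.2 (S z) * rate2 g1 g2 d z) * (det z)^-1); last first.
  by move=> z iz; have [] := chord_ends_derive HS d iz.
have [c1 c2 c3 c4] := chord_fun_coef; have [r1 r2] := chord_fun_rates d.
by apply: chord_funM; [apply: chord_funB; exact: chord_funM|exact: chord_fun_detV].
Qed.

Let has_derivative_detV : has_derivative (fun z => (det z)^-1).
Proof.
pose good f := chord_fun f /\ has_derivative f.
have gM f g : good f -> good g -> good (fun z => f z * g z).
  move=> [f1 f2] [g11 g22]; split; [exact: chord_funM|exact: has_derivativeM].
have gD f g : good f -> good g -> good (fun z => f z + g z).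
  move=> [f1 f2] [g11 g22]; split; [exact: chord_funD|exact: has_derivativeD].
have gN f : good f -> good (fun z => - f z).
  move=> gf; have -> : (fun z => - f z) = (fun z => -1 * f z).
    by apply/funext => z; rewrite mulN1r.
  by apply: (gM _ _) => //; split; [exact: chord_fun_cst|exact: has_derivative_cst].
have [|||||c1 c2 c3 c4] := @coef_closed good _ _ _ _ _ gD gM gN.
- by split; [exact: chord_fun_p1|exact: has_derivative_p1].
- by split; [exact: chord_fun_p2|exact: has_derivative_p2].
- by move=> phi sphi; split; [exact: chord_fun_angle|exact: has_derivative_angle].
- by move=> phi sphi; split; [exact: chord_fun_start|exact: has_derivative_start].
- by move=> phi sphi; split; [exact: chord_fun_stop|exact: has_derivative_stop].
have [_ hd] : good det by apply: (gD _ _); [exact: gM|apply: (gN _); exact: gM].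
move=> d; have [f' cf' df] := hd d.
exists (fun z => - f' z * ((det z)^-1 * (det z)^-1)).
  apply: chord_funM; first exact: chord_funN.
  by apply: chord_funM; exact: chord_fun_detV.
move=> z iz; apply: (is_deriveV_fun (f := det)); last exact: df.
by rewrite gt_eqF// (chord_det_gt0 HS)//; exact: inner_admissible.
Qed.

Lemma chord_fun_derive f : chord_fun f -> forall d, exists2 f', chord_fun f' &
  forall z, inn z.1 -> is_derive z d f (f' z).
Proof.
elim=> {f}.
- exact: has_derivative_cst.
- exact: has_derivative_p1.
- exact: has_derivative_p2.
- exact: has_derivative_angle.
- exact: has_derivative_start.
- exact: has_derivative_stop.
- by move=> f g _ hf _ hg; exact: has_derivativeD.
- by move=> f g cf hf cg hg; exact: has_derivativeM.
- exact: has_derivative_detV.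
Qed.

Lemma chord_fun_cvg f : chord_fun f ->
  forall (I : Type) (F : set_system I), Filter F -> forall (Z : I -> plane * R) z,
  Z i @[i --> F] --> z -> adm z.1 z.2 ->
  (\forall i \near F, adm (Z i).1 (Z i).2) -> f (Z i) @[i --> F] --> f z.
Proof.
move=> cf I F FF Z z cZ az aZ.
have [cS cT] := chord_ends_cvg HS FF cZ az aZ.
have c2 := cvg_proj2 cZ; have c11 := cvg_proj1 (cvg_proj1 cZ).
have c12 := cvg_proj2 (cvg_proj1 cZ).
pose good f := f (Z i) @[i --> F] --> f z.
have gM f1 f2 : good f1 -> good f2 -> good (fun z => f1 z * f2 z).
  by move=> *; exact: cvgM.
have gD f1 f2 : good f1 -> good f2 -> good (fun z => f1 z + f2 z).
  by move=> *; exact: cvgD.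
have gN f1 : good f1 -> good (fun z => - f1 z).
  by move=> *; exact: cvgN.
have ga phi : smooth phi -> good (fun z => phi z.2).
  by move=> sphi; apply: (cvg_apply FF (smooth_continuous sphi) c2).
have gs phi : smooth phi -> good (fun z => phi (S z)).
  by move=> sphi; apply: (cvg_apply FF (smooth_continuous sphi) cS).
have gt phi : smooth phi -> good (fun z => phi (T z)).
  by move=> sphi; apply: (cvg_apply FF (smooth_continuous sphi) cT).
elim: cf => {f}.
- by move=> c; exact: cvg_cst.
- exact: c11.
- exact: c12.
- exact: ga.
- exact: gs.
- exact: gt.
- by move=> f g _ hf _ hg; exact: gD.
- by move=> f g cf hf cg hg; exact: gM.
- have [c1 c2' c3 c4] := @coef_closed good c11 c12 ga gs gt gD gM gN.
  apply: cvgV; first by rewrite gt_eqF// (chord_det_gt0 HS).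
  by apply: cvgB; apply: cvgM.
Qed.

End ChordFunctions.

(** * Image lines and the distance [q_ART] *)

Section Lines.
Context {R : realType}.
Local Notation plane := (R * R)%type.
Implicit Types (p x y z a b : plane) (th r : R).

Lemma lineP a b z : line a b z <->
  exists t : R, z.1 = a.1 + t * (b.1 - a.1) /\ z.2 = a.2 + t * (b.2 - a.2).
Proof.
split=> [[t ->]|[t [e1 e2]]]; exists t => //.
by rewrite [LHS]surjective_pairing e1 e2.
Qed.

Lemma lineC a b : line a b = line b a.
Proof.
suff H x y : line x y `<=` line y x by rewrite eqEsubset; split; exact: H.
move=> z /lineP[t [e1 e2]]; apply/lineP; exists (1 - t); rewrite e1 e2; split; ring.
Qed.

Lemma line_left a b : line a b a.
Proof. by apply/lineP; exists 0; rewrite !mul0r !addr0. Qed.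

Lemma line_cross a b z : line a b z -> cross (a - z) (b - z) = 0.
Proof. by case=> t ->; rewrite /cross /=; rewrite /GRing.scale /=; ring. Qed.

Lemma line_crossP a b z : a <> b -> cross (a - z) (b - z) = 0 -> line a b z.
Proof.
by move=> ab /(collinear_segment ab)[t ->]; apply/lineP; exists t.
Qed.

Lemma line_normal th p r a b : a <> b ->
  dotp (nvec th) (a - p) = r -> dotp (nvec th) (b - p) = r ->
  line a b = [set z | dotp (nvec th) (z - p) = r].
Proof.
rewrite /dotp /nvec /= => ab ea eb.
have E : cos th ^+ 2 + sin th ^+ 2 = 1 by exact: cos2Dsin2.
have H z (w : plane) : cos th * (z.1 - p.1) + sin th * (z.2 - p.2) = r ->
    cos th * (w.1 - p.1) + sin th * (w.2 - p.2) = r ->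
    z.1 - w.1 = - (cos th * (z.2 - w.2) - sin th * (z.1 - w.1)) * sin th /\
    z.2 - w.2 = (cos th * (z.2 - w.2) - sin th * (z.1 - w.1)) * cos th.
  move=> ez ew; have e : cos th * (z.1 - w.1) + sin th * (z.2 - w.2) = 0.
    by rewrite -[RHS](subrr r) -{1}ez -ew; ring.
  split.
    transitivity ((cos th ^+ 2 + sin th ^+ 2) * (z.1 - w.1)); first by rewrite E mul1r.
    transitivity (- (cos th * (z.2 - w.2) - sin th * (z.1 - w.1)) * sin th +
       cos th * (cos th * (z.1 - w.1) + sin th * (z.2 - w.2))); first ring.
    by rewrite e mulr0 addr0.
  transitivity ((cos th ^+ 2 + sin th ^+ 2) * (z.2 - w.2)); first by rewrite E mul1r.
  transitivity ((cos th * (z.2 - w.2) - sin th * (z.1 - w.1)) * cos th +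
       sin th * (cos th * (z.1 - w.1) + sin th * (z.2 - w.2))); first ring.
  by rewrite e mulr0 addr0.
rewrite eqEsubset; split=> z.
  move=> /lineP[t [e1 e2]] /=; rewrite e1 e2.
  transitivity ((1 - t) * (cos th * (a.1 - p.1) + sin th * (a.2 - p.2)) +
    t * (cos th * (b.1 - p.1) + sin th * (b.2 - p.2))); first ring.
  by rewrite ea eb; ring.
move=> /= ez; apply/lineP.
have [b1 b2] := H b a eb ea; have [z1 z2] := H z a ez ea.
set m := cos th * (b.2 - a.2) - sin th * (b.1 - a.1) in b1 b2.
set n := cos th * (z.2 - a.2) - sin th * (z.1 - a.1) in z1 z2.
have m0 : m != 0.
  apply/eqP => m0; apply: ab; move: b1 b2; rewrite m0 oppr0 !mul0r => /eqP b1 /eqP b2.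
  by rewrite [a]surjective_pairing [b]surjective_pairing; rewrite !subr_eq0 in b1 b2; rewrite (eqP b1) (eqP b2).
exists (n / m); rewrite b1 b2; split.
  by rewrite mulNr mulrN mulrA divfK// -mulNr -z1 addrC subrK.
by rewrite mulrA divfK// -z2 addrC subrK.
Qed.

End Lines.

Section ImageLines.
Context {R : realType}.
Local Notation plane := (R * R)%type.
Variables (C : set plane) (g1 g2 rho : R -> R).
Hypothesis HS : support_param C g1 g2 rho.
Hypothesis HC : oval C.
Implicit Types (p q : plane) (x y th s t : R).

Local Notation gm := (gam g1 g2).
Local Notation inn := (inner g1 g2).
Local Notation adm := (admissible g1 g2).
Local Notation S := (chord_start g1 g2).
Local Notation T := (chord_stop g1 g2).
Local Notation chrd := (chord g1 g2).

Lemma tangent_vector_exists (x : plane) : C x -> exists v, tangent_vector C x v.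
Proof.
have [P [g Hg]] := HC; have [_ [_ gr] _ _ _] := Hg.
move=> Cx; have [t _ <-] : range g x by rewrite gr.
by exists (derive1 g t), P, g, t.
Qed.

Lemma sin_eq0 x : sin x = 0 -> exists k : int,
  x = k%:~R * (pi *+ 2) \/ x = pi + k%:~R * (pi *+ 2).
Proof.
move=> sx; have c2 : (cos x) ^+ 2 = 1 ^+ 2 by rewrite cos2sin2 sx expr0n subr0 expr1n.
move/eqP: c2; rewrite eqf_sqr => /orP[/eqP/cos_eq1[k xk]|/eqP cx]; first by exists k; left.
have : cos (x - pi) = 1 by rewrite cosB cx cospi sx mul0r addr0 mulrNN mulr1.
by move=> /cos_eq1[k xk]; exists k; right; rewrite -xk addrC subrK.
Qed.

Lemma iota_unique s (y u v : plane) : C y -> y <> gm s ->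
  tangent_vector C (gm s) u -> tangent_vector C y v -> cross u v = 0 ->
  y = gm (s + pi).
Proof.
move=> /(gam_surj HS)[t ->] ne.
move=> /(tangent_vector_direction HS)[u0 [l uE]] /(tangent_vector_direction HS)[v0 [m vE]].
have l0 : l != 0 by apply: contra_neq u0 => l0; rewrite uE l0 oppr0 !mul0r.
have m0 : m != 0 by apply: contra_neq v0 => m0; rewrite vE m0 oppr0 !mul0r.
have -> : cross u v = l * m * sin (t - s).
  by rewrite uE vE /cross /= sinB; ring.
move/eqP; rewrite !mulf_eq0 (negbTE l0) (negbTE m0) /= => /eqP /sin_eq0[k [ts|ts]].
  by case: ne; rewrite -(gam_periodz HS k s) -ts addrC subrK.
by rewrite -(gam_periodz HS k (s + pi)) -addrA -ts addrC subrK.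
Qed.

Lemma gam_antipode s : gm (s + pi) <> gm s.
Proof.
have p0 := @pi_gt0 R.
by move=> /esym; apply: (gam_neq HS); rewrite mulr2n; apply/andP; split; lra.
Qed.

Lemma iotaP s : [set y | [/\ C y, y <> gm s & exists u v,
   [/\ tangent_vector C (gm s) u, tangent_vector C y v & cross u v = 0]]] =
   [set gm (s + pi)].
Proof.
rewrite eqEsubset; split=> y /=.
  by move=> [Cy ne [u [v [tu tv c]]]]; exact: iota_unique tu tv c.
move=> ->; split; [exact: (gam_in HS)|exact: gam_antipode|].
have [u tu] := tangent_vector_exists (gam_in HS s).
have [v tv] := tangent_vector_exists (gam_in HS (s + pi)).
exists u, v; split => //.
have [_ [l ->]] := tangent_vector_direction HS tu.
have [_ [m ->]] := tangent_vector_direction HS tv.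
by rewrite /cross /= sinDpi cosDpi; ring.
Qed.

Lemma iota_gam s : iota_of C (gm s) = gm (s + pi).
Proof.
rewrite /iota_of iotaP.
exact: (@getPex _ [set gm (s + pi)] (ex_intro _ (gm (s + pi)) erefl)).
Qed.

Lemma line_gam2 a s t : gm s <> gm t -> line (gm s) (gm t) (gm a) ->
  gm a = gm s \/ gm a = gm t.
Proof.
move=> ne; have [t' /andP[t1 t2] [k tE]] := gam_reduce t s.
rewrite -(gam_periodz HS k t) -tE in ne *.
have [a' /andP[a1 a2] [k' aE]] := gam_reduce a s.
rewrite -(gam_periodz HS k' a) -aE => /line_cross c.
have st : s < t'.
  by rewrite lt_neqAle t1 andbT; apply/eqP => e; apply: ne; rewrite e.
move: a1; rewrite le_eqVlt => /predU1P[->|a1]; first by left.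
case: (ltgtP a' t') => [at_|ta|->]; last by right.
  have := triple_cross HS a1 at_ t2.
  have -> : cross (gm a' - gm s) (gm t' - gm s) = - cross (gm s - gm a') (gm t' - gm a').
    by rewrite /cross /=; ring.
  by rewrite c oppr0 ltxx.
have := triple_cross HS st ta a2.
have -> : cross (gm t' - gm s) (gm a' - gm s) = cross (gm s - gm a') (gm t' - gm a').
  by rewrite /cross /=; ring.
by rewrite c ltxx.
Qed.

Lemma Phi_secant s t : gm s <> gm t ->
  Phi C (line (gm s) (gm t)) = line (gm (s + pi)) (gm (t + pi)).
Proof.
move=> ne; rewrite eqEsubset; split=> z; last first.
  move=> Hz; exists (gm s), (gm t); split=> //; try exact: (gam_in HS).
  by rewrite !iota_gam.
move=> [x [y [/(gam_surj HS)[a ->] /(gam_surj HS)[b ->] xy Lxy]]].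
have La : line (gm s) (gm t) (gm a) by rewrite Lxy; exact: line_left.
have Lb : line (gm s) (gm t) (gm b) by rewrite Lxy lineC; exact: line_left.
have [ea|ea] := line_gam2 ne La; have [eb|eb] := line_gam2 ne Lb.
- by case: xy; rewrite ea eb.
- by rewrite ea eb !iota_gam.
- by rewrite ea eb !iota_gam lineC.
- by case: xy; rewrite ea eb.
Qed.

Definition image_dist (z : plane * R) : R :=
  cos z.2 * (g1 (S z + pi) - z.1.1) + sin z.2 * (g2 (S z + pi) - z.1.2).

Lemma image_dist_stop z : adm z.1 z.2 -> image_dist z =
  cos z.2 * (g1 (T z + pi) - z.1.1) + sin z.2 * (g2 (T z + pi) - z.1.2).
Proof.
move=> /(chord_endsP HS)[_ _ e _]; apply/eqP; rewrite -subr_eq0 -e /image_dist /antipode_gap.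
by apply/eqP; ring.
Qed.

Lemma chord_of_antipodes p th s t : th <= s < th + pi *+ 2 -> th <= t < th + pi *+ 2 ->
  s < t -> antipode_gap g1 g2 th s t = 0 -> cross (gm s - p) (gm t - p) = 0 ->
  chrd p th t s.
Proof.
move=> /andP[s1 s2] /andP[t1 t2] st e c; have p0 : 0 < (pi : R) := pi_gt0 R.
have e' : cos th * g1 (s + pi) + sin th * g2 (s + pi) = cos th * g1 (t + pi) + sin th * g2 (t + pi).
  by apply/eqP; rewrite -subr_eq0 -e /antipode_gap; apply/eqP; ring.
have shift x : cos th * g1 (x + pi) + sin th * g2 (x + pi) = cos th * g1 (x - pi) + sin th * g2 (x - pi).
  have -> : x + pi = x - pi + pi *+ 2 by ring.
  by rewrite (g1_period HS) (g2_period HS).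
have tp : th + pi < t.
  rewrite ltNge; apply/negP => tp.
  have := @support_incr _ _ _ _ _ HS th (s + pi) (t + pi); rewrite e' ltxx.
  by move=> H; suff : false by []; apply: H; lra.
have sp : s < th + pi.
  rewrite ltNge; apply/negP => sp.
  have := @support_decr _ _ _ _ _ HS th (s - pi) (t - pi); rewrite -!shift e' ltxx.
  by move=> H; suff : false by []; apply: H; lra.
have ths : th < s.
  rewrite lt_neqAle s1 andbT; apply/eqP => sE.
  have := @support_decr _ _ _ _ _ HS th (t - pi) (th + pi); rewrite -shift -e' sE ltxx.
  by move=> H; suff : false by []; apply: H; lra.
split; [by rewrite ths|by rewrite tp| |by rewrite crossC c oppr0].
by rewrite /antipode_gap; move: e'; lra.
Qed.

Lemma chord_lineP p th r : inn p ->
  (Phi C @` pencil p) [set z | dotp (nvec th) (z - p) = r] <-> r = image_dist (p, th).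
Proof.
move=> ip; have az : adm p th by exact: inner_admissible.
have cz := chord_endsP HS (z := (p, th)) az; have [p0 _ _] := az.
have ne : gm (T (p, th)) <> gm (S (p, th)).
  by apply: (gam_neq HS); case: cz => /andP[a b] /andP[a' b'] _ _ /=; apply/andP; split; lra.
have ne' : gm (S (p, th) + pi) <> gm (T (p, th) + pi).
  by move=> /esym; apply: (gam_neq HS); case: cz => /andP[a b] /andP[a' b'] _ _ /=; apply/andP; split; lra.
split; last first.
  move=> ->; exists (line (gm (S (p, th))) (gm (T (p, th)))).
    split; first by exists (gm (S (p, th))), (gm (T (p, th))); split => // /esym.
    by apply: line_crossP; [move=> /esym|case: cz].
  rewrite Phi_secant; last by move=> /esym.
  apply: line_normal => //; rewrite /dotp /nvec /gam /=.
  by rewrite (image_dist_stop (z := (p, th))).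
move=> [L [_ Lp] PL].
have : Phi C L (p.1 + r * cos th, p.2 + r * sin th).
  rewrite PL.
  change (cos th * (p.1 + r * cos th - p.1) + sin th * (p.2 + r * sin th - p.2) = r).
  transitivity (r * (cos th ^+ 2 + sin th ^+ 2)); first by ring.
  by rewrite cos2Dsin2 mulr1.
move=> [x [y [Cx Cy xy LE _]]].
have [s sE] := gam_surj HS Cx; have [t tE] := gam_surj HS Cy.
have [s' s'i [k s'E]] := gam_reduce s th; have [t' t'i [k' t'E]] := gam_reduce t th.
have {}sE : x = gm s' by rewrite sE s'E (gam_periodz HS).
have {}tE : y = gm t' by rewrite tE t'E (gam_periodz HS).
rewrite sE tE in xy LE.
move: PL Lp; rewrite LE Phi_secant// => PL /line_cross c.
have r1 : dotp (nvec th) (gm (s' + pi) - p) = r.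
  have : line (gm (s' + pi)) (gm (t' + pi)) (gm (s' + pi)) by exact: line_left.
  by rewrite PL.
have r2 : dotp (nvec th) (gm (t' + pi) - p) = r.
  have : line (gm (s' + pi)) (gm (t' + pi)) (gm (t' + pi)) by rewrite lineC; exact: line_left.
  by rewrite PL.
have e : antipode_gap g1 g2 th s' t' = 0.
  by rewrite -[RHS](subrr r) -{1}r1 -r2 /antipode_gap /dotp /nvec /=; ring.
case: (ltgtP s' t') => [st|ts|st]; last by case: xy; rewrite st.
  have cst := chord_of_antipodes s'i t'i st e c.
  have [E _] := chord_unique HS p0 cz cst.
  by rewrite -r2 /image_dist E.
have e' : antipode_gap g1 g2 th t' s' = 0.
  by rewrite -[RHS]oppr0 -e /antipode_gap; ring.
have c' : cross (gm t' - p) (gm s' - p) = 0 by rewrite crossC c oppr0.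
have cst := chord_of_antipodes t'i s'i ts e' c'.
have [E _] := chord_unique HS p0 cz cst.
by rewrite -r1 /image_dist E.
Qed.

Lemma q_ARTE p th : inn p -> q_ART C p th = image_dist (p, th).
Proof.
move=> ip; apply/(chord_lineP _ _ ip).
have := @getPex _ [set r | (Phi C @` pencil p) [set z | dotp (nvec th) (z - p) = r]].
by apply; exists (image_dist (p, th)); exact/(chord_lineP _ _ ip).
Qed.

Lemma image_dist_antiperiodic p th : inn p ->
  image_dist (p, th + pi) = - image_dist (p, th).
Proof.
move=> ip; apply/esym/(chord_lineP _ _ ip).
have : (Phi C @` pencil p) [set z | dotp (nvec th) (z - p) = image_dist (p, th)].
  exact/(chord_lineP _ _ ip).
congr (_ _); rewrite eqEsubset; split=> z /=; rewrite /dotp /nvec /= cosDpi sinDpi.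
  by move=> <-; ring.
by move=> e; rewrite -[RHS]opprK -e; ring.
Qed.

End ImageLines.

Section Slices.
Context {R : realType}.
Local Notation plane := (R * R)%type.

Lemma is_derive_slice2 (f : plane * R -> R) p (th l : R) :
  is_derive (p, th) (0, 1) f l -> is_derive th 1 (fun y => f (p, y)) l.
Proof.
move=> /is_derive_line df; apply/is_derive_line.
have -> // : (fun h : R => f (p, h *: 1 + th)) = (fun h => f (h *: (0, 1) + (p, th))).
apply/funext => h; rewrite (_ : h *: (0, 1) + (p, th) = (h *: 0 + p, h *: 1 + th))//.
by rewrite scaler0 add0r.
Qed.

Lemma is_derive_slice1 (f : plane * R -> R) (p v : plane) (th l : R) :
  is_derive (p, th) (v, 0) f l -> is_derive p v (fun y => f (y, th)) l.
Proof.
move=> /is_derive_line df; apply/is_derive_line.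
have -> // : (fun h : R => f (h *: v + p, th)) = (fun h => f (h *: (v, 0) + (p, th))).
apply/funext => h; rewrite (_ : h *: (v, 0) + (p, th) = (h *: v + p, h *: 0 + th))//.
by rewrite scaler0 add0r.
Qed.

Lemma cvg_slice (p : plane) (th : R) : (p, y) @[y --> th] --> (p, th).
Proof. exact: (cvg_pair (cvg_cst p) cvg_id). Qed.

Lemma derive_antiperiodic (f f' : R -> R) : (forall x : R, is_derive x 1 f (f' x)) ->
  (forall x, f (x + pi) = - f x) -> forall x, f' (x + pi) = - f' x.
Proof.
move=> df fa x; have [_ <-] := is_derive_shift_fun (df (x + pi)).
have -> : (fun y => f (y + pi)) = (fun y => - f y) by apply/funext => y; rewrite fa.
by have [_ ->] := is_deriveN_fun (df x).
Qed.

End Slices.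

Section EnergyFormula.
Context {R : realType}.
Local Notation plane := (R * R)%type.
Variables (C : set plane) (g1 g2 rho : R -> R).
Hypothesis HS : support_param C g1 g2 rho.
Hypothesis HC : oval C.
Implicit Types (p : plane) (x y th s t : R) (z d : plane * R).

Local Notation inn := (inner g1 g2).
Local Notation S := (chord_start g1 g2).
Local Notation T := (chord_stop g1 g2).
Local Notation det := (chord_det g1 g2 rho).
Local Notation cfun := (chord_fun g1 g2 rho).
Local Notation q := (image_dist g1 g2).

Lemma chord_fun_image_dist : cfun q.
Proof.
have s1 := smooth_shift pi (smooth_g1 HS); have s2 := smooth_shift pi (smooth_g2 HS).
apply: chord_funD; apply: chord_funM; try exact: chord_fun_angle smooth_cos;
  try exact: chord_fun_angle smooth_sin; apply: chord_funB.
- exact: (chord_fun_start _ _ _ s1).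
- exact: chord_fun_p1.
- exact: (chord_fun_start _ _ _ s2).
- exact: chord_fun_p2.
Qed.

(* The derivative of [image_dist] in the angle, that is, the coordinate along
   the image line of its point of contact with the envelope. *)
Definition contact z : R :=
  - sin z.2 * (g1 (S z + pi) - z.1.1) + cos z.2 * (g2 (S z + pi) - z.1.2)
  + chord_coef1 rho z.2 (S z) *
    (rate1 g1 g2 (0, 1) z * chord_coef2 g1 g2 rho z.1 (T z) (S z) * (det z)^-1).

Lemma chord_fun_contact : cfun contact.
Proof.
have s1 := smooth_shift pi (smooth_g1 HS); have s2 := smooth_shift pi (smooth_g2 HS).
have [c1 c2 c3 c4] := chord_fun_coef HS; have [r1 r2] := chord_fun_rates HS (0, 1).
apply: chord_funD.
  apply: chord_funD; apply: chord_funM.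
  - by apply: chord_funN; exact: chord_fun_angle smooth_sin.
  - by apply: chord_funB; [exact: (chord_fun_start _ _ _ s1)|exact: chord_fun_p1].
  - exact: chord_fun_angle smooth_cos.
  - by apply: chord_funB; [exact: (chord_fun_start _ _ _ s2)|exact: chord_fun_p2].
apply: chord_funM => //; apply: chord_funM; last exact: chord_fun_detV.
exact: chord_funM.
Qed.

Lemma image_dist_derive p th : inn p ->
  is_derive th 1 (fun y => q (p, y)) (contact (p, th)).
Proof.
move=> ip; have [dS _] := chord_ends_derive HS (z := (p, th)) (0, 1) ip.
have {}dS := is_derive_slice2 dS.
have dg1S : is_derive th 1 (fun y => g1 (S (p, y) + pi)) _ :=
  is_derive_comp_fun dS (is_derive_shift_fun (dg1 HS _)).
have dg2S : is_derive th 1 (fun y => g2 (S (p, y) + pi)) _ :=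
  is_derive_comp_fun dS (is_derive_shift_fun (dg2 HS _)).
apply: (is_deriveW (is_deriveD_fun
  (is_deriveM_fun (is_derive_cos th) (is_deriveBr_fun p.1 dg1S))
  (is_deriveM_fun (is_derive_sin th) (is_deriveBr_fun p.2 dg2S)))).
rewrite /contact /rate2 /chord_coef1 /= sinDpi cosDpi !mul0r subrr mulr0 subr0.
by ring.
Qed.

Lemma chord_fun_continuous (f : plane * R -> R) p : cfun f -> inn p ->
  continuous (fun th => f (p, th)).
Proof.
move=> cf ip th; apply: (chord_fun_cvg HS cf).
- exact: cvg_slice.
- exact: inner_admissible.
- by near=> y; exact: inner_admissible.
Unshelve. all: by end_near. Qed.

Lemma contact_antiperiodic p th : inn p -> contact (p, th + pi) = - contact (p, th).
Proof.
move=> ip; apply: (derive_antiperiodic (f := fun y => q (p, y)) (f' := fun y => contact (p, y))).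
  by move=> x; exact: image_dist_derive.
by move=> x; exact: image_dist_antiperiodic HS HC _ _ ip.
Qed.

Lemma contact_derive p : inn p -> exists2 c' : R -> R,
  (forall th : R, is_derive th 1 (fun y => contact (p, y)) (c' th)) & continuous c'.
Proof.
move=> ip; have [f' f'c df] := chord_fun_derive HS chord_fun_contact (0, 1).
exists (fun th => f' (p, th)); last exact: chord_fun_continuous.
by move=> th; apply: is_derive_slice2; exact: df.
Qed.

Lemma energy_primitive p (K : R -> R) : inn p ->
  (forall th : R, is_derive th 1 K (contact (p, th) ^+ 2 - q (p, th) ^+ 2)) ->
  energy C p = 2^-1 * (K pi - K 0).
Proof.
move=> ip dK; have [c' dc cc'] := contact_derive ip.
rewrite /energy ifT; last by rewrite inE (region_inner HS).
have qE : q_ART C p = fun th => q (p, th) by apply/funext => th; exact: (q_ARTE HS HC).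
have q'E : derive1 (q_ART C p) = fun th => contact (p, th).
  apply/funext => th; rewrite qE derive1E.
  by have [_ ->] := image_dist_derive th ip.
pose X th := (p.1 + q (p, th) * cos th - contact (p, th) * sin th,
             p.2 + q (p, th) * sin th + contact (p, th) * cos th).
have XE : ART C p = X.
  apply/funext => th; rewrite /ART q'E qE /nvec /tauvec /X.
  by apply/pair_equal_spec; split; rewrite /= /GRing.scale /= ?mulrN.
have dX (th : R) : is_derive th 1 X (- (q (p, th) + c' th) * sin th, (q (p, th) + c' th) * cos th).
  apply: is_derive_pair.
    apply: (is_deriveW (is_deriveB_fun (is_deriveD_fun (is_derive_cst p.1 _ _)
      (is_deriveM_fun (image_dist_derive th ip) (is_derive_cos th)))
      (is_deriveM_fun (dc th) (is_derive_sin th)))).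
    by ring.
  apply: (is_deriveW (is_deriveD_fun (is_deriveD_fun (is_derive_cst p.2 _ _)
      (is_deriveM_fun (image_dist_derive th ip) (is_derive_sin th)))
      (is_deriveM_fun (dc th) (is_derive_cos th)))).
  by ring.
pose pn th := p.1 * cos th + p.2 * sin th.
pose pn' th := - p.1 * sin th + p.2 * cos th.
have dpn (th : R) : is_derive th 1 pn (pn' th).
  apply: (is_deriveW (is_deriveD_fun (is_deriveMl_fun _ (is_derive_cos th)) (is_deriveMl_fun _ (is_derive_sin th)))).
  by rewrite /pn'; ring.
have dpn' (th : R) : is_derive th 1 pn' (- pn th).
  apply: (is_deriveW (is_deriveD_fun (is_deriveMl_fun _ (is_derive_sin th)) (is_deriveMl_fun _ (is_derive_cos th)))).
  by rewrite /pn; ring.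
have cross_X th : cross (ART C p th) (derive1 (ART C p) th) =
    (q (p, th) + c' th) * (q (p, th) + pn th).
  rewrite XE derive1E; have [_ ->] := dX th.
  have E : cos th ^+ 2 = 1 - sin th ^+ 2 by exact: cos2sin2.
  by rewrite /cross /X /pn /=; ring: E.
pose B th := q (p, th) * contact (p, th) + (contact (p, th) * pn th - q (p, th) * pn' th).
have dB (th : R) : is_derive th 1 B ((q (p, th) + c' th) * (q (p, th) + pn th)
    + (contact (p, th) ^+ 2 - q (p, th) ^+ 2)).
  apply: (is_deriveW (is_deriveD_fun (is_deriveM_fun (image_dist_derive th ip) (dc th))
    (is_deriveB_fun (is_deriveM_fun (dc th) (dpn th)) (is_deriveM_fun (image_dist_derive th ip) (dpn' th))))).
  by ring.
have dBK (th : R) : is_derive th 1 (fun y => B y - K y) ((q (p, th) + c' th) * (q (p, th) + pn th)).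
  apply: (is_deriveW (is_deriveB_fun (dB th) (dK th))); ring.
rewrite /oriented_area.
under eq_Rintegral do rewrite cross_X.
rewrite (Rintegral_derive (pi_gt0 R) _ dBK); last first.
  have cq := chord_fun_continuous chord_fun_image_dist ip.
  have cpn : continuous pn by move=> th; exact: is_derive_continuous (dpn th).
  by move=> th; apply: cvgM; apply: cvgD; [exact: cq|exact: cc'|exact: cq|exact: cpn].
have -> : B pi = B 0.
  have a1 : q (p, pi) = - q (p, 0) by have := image_dist_antiperiodic HS HC 0 ip; rewrite add0r.
  have a2 : contact (p, pi) = - contact (p, 0) by have := contact_antiperiodic 0 ip; rewrite add0r.
  by rewrite /B /pn /pn' a1 a2 cospi sinpi cos0 sin0; ring.
by ring.
Qed.

Lemma energy_integral p : inn p -> energy C p =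
  2^-1 * \int[lebesgue_measure]_(th in `[0, pi]) (contact (p, th) ^+ 2 - q (p, th) ^+ 2).
Proof.
move=> ip.
have cf : continuous (fun th => contact (p, th) ^+ 2 - q (p, th) ^+ 2).
  apply: (chord_fun_continuous (f := fun z => contact z * contact z - q z * q z)) => //.
  by apply: chord_funB; apply: chord_funM; (exact: chord_fun_contact || exact: chord_fun_image_dist).
have [K dK] := continuous_primitive cf.
by rewrite (energy_primitive ip dK) (Rintegral_derive (pi_gt0 R) cf dK).
Qed.

End EnergyFormula.

(** * Regularity of the energy *)

Section EnergySmooth.
Context {R : realType}.
Local Notation plane := (R * R)%type.

Lemma Cn_on_eq (U : set plane) (n : nat) (f g : plane -> R) : open U ->
  (forall p, U p -> f p = g p) -> Cn_on U n f -> Cn_on U n g.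
Proof.
move=> oU; have nU p : U p -> nbhs p U by move=> Up; apply: open_nbhs_nbhs.
elim: n f g => [|n IH] f g fg /=.
  move=> cf p Up; rewrite -fg//; apply: cvg_trans (cf p Up).
  by apply: near_eq_cvg; apply: filterS (nU p Up) => q Uq; rewrite fg.
have fgn p : U p -> \near p, f p = g p.
  by move=> /nU; apply: filterS => q Uq; exact: fg.
move=> [df c1 c2]; split.
- move=> p Up; have [d1 d2] := df p Up.
  by split; apply: near_eq_derivable (fgn p Up) _.
- by apply: IH c1 => p Up; exact: near_eq_derive (fgn p Up).
- by apply: IH c2 => p Up; exact: near_eq_derive (fgn p Up).
Qed.

Lemma is_derive_along (f : plane -> R) (p v : plane) (x l : R) :
  is_derive (x *: v + p) v f l -> is_derive x 1 (fun t : R => f (t *: v + p)) l.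
Proof.
move=> /is_derive_line df.
have {}df : is_derive (x + (- x)) 1 (fun h : R => f (h *: v + (x *: v + p))) l by rewrite subrr.
have := is_derive_shift_fun df.
have -> // : (fun y : R => f ((y + - x) *: v + (x *: v + p))) = (fun t : R => f (t *: v + p)).
by apply/funext => t; rewrite addrA -scalerDl subrK.
Qed.

Lemma Rintegral_sub_mean (f g : R -> R) : continuous f -> continuous g ->
  exists c : R, 0 < c < pi /\ \int[lebesgue_measure]_(t in `[0, pi]) f t -
    \int[lebesgue_measure]_(t in `[0, pi]) g t = (f c - g c) * pi.
Proof.
move=> cf cg; have p0 := @pi_gt0 R.
have [F dF] := continuous_primitive cf; have [G dG] := continuous_primitive cg.
rewrite (Rintegral_derive p0 cf dF) (Rintegral_derive p0 cg dG).
have dFG (x : R) : is_derive x 1 (fun y => F y - G y) (f x - g x) by exact: is_deriveB_fun.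
have [c [cp E]] := mean_value dFG p0; exists c; split=> //.
by rewrite subr0 in E; rewrite -E; ring.
Qed.

Variables (C : set plane) (g1 g2 rho : R -> R).
Hypothesis HS : support_param C g1 g2 rho.
Hypothesis HC : oval C.
Implicit Types (p : plane) (x y th s t : R) (z d : plane * R).

Local Notation inn := (inner g1 g2).
Local Notation adm := (admissible g1 g2).
Local Notation cfun := (chord_fun g1 g2 rho).
Local Notation q := (image_dist g1 g2).
Local Notation cont := (contact g1 g2 rho).

Lemma near_inner p : inn p -> \forall p' \near p, inn p'.
Proof. by move=> ip; apply: open_nbhs_nbhs; split=> //; exact: (open_inner HS). Qed.

Lemma chord_fun_uniform f p (e : R) : cfun f -> inn p -> 0 < e ->
  \forall p' \near p, inn p' /\ forall th, 0 <= th <= pi -> `|f (p', th) - f (p, th)| < e.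
Proof.
move=> cf ip e0.
have cK : compact `[0, (pi : R)] by exact: segment_compact.
have cov := (proj1 (compact_near_coveringP _) cK) plane (nbhs p)
   (fun p' th => `|f (p', th) - f (p, th)| < e) _.
have H : \forall p' \near p, `[0, pi] `<=` (fun th => `|f (p', th) - f (p, th)| < e).
  apply: cov => th _.
  pose G := filter_prod (nbhs th) (nbhs p).
  have c2 : (fun y : R * plane => y.2) @ G --> p by exact: cvg_snd.
  have c1 : (fun y : R * plane => y.1) @ G --> th by exact: cvg_fst.
  have cZ : (fun y : R * plane => (y.2, y.1)) @ G --> (p, th) by exact: cvg_pair c2 c1.
  have cZ' : (fun y : R * plane => (p, y.1)) @ G --> (p, th) by exact: cvg_pair (cvg_cst p) c1.
  have ap : adm p th by exact: inner_admissible.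
  have l1 : (fun y : R * plane => f (y.2, y.1)) @ G --> f (p, th).
    apply: (chord_fun_cvg HS cf _ cZ ap).
    have : \forall y \near G, inn y.2 by apply: c2; exact: near_inner.
    by apply: filterS => y; exact: inner_admissible.
  have l2 : (fun y : R * plane => f (p, y.1)) @ G --> f (p, th).
    apply: (chord_fun_cvg HS cf _ cZ' ap).
    by apply: nearW => y; exact: inner_admissible.
  have l3 : f (y.2, y.1) - f (p, y.1) @[y --> G] --> f (p, th) - f (p, th) by exact: cvgB.
  have : \forall y \near G, `|(f (y.2, y.1) - f (p, y.1)) - (f (p, th) - f (p, th))| < e.
    exact: cvgr_distC_lt.
  by apply: filterS => y; rewrite subrr subr0.
apply: filterS2 (near_inner ip) H => p' ip' H; by split.
Qed.

Let I f p : R := \int[lebesgue_measure]_(th in `[0, pi]) f (p, th).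

Lemma chord_fun_integral_cvg f p : cfun f -> inn p -> I f p' @[p' --> p] --> I f p.
Proof.
move=> cf ip; apply/cvgrPdistC_lt => e e0.
have p0 := @pi_gt0 R.
have e0' : 0 < e / pi by rewrite divr_gt0.
apply: filterS (chord_fun_uniform cf ip e0') => p' [ip' H].
have [c [/andP[c0 cpi] E]] := Rintegral_sub_mean
  (chord_fun_continuous HS cf ip') (chord_fun_continuous HS cf ip).
rewrite /I E normrM (gtr0_norm p0) -ltr_pdivlMr//; apply: H.
by rewrite !ltW.
Qed.

Lemma chord_fun_integral_derive f f' p (v : plane) : cfun f -> cfun f' ->
  (forall z, inn z.1 -> is_derive z (v, 0) f (f' z)) -> inn p ->
  is_derive p v (I f) (I f' p).
Proof.
move=> cf cf' df ip; apply/is_derive_cvgP; apply/cvgrPdistC_lt => e e0.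
have p0 := @pi_gt0 R.
have e0' : 0 < e / pi by rewrite divr_gt0.
have cl : h *: v + p @[h --> (0 : R)] --> p.
  have : h *: v + p @[h --> (0 : R)] --> (0 : R) *: v + p.
    by apply: cvgD; [apply: cvgZr_tmp; exact: cvg_id|exact: cvg_cst].
  by rewrite scale0r add0r.
have : \forall h \near (0 : R), inn (h *: v + p) /\ forall th, 0 <= th <= pi ->
    `|f' (h *: v + p, th) - f' (p, th)| < e / pi.
  exact: cl _ (chord_fun_uniform cf' ip e0').
move=> /nbhs_ballP[d /= d0 Hd].
near=> h.
have h0 : h != 0 by near: h; exact: nbhs_dnbhs_neq.
have hd : `|h| < d.
  near: h; apply: cvg_within; apply/nbhs_ballP; exists d => // y.
  by rewrite /ball /= sub0r normrN.
have B (t : R) : 0 <= t <= 1 -> ball (0 : R) d (t * h).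
  move=> /andP[t0 t1]; rewrite /ball /= sub0r normrN normrM (ger0_norm t0).
  by apply: le_lt_trans hd; rewrite ler_piMl.
have ih : inn (h *: v + p) by have [] := Hd (1 * h) (B 1 _); rewrite ?mul1r// lexx ler01.
pose F th := h^-1 * (f (h *: v + p, th) - f (p, th)).
have cF : continuous F.
  move=> th; apply: cvgM; first exact: cvg_cst.
  by apply: cvgB; exact: (chord_fun_continuous HS cf).
have EI : h^-1 *: (I f (h *: v + p) - I f p) = I (fun z => F z.2) p.
  have [F1 dF1] := continuous_primitive (chord_fun_continuous HS cf ih).
  have [F2 dF2] := continuous_primitive (chord_fun_continuous HS cf ip).
  rewrite /I (Rintegral_derive p0 (chord_fun_continuous HS cf ih) dF1).
  rewrite (Rintegral_derive p0 (chord_fun_continuous HS cf ip) dF2).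
  have dF (th : R) : is_derive th 1 (fun y => h^-1 * (F1 y - F2 y)) (F th).
    by apply: is_deriveMl_fun; apply: is_deriveB_fun.
  by rewrite (Rintegral_derive p0 cF dF) /GRing.scale/=; ring.
rewrite EI /I /=.
have [c [/andP[c0 cpi] ->]] := Rintegral_sub_mean cF (chord_fun_continuous HS cf' ip).
rewrite normrM (gtr0_norm p0) -ltr_pdivlMr//.
pose G (t : R) := f (t *: (h *: v) + p, c).
have dG (t : R) : 0 <= t <= 1 -> is_derive t 1 G (h * f' ((t * h) *: v + p, c)).
  move=> t01; have [it _] := Hd _ (B t t01).
  have D1 := is_derive_slice1 (df ((t * h) *: v + p, c) it).
  have D2 := is_derive_along (f := fun w => f (w, c)) D1.
  have D3 : is_derive t 1 (fun s => s * h) h.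
    by apply: (is_deriveW (is_deriveM_fun (is_derive_id _ _) (is_derive_cst _ _ _))); rewrite mul1r mulr0 addr0.
  have := is_derive_comp_fun D3 D2.
  have -> : (fun s => f ((s * h) *: v + p, c)) = G by apply/funext => s; rewrite /G scalerA.
  by rewrite mulrC.
have [t [/andP[t0 t1] E]] := mean_value_seg dG ltr01.
have -> : F c = f' ((t * h) *: v + p, c).
  move: E; rewrite /G scale1r scale0r add0r subr0 mulr1 /F => ->.
  by rewrite mulKf.
have [|_ H] := Hd (t * h) (B t _); first by rewrite !ltW.
by apply: H; rewrite !ltW.
Unshelve. all: by end_near. Qed.

Lemma chord_fun_integral_smooth f n : cfun f -> Cn_on inn n (I f).
Proof.
elim: n f => [|n IH] f cf /=.
  by move=> p ip; exact: chord_fun_integral_cvg.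
have [f1 cf1 df1] := chord_fun_derive HS cf ((1, 0), 0).
have [f2 cf2 df2] := chord_fun_derive HS cf ((0, 1), 0).
have D1 p : inn p -> is_derive p (1, 0) (I f) (I f1 p).
  by move=> ip; exact: (chord_fun_integral_derive cf cf1 df1 ip).
have D2 p : inn p -> is_derive p (0, 1) (I f) (I f2 p).
  by move=> ip; exact: (chord_fun_integral_derive cf cf2 df2 ip).
split.
- by move=> p ip; split; [have [] := D1 p ip|have [] := D2 p ip].
- apply: (Cn_on_eq (open_inner HS) _ (IH _ cf1)) => p ip.
  by have [_ ->] := D1 p ip.
- apply: (Cn_on_eq (open_inner HS) _ (IH _ cf2)) => p ip.
  by have [_ ->] := D2 p ip.
Qed.

Lemma chord_fun_density :
  cfun (fun z => 2^-1 * (cont z * cont z - q z * q z)).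
Proof.
apply: chord_funM; first exact: chord_fun_cst.
by apply: chord_funB; apply: chord_funM;
  (exact: (chord_fun_contact HS) || exact: (chord_fun_image_dist HS)).
Qed.

Lemma energyE p : inn p -> energy C p =
  I (fun z => 2^-1 * (cont z * cont z - q z * q z)) p.
Proof.
move=> ip; have cf := chord_fun_continuous HS chord_fun_density ip.
have [K dK] := continuous_primitive cf.
have dK2 (th : R) : is_derive th 1 (fun y => 2 * K y) (cont (p, th) ^+ 2 - q (p, th) ^+ 2).
  by apply: (is_deriveW (is_deriveMl_fun _ (dK th))) => /=; field.
rewrite (energy_primitive HS HC ip dK2) /I (Rintegral_derive (pi_gt0 R) cf dK).
by field.
Qed.

Lemma energy_smooth : smooth_on (region C) (energy C).
Proof.
move=> n; rewrite (region_inner HS).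
apply: (Cn_on_eq (open_inner HS) _ (chord_fun_integral_smooth n chord_fun_density)).
by move=> p ip; rewrite energyE.
Qed.

End EnergySmooth.

Section EnergyBoundary.
Context {R : realType}.
Local Notation plane := (R * R)%type.
Variables (C : set plane) (g1 g2 rho : R -> R).
Hypothesis HS : support_param C g1 g2 rho.
Hypothesis HC : oval C.
Implicit Types (p : plane) (x y th s t : R) (z d : plane * R).

Local Notation gm := (gam g1 g2).
Local Notation gp := (gap g1 g2).
Local Notation inn := (inner g1 g2).
Local Notation adm := (admissible g1 g2).
Local Notation S := (chord_start g1 g2).
Local Notation T := (chord_stop g1 g2).
Local Notation det := (chord_det g1 g2 rho).
Local Notation cfun := (chord_fun g1 g2 rho).
Local Notation q := (image_dist g1 g2).
Local Notation cont := (contact g1 g2 rho).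

Definition along (p : plane) th x : R :=
  - sin th * (g1 x - p.1) + cos th * (g2 x - p.2).

(* The envelope touches the image line inside the image of the chord. *)
Lemma contact_convex z : adm z.1 z.2 -> exists m : R,
  [/\ 0 <= m <= 1, cont z = (1 - m) * along z.1 z.2 (S z + pi) + m * along z.1 z.2 (T z + pi) &
   m * det z = - (chord_coef1 rho z.2 (S z) * chord_coef2 g1 g2 rho z.1 (T z) (S z))].
Proof.
move=> az; have cz := chord_endsP HS az; have [p0 _ _] := az.
have d0 := chord_det_gt0 HS az.
have [l [/andP[l0 l1] _ _ E1 E2]] := chord_coef2_param HS p0 cz.
have [k1 k2] := chord_gaps_gt0 HS cz.
have a1 := chord_coef1_start_lt0 HS cz; have a2 := chord_coef1_stop_gt0 HS cz.
exists (- (chord_coef1 rho z.2 (S z) * chord_coef2 g1 g2 rho z.1 (T z) (S z)) / det z).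
split.
- rewrite ler_pdivrMr// ler_pdivlMr// mul0r mul1r; apply/andP; split.
    rewrite -mulNr; apply: mulr_ge0; first by rewrite oppr_ge0 ltW.
    by rewrite E2; apply: mulr_ge0; [rewrite subr_ge0|exact: ltW].
  rewrite /chord_det lerDr E1.
  by apply: mulr_ge0; [exact: ltW|apply: mulr_ge0 => //; exact: ltW].
- rewrite /contact /along /rate1 /=; field; exact: lt0r_neq0.
- by rewrite divfK// lt0r_neq0.
Qed.

Lemma contact_bounded : exists2 B : R, 0 <= B &
  forall p th, inn p -> `|q (p, th)| <= B /\ `|cont (p, th)| <= B.
Proof.
have [M HM] := gap_ge0_bounded g1 g2.
have Hg x := HM (gm x) (fun y => gap_gam_ge0 HS y x).
have M0 : 0 <= M by have [h _] := Hg 0; exact: le_trans h.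
exists (M *+ 4); first by rewrite mulrn_wge0.
move=> p th ip; have [p1 p2] := HM p (fun x => ltW (ip x)).
have H (a b x : R) : `|a| <= 1 -> `|b| <= 1 ->
    `|a * (g1 x - p.1) + b * (g2 x - p.2)| <= M *+ 4.
  move=> a1 b1; have [h1 h2] := Hg x.
  have u1 : `|a * (g1 x - p.1)| <= M + M.
    rewrite normrM (le_trans (ler_piMl _ a1))//.
    by rewrite (le_trans (ler_normB _ _))// lerD.
  have u2 : `|b * (g2 x - p.2)| <= M + M.
    rewrite normrM (le_trans (ler_piMl _ b1))//.
    by rewrite (le_trans (ler_normB _ _))// lerD.
  by rewrite (le_trans (ler_normD _ _))// (le_trans (lerD u1 u2))// !mulrS mulr0n; lra.
split; first by apply: H; [exact: cos_max|exact: sin_max].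
have [m [/andP[m0 m1] -> _]] := @contact_convex (p, th) (inner_admissible th ip).
have A x : `|along p th x| <= M *+ 4.
  by apply: H; [rewrite normrN; exact: sin_max|exact: cos_max].
rewrite (le_trans (ler_normD _ _))// !normrM (ger0_norm m0) ger0_norm ?subr_ge0//=.
have -> : M *+ 4 = (1 - m) * (M *+ 4) + m * (M *+ 4) by ring.
by rewrite lerD// ler_wpM2l// subr_ge0.
Qed.

Let u1 (c th : R) : R := cos th * (g1 (c + pi) - g1 c) + sin th * (g2 (c + pi) - g2 c).
Let u2 (c th : R) : R := - sin th * (g1 (c + pi) - g1 c) + cos th * (g2 (c + pi) - g2 c).

Let boundary_density c th : adm (gm c) th ->
  cont (gm c, th) = u2 c th /\ q (gm c, th) = u1 c th.
Proof.
move=> az; have cz := chord_endsP HS (z := (gm c, th)) az.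
have d0 := chord_det_gt0 HS (z := (gm c, th)) az.
have [m [_ cE mE]] := @contact_convex (gm c, th) az.
have ne : gm (S (gm c, th)) <> gm (T (gm c, th)).
  move=> /esym; apply: (gam_neq HS); case: cz => /andP[a b] /andP[a' b'] _ _ /=.
  by apply/andP; split; lra.
have [_ _ _ X] := cz.
have shift x : gm c = gm x -> gm (x + pi) = gm (c + pi).
  by move=> /(gam_inj HS)[k ->]; rewrite addrAC (gam_periodz HS).
have [e|e] := line_gam2 HS ne (line_crossP ne X).
  have [e1 e2] := shift _ e; have [f1 f2] := e.
  have : m * det (gm c, th) = 0.
    by rewrite mE /chord_coef2 /= -f1 -f2 !subrr !mulr0 addr0 mulr0 oppr0 mulr0 oppr0.
  move=> /eqP; rewrite mulf_eq0 (gt_eqF d0) orbF => /eqP m0.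
  split; last by rewrite /image_dist /= e1 e2.
  by rewrite cE m0 subr0 mul1r mul0r addr0 /along /= e1 e2.
have [e1 e2] := shift _ e; have [f1 f2] := e.
have : m * det (gm c, th) = 1 * det (gm c, th).
  rewrite mE mul1r /chord_det /chord_coef2 /= -f1 -f2 !subrr !mulr0 addr0 mulr0 oppr0.
  by rewrite mulr0 add0r.
move=> /(mulIf (lt0r_neq0 d0)) m1.
split; first by rewrite cE m1 subrr mul0r add0r mul1r /along /= e1 e2.
by rewrite (image_dist_stop HS)//= e1 e2.
Qed.

Let boundary_integral (c : R) :
  (\int[lebesgue_measure]_(th in `[0%R, pi]) ((u2 c th ^+ 2 - u1 c th ^+ 2)%R)%:E)%E = 0%E.
Proof.
have d1 (th : R) : is_derive th 1 (u1 c) (u2 c th).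
  have -> : u1 c = (fun y => (g1 (c + pi) - g1 c) * cos y + (g2 (c + pi) - g2 c) * sin y).
    by apply/funext => y; rewrite /u1; ring.
  apply: (is_deriveW (is_deriveD_fun (is_deriveMl_fun _ (is_derive_cos th)) (is_deriveMl_fun _ (is_derive_sin th)))).
  by rewrite /u2; ring.
have d2 (th : R) : is_derive th 1 (u2 c) (- u1 c th).
  have -> : u2 c = (fun y => (g2 (c + pi) - g2 c) * cos y - (g1 (c + pi) - g1 c) * sin y).
    by apply/funext => y; rewrite /u2; ring.
  apply: (is_deriveW (is_deriveB_fun (is_deriveMl_fun _ (is_derive_cos th)) (is_deriveMl_fun _ (is_derive_sin th)))).
  by rewrite /u1; ring.
have d12 (th : R) : is_derive th 1 (fun y => u1 c y * u2 c y) (u2 c th ^+ 2 - u1 c th ^+ 2).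
  by apply: (is_deriveW (is_deriveM_fun (d1 th) (d2 th))); ring.
have c12 : continuous (fun th => u1 c th * u2 c th).
  by move=> th; exact: is_derive_continuous (d12 th).
have cf : continuous (fun th => u2 c th ^+ 2 - u1 c th ^+ 2).
  have k1 : continuous (u1 c) by move=> th; exact: is_derive_continuous (d1 th).
  have k2 : continuous (u2 c) by move=> th; exact: is_derive_continuous (d2 th).
  by move=> th; apply: cvgB; rewrite expr2; apply: cvgM; (exact: k1 || exact: k2).
rewrite (@continuous_FTC2 R _ (fun th => u1 c th * u2 c th))//.
- by rewrite /u1 /u2 sinpi cospi sin0 cos0 -EFinB; congr EFin; ring.
- exact: pi_gt0.
- exact: continuous_subspaceT.
- split.
  + by move=> x _; have [] := d12 x.
  + by apply: cvg_at_right_filter; exact: c12.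
  + by apply: cvg_at_left_filter; exact: c12.
- by move=> x _; rewrite derive1E; have [_ ->] := d12 x.
Qed.

Lemma energy_seq_cvg0 c (P : nat -> plane) : (forall n, inn (P n)) ->
  P n @[n --> \oo] --> gm c -> energy C (P n) @[n --> \oo] --> 0.
Proof.
move=> iP cP.
have [B B0 HB] := contact_bounded.
pose f n th := cont (P n, th) ^+ 2 - q (P n, th) ^+ 2.
have cf n : continuous (f n).
  apply: (chord_fun_continuous HS (f := fun z => cont z * cont z - q z * q z)) => //.
  by apply: chord_funB; apply: chord_funM; (exact: (chord_fun_contact HS) || exact: (chord_fun_image_dist HS)).
pose fl th := u2 c th ^+ 2 - u1 c th ^+ 2.
have cfl : continuous fl.
  have k (a b : R) (g h : R -> R) : continuous g -> continuous h -> continuous (fun th => g th * a + h th * b).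
    by move=> cg ch th; apply: cvgD; apply: cvgM; [exact: cg|exact: cvg_cst|exact: ch|exact: cvg_cst].
  have k1 : continuous (u1 c) by apply: k; [exact: continuous_cos|exact: continuous_sin].
  have k2 : continuous (u2 c).
    apply: k; last exact: continuous_cos.
    by move=> th; apply: cvgN; exact: continuous_sin.
  by move=> th; apply: cvgB; rewrite expr2; apply: cvgM; (exact: k1 || exact: k2).
have mc (g : R -> R) : continuous g -> measurable_fun (`[0, pi] : set R) (EFin \o g).
  by move=> cg; apply/measurable_EFinP; apply: measurable_funTS; exact: continuous_measurable_fun.
pose N : set R := range (fun k : bool * int => c - (if k.1 then pi else 0) + k.2%:~R * (pi *+ 2)).
have cN : countable N.
  apply: sub_countable (countableP [set: bool * int]); exact: card_image_le.
have lim_ae : {ae lebesgue_measure, forall th : R, `[0, pi]%classic th ->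
    (EFin \o f n) th @[n --> \oo] --> (EFin \o fl) th}.
  exists N; split; [exact: countable_measurable|exact: countable_lebesgue_measure0|].
  move=> /= th; change (Real.sort R) in th; move=> nth; apply: contrapT => nN; apply: nth => _.
  have az : adm (gm c) th.
    have pos x : (forall k : int, x <> c + k%:~R * (pi *+ 2)) -> 0 < gp (gm c) x.
      move=> nx; rewrite lt_neqAle (gap_gam_ge0 HS) andbT eq_sym; apply/eqP.
      move=> /(gap_gam_eq0 HS)[k cE]; apply: (nx (- k)).
      by rewrite cE mulrNz mulNr addrK.
    split; first by move=> x; exact: (gap_gam_ge0 HS).
      by apply: pos => k E; apply: nN; exists (false, k) => //=; rewrite subr0.
    apply: pos => k E; apply: nN; exists (true, k) => //=.
    by rewrite addrAC -E addrK.
  have [e1 e2] := boundary_density az.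
  apply: cvg_EFin; first exact: nearW.
  rewrite /fl -e1 -e2 !expr2.
  have cZ : (P n, th) @[n --> \oo] --> (gm c, th) by exact: cvg_pair cP (cvg_cst th).
  have aZ : \forall n \near \oo, adm (P n) th by apply: nearW => n; exact: inner_admissible.
  have cfun0 : cfun (fun z => cont z * cont z - q z * q z).
    by apply: chord_funB; apply: chord_funM; (exact: (chord_fun_contact HS) || exact: (chord_fun_image_dist HS)).
  exact: (chord_fun_cvg HS cfun0 _ cZ az aZ).
have dom n th : (`|(f n th)%:E| <= (B ^+ 2)%R%:E)%E.
  rewrite lee_fin /f; have [h1 h2] := HB (P n) th (iP n).
  have k1 : cont (P n, th) ^+ 2 <= B ^+ 2 by rewrite -real_normK ?num_real// lerXn2r ?nnegrE.
  have k2 : q (P n, th) ^+ 2 <= B ^+ 2 by rewrite -real_normK ?num_real// lerXn2r ?nnegrE.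
  have k3 : 0 <= cont (P n, th) ^+ 2 by exact: sqr_ge0.
  have k4 : 0 <= q (P n, th) ^+ 2 by exact: sqr_ge0.
  by rewrite ler_norml; apply/andP; split; lra.
have int_cst : lebesgue_measure.-integrable `[0, (pi : R)] (EFin \o cst (B ^+ 2)).
  apply: continuous_compact_integrable; first exact: segment_compact.
  by apply: continuous_subspaceT => x; exact: cvg_cst.
have dom_ae : {ae lebesgue_measure, forall (th : R) (n : nat), `[0, pi]%classic th ->
    (`|(EFin \o f n) th| <= (EFin \o cst (B ^+ 2)%R) th)%E}.
  by apply: aeW => th n _; exact: dom.
have [_ _ L] := @dominated_convergence _ _ _ lebesgue_measure `[0, (pi : R)] (measurable_itv _)
  (fun n => EFin \o f n) (EFin \o fl) (EFin \o cst (B ^+ 2)) (fun n => mc _ (cf n)) (mc _ cfl)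
  lim_ae int_cst dom_ae.
rewrite /= boundary_integral in L.
have -> : (fun n => energy C (P n)) = (fun n => 2^-1 * fine (\int[lebesgue_measure]_(th in `[0%R, pi]) (f n th)%:E)%E).
  by apply/funext => n; rewrite (energy_integral HS HC (iP n)).
have {}L : fine (\int[lebesgue_measure]_(th in `[0%R, pi]) (f n th)%:E)%E @[n --> \oo] --> (0 : R).
  exact: (fine_cvg L).
have H := cvgM (cvg_cst (2^-1 : R)) L; have E : 2^-1 * 0 = 0 :> R := mulr0 _.
by rewrite E in H; exact: H.
Qed.

Lemma curve_not_region p : C p -> ~ region C p.
Proof. by move=> Cp []. Qed.

Lemma energy_curve p : C p -> energy C p = 0.
Proof. by move=> Cp; rewrite /energy memNset//; exact: curve_not_region. Qed.

Lemma closure_region : closure (region C) = [set p | forall x, 0 <= gp p x].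
Proof. by rewrite (region_inner HS) (closure_inner HS). Qed.

Lemma energy_continuous : {within closure (region C), continuous (energy C)}.
Proof.
apply/subspace_continuousP => p; rewrite closure_region => p0.
have [ip|Cp] := gap_ge0_cases HS p0.
  have := energy_smooth HS HC 0 p; rewrite (region_inner HS) => /(_ ip).
  exact: cvg_within_filter.
rewrite /from_subspace (energy_curve Cp); move: Cp => /(gam_surj HS)[c pE].
apply/cvgrPdist_lt => e e0; apply: contrapT => nE.
have H (n : nat) : exists p' : plane, [/\ inn p', ball p (n.+1%:R^-1) p' & e <= `|energy C p'|].
  apply: contrapT => nH; apply: nE.
  apply/nbhs_ballP; exists (n.+1%:R^-1) => /=; first by rewrite invr_gt0.
  move=> p' pp' p'0; rewrite sub0r normrN ltNge; apply/negP => le; apply: nH.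
  have [ip'|Cp'] := gap_ge0_cases HS p'0; first by exists p'.
  by move: le; rewrite (energy_curve Cp') normr0 leNgt e0.
have [P HP] := choice H.
have cP : P n @[n --> \oo] --> gm c.
  rewrite -pE; apply/cvg_ballP => r r0.
  have := near_infty_natSinv_lt (PosNum r0); apply: filterS => n nr.
  by have [_ + _] := HP n; apply: le_ball; exact: ltW.
have := energy_seq_cvg0 (fun n => let: And3 h _ _ := HP n in h) cP.
move=> /cvgrPdist_lt/(_ e e0)[n _ /(_ n (leqnn n))]; rewrite sub0r normrN ltNge.
by have [_ _ ->] := HP n.
Qed.

End EnergyBoundary.

(** * The Wirtinger inequality *)

Section Wirtinger.
Context {R : realType}.

Lemma derive0_cst (f : R -> R) : (forall x : R, is_derive x 1 f 0) -> forall x y, f x = f y.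
Proof.
move=> df x y; wlog xy : x y / x <= y.
  by move=> H; case/orP: (le_total x y) => [/H|/H ->].
apply/eqP; rewrite eq_le; apply/andP; split.
  by apply: (derive_ge0_le df).
rewrite -lerN2; apply: (derive_ge0_le (f := fun x => - f x) (f' := fun _ => 0)) => // z.
by apply: is_deriveW (is_deriveN_fun (df z)) _; rewrite oppr0.
Qed.

Section ZeroAtOrigin.
Variables q q' K : R -> R.
Hypothesis dq : forall x : R, is_derive x 1 q (q' x).
Hypothesis dK : forall x : R, is_derive x 1 K (q' x ^+ 2 - q x ^+ 2).
Hypothesis qpi : forall x, q (x + pi) = - q x.
Hypothesis q0 : q 0 = 0.

(* [G' = (q' - q cot)^2], and [A] tends to [0] at the zeros of [sin], which are
   also zeros of [q]. *)
Let A (x : R) : R := q x ^+ 2 * (cos x / sin x).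
Let G (x : R) : R := K x - A x.

Let Api x : A (x + pi) = A x.
Proof. by rewrite /A qpi sinDpi cosDpi sqrrN invrN mulrNN. Qed.

Let dG (x : R) : 0 < x < pi -> is_derive x 1 G ((q' x - q x * (cos x / sin x)) ^+ 2).
Proof.
move=> xpi; have s0 : sin x != 0 by rewrite lt0r_neq0// sin_gt0_pi.
apply: (is_deriveW (is_deriveB_fun (dK x) (is_deriveM_fun
  (is_deriveM_fun (dq x) (dq x)) (is_deriveM_fun (is_derive_cos x)
  (is_deriveV_fun s0 (is_derive_sin x)))))).
have E : cos x ^+ 2 = 1 - sin x ^+ 2 by exact: cos2sin2.
by field: E.
Qed.

Let cvgA : A h @[h --> (0 : R)^'] --> 0.
Proof.
have slope (f : R -> R) (l : R) : f 0 = 0 -> is_derive (0 : R) 1 f l ->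
    h^-1 * f h @[h --> (0 : R)^'] --> l.
  move=> f0 /is_derive_cvgP; rewrite f0.
  rewrite (_ : (fun h => h^-1 *: (f (h *: 1 + 0) - 0)) = (fun h => h^-1 * f h))//.
  by apply/funext => h; rewrite subr0 addr0 [h *: 1]mulr1.
have sl1 := slope q _ q0 (dq 0).
have sl2 := slope sin _ (sin0 R) (is_derive_sin 0); rewrite cos0 in sl2.
have c0 : q h @[h --> (0 : R)^'] --> 0.
  by rewrite -{2}q0; apply: cvg_within_filter; exact: is_derive_continuous (dq 0).
have c1 : cos h @[h --> (0 : R)^'] --> (1 : R).
  by rewrite -cos0; apply: cvg_within_filter; exact: continuous_cos.
have sl2V : (h^-1 * sin h)^-1 @[h --> (0 : R)^'] --> (1 : R)^-1.
  by apply: cvgV => //; exact: oner_neq0.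
have L : h^-1 * q h * q h * cos h * (h^-1 * sin h)^-1 @[h --> (0 : R)^'] --> q' 0 * 0 * 1 * 1^-1.
  exact: cvgM (cvgM (cvgM sl1 c0) c1) sl2V.
rewrite [in X in _ --> X]mulr0 !mul0r in L; apply: cvg_trans L; apply: near_eq_cvg.
near=> h; have h0 : h != 0 by near: h; exact: nbhs_dnbhs_neq.
by rewrite /A invfM invrK; move: (sin h)^-1 => s; field.
Unshelve. all: by end_near. Qed.

Let Gle (x y : R) : 0 < x -> x <= y -> y < pi -> G x <= G y.
Proof.
move=> x0; rewrite le_eqVlt => /predU1P[->//|xy] ypi.
have [|c [cxy E]] := mean_value_seg (f := G) (f' := fun x => (q' x - q x * (cos x / sin x)) ^+ 2) (a := x) (b := y) _ xy.
  by move=> z /andP[xz zy]; apply: dG; rewrite (lt_le_trans x0 xz) (le_lt_trans zy ypi).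
by rewrite -subr_ge0 E mulr_ge0 ?sqr_ge0// subr_ge0 ltW.
Qed.

Let cK : continuous K.
Proof. by move=> x; exact: is_derive_continuous (dK x). Qed.

Let K0le (y : R) : 0 < y < pi -> K 0 <= G y.
Proof.
move=> /andP[y0 ypi].
have c1 : G h @[h --> (0 : R)^'+] --> K 0.
  rewrite -[K 0]subr0; apply: cvgB; first by apply: cvg_at_right_filter; exact: cK.
  exact: cvg_dnbhs_at_right cvgA.
apply: (ler_cvg_to c1 (cvg_cst (G y))).
near=> h; apply: Gle => //.
by near: h; exact: nbhs_right_ltW.
Unshelve. all: by end_near. Qed.

Let leKpi (y : R) : 0 < y < pi -> G y <= K pi.
Proof.
move=> /andP[y0 ypi].
have c1 : G (h + pi) @[h --> (0 : R)^'-] --> K pi.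
  have -> : (fun h : R => G (h + pi)) = (fun h => K (h + pi) - A h).
    by apply/funext => h; rewrite /G Api.
  rewrite -[K pi]subr0; apply: cvgB; last exact: cvg_dnbhs_at_left cvgA.
  have ch : h + pi @[h --> (0 : R)] --> (pi : R).
    have : h + pi @[h --> (0 : R)] --> 0 + pi by apply: cvgD; [exact: cvg_id|exact: cvg_cst].
    by rewrite add0r.
  have cKh : K (h + pi) @[h --> (0 : R)] --> K pi.
    exact: (@cvg_apply R R (nbhs 0) _ K (fun h : R => h + pi) pi cK ch).
  exact: cvg_at_left_filter cKh.
apply: (ler_cvg_to (cvg_cst (G y)) c1).
near=> h; have h0 : h < 0 by near: h; exact: nbhs_left_lt.
apply: Gle => //; last by rewrite gtrDr.
by rewrite -lerBlDr; apply/ltW; near: h; apply: nbhs_left_gt; rewrite subr_lt0.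
Unshelve. all: by end_near. Qed.

Lemma wirtinger_origin : K 0 <= K pi.
Proof.
have H : 0 < (pi : R) / 2 < pi by have p0 := pi_gt0 R; apply/andP; split; lra.
exact: le_trans (K0le H) (leKpi H).
Qed.

Lemma wirtinger_origin_eq : K 0 = K pi -> exists c : R, forall x, q x = c * sin x.
Proof.
move=> KE.
have Gc (x : R) : 0 < x < pi -> G x = K 0.
  by move=> xp; apply/eqP; rewrite eq_le K0le// andbT KE leKpi.
have q'E (x : R) : 0 < x < pi -> q' x = q x * (cos x / sin x).
  move=> xp; have := dG xp => dGx.
  have d0 : is_derive x 1 G 0.
    have [d e] := is_derive_cst (K 0) x (1 : R).
    have nE : \near x, cst (K 0) x = G x.
      have : \forall y \near x, 0 < y < pi.
        by have [a b] := andP xp; near=> y; apply/andP; split; near: y;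
          [exact: lt_nbhsr|exact: lt_nbhsl].
      by apply: filterS => y /Gc ->.
    split; first exact: near_eq_derivable nE d.
    by rewrite -e; apply/esym; exact: near_eq_derive nE.
  have [_ e1] := dGx; have [_ e2] := d0; move: e2; rewrite e1 => /eqP.
  by rewrite sqrf_eq0 subr_eq0 => /eqP.
have d0 (x : R) : 0 < x < pi -> is_derive x 1 (fun y => q y * (sin y)^-1) 0.
  move=> xp; have s0 : sin x != 0 by rewrite lt0r_neq0// sin_gt0_pi.
  apply: (is_deriveW (is_deriveM_fun (dq x) (is_deriveV_fun s0 (is_derive_sin x)))).
  by rewrite q'E//; field.
have pp := pi_gt0 R.
have H : 0 < (pi : R) / 2 < pi by apply/andP; split; lra.
pose c := q (pi / 2) * (sin (pi / 2))^-1.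
have cE (x : R) : 0 < x < pi -> q x * (sin x)^-1 = c.
  move=> xp; have [a b] := andP xp; have [a' b'] := andP H.
  case: (ltgtP x (pi / 2)) => [h|h|->//].
    have [|z [_ E]] := mean_value_seg (f := fun y => q y * (sin y)^-1) (f' := fun _ => 0) _ h.
      by move=> z /andP[z1 z2]; apply: d0; apply/andP; split; lra.
    by move: E; rewrite mul0r => /eqP; rewrite subr_eq0 => /eqP <-.
  have [|z [_ E]] := mean_value_seg (f := fun y => q y * (sin y)^-1) (f' := fun _ => 0) _ h.
    by move=> z /andP[z1 z2]; apply: d0; apply/andP; split; lra.
  by move: E; rewrite mul0r => /eqP; rewrite subr_eq0 => /eqP.
exists c.
have base (x : R) : 0 <= x < pi -> q x = c * sin x.
  rewrite le_eqVlt => /andP[/predU1P[<- _|x0 xp]]; first by rewrite q0 sin0 mulr0.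
  have xp' : 0 < x < pi by rewrite x0.
  by rewrite -(cE x xp') divfK// lt0r_neq0// sin_gt0_pi.
have stepk (n : nat) (x : R) : q (x + n%:R * pi) - c * sin (x + n%:R * pi) = (-1) ^+ n * (q x - c * sin x).
  elim: n => [|n IH]; first by rewrite mul0r addr0 expr0 mul1r.
  rewrite -natr1 mulrDl mul1r addrA qpi sinDpi exprS -mulrA -IH; ring.
have stepn (n : nat) (x : R) : 0 <= x < pi -> q (x - n%:R * pi) = c * sin (x - n%:R * pi).
  move=> xp; have := stepk n (x - n%:R * pi); rewrite subrK base// subrr => /esym/eqP.
  by rewrite mulf_eq0 expf_eq0 oppr_eq0 oner_eq0 andbF /= subr_eq0 => /eqP.
have stepp (n : nat) (x : R) : 0 <= x < pi -> q (x + n%:R * pi) = c * sin (x + n%:R * pi).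
  by move=> xp; apply/eqP; rewrite -subr_eq0 stepk base// subrr mulr0.
move=> x; pose k := Num.floor (x / pi); pose y := x - k%:~R * pi.
have yp : 0 <= y < pi.
  have := Num.Theory.floor_itv (x / pi); rewrite -/k => /andP[h1 h2].
  rewrite /y subr_ge0 -ler_pdivlMr// h1 /= ltrBlDl -[X in _ + X]mul1r -mulrDl -ltr_pdivrMr//.
  by rewrite -[1]/(1%:~R) -intrD.
have -> : x = y + k%:~R * pi by rewrite /y subrK.
move: yp; move: (y) (k) => {}y [n|n] yp; first exact: stepp.
by rewrite NegzE mulrNz mulNr; exact: stepn.
Unshelve. all: by end_near. Qed.

End ZeroAtOrigin.

Lemma wirtinger (q q' K : R -> R) : (forall x : R, is_derive x 1 q (q' x)) ->
  (forall x : R, is_derive x 1 K (q' x ^+ 2 - q x ^+ 2)) ->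
  (forall x, q (x + pi) = - q x) ->
  K 0 <= K pi /\
  (K 0 = K pi -> exists a b : R, forall x, q x = a * cos x + b * sin x).
Proof.
move=> dq dK qpi; have pp := pi_gt0 R.
have cq : continuous q by move=> x; exact: is_derive_continuous (dq x).
have [x0 qx0] : exists x0, q x0 = 0.
  have qp : q pi = - q 0 by rewrite -{1}[pi]add0r qpi.
  have [|||x xi E] := @IVT _ q 0 pi 0.
  - exact: ltW.
  - exact: continuous_subspaceT.
  - rewrite qp; case: (leP (q 0) (- q 0)) => h; apply/andP; split; lra.
  - by exists x.
have q'pi := derive_antiperiodic dq qpi.
have Kpi x : K (x + pi) - K x = K pi - K 0.
  rewrite -[in RHS](add0r pi); apply: (derive0_cst (f := fun x => K (x + pi) - K x)) => y.
  apply: (is_deriveW (is_deriveB_fun (is_derive_shift_fun (dK (y + pi))) (dK y))).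
  by rewrite q'pi qpi !sqrrN subrr.
have dqs (x : R) : is_derive x 1 (fun y => q (y + x0)) (q' (x + x0)) by exact: is_derive_shift_fun.
have dKs (x : R) : is_derive x 1 (fun y => K (y + x0)) (q' (x + x0) ^+ 2 - q (x + x0) ^+ 2).
  exact: is_derive_shift_fun.
have qs x : q (x + pi + x0) = - q (x + x0) by rewrite addrAC qpi.
have q0 : q (0 + x0) = 0 by rewrite add0r.
have E : K (pi + x0) - K (0 + x0) = K pi - K 0 by rewrite add0r [pi + x0]addrC Kpi.
split.
  rewrite -subr_ge0 -E subr_ge0.
  exact: (wirtinger_origin (q := fun y => q (y + x0)) (q' := fun y => q' (y + x0)) (K := fun y => K (y + x0))).
move=> KE.
have [|c qE] := wirtinger_origin_eq (q := fun y => q (y + x0)) (q' := fun y => q' (y + x0))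
   (K := fun y => K (y + x0)) dqs dKs qs q0.
  by apply/esym/eqP; rewrite -subr_eq0 E KE subrr.
exists (- c * sin x0), (c * cos x0) => x.
by have := qE (x - x0); rewrite subrK sinB => ->; ring.
Qed.

End Wirtinger.

Section EnergySign.
Context {R : realType}.
Local Notation plane := (R * R)%type.
Variables (C : set plane) (g1 g2 rho : R -> R).
Hypothesis HS : support_param C g1 g2 rho.
Hypothesis HC : oval C.
Implicit Types (p : plane) (x y th s t : R).
Local Notation q := (image_dist g1 g2).
Local Notation inn := (inner g1 g2).

Lemma energy_sign p : inn p -> 0 <= energy C p /\
  (energy C p = 0 -> exists a b : R, forall x, q (p, x) = a * cos x + b * sin x).
Proof.
move=> ip.
have cf := chord_fun_continuous HS (chord_fun_density HS) ip.
have [K dK] := continuous_primitive cf.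
have dK2 (th : R) : is_derive th 1 (fun y => 2 * K y) (contact g1 g2 rho (p, th) ^+ 2 - q (p, th) ^+ 2).
  by apply: (is_deriveW (is_deriveMl_fun _ (dK th))) => /=; field.
have [h1 h2] := wirtinger (fun th => image_dist_derive HS th ip) dK2 (fun x => image_dist_antiperiodic HS HC x ip).
rewrite (energy_primitive HS HC ip dK2); split; first by rewrite mulr_ge0 ?subr_ge0.
move=> /eqP; rewrite mulf_eq0 invr_eq0 pnatr_eq0 /= subr_eq0 => /eqP /esym.
exact: h2.
Qed.

Lemma energy_ge0 p : closure (region C) p -> 0 <= energy C p.
Proof.
rewrite (closure_region HS) => /(gap_ge0_cases HS)[/energy_sign[]//|Cp].
by rewrite energy_curve.
Qed.

Lemma compact_closure_region : compact (closure (region C)).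
Proof.
have [M HM] := gap_ge0_bounded g1 g2.
have cK : compact (`[- M, M]%classic `*` `[- M, M]%classic : set plane).
  by apply: compact_setX; exact: segment_compact.
apply: (subclosed_compact _ cK); first exact: closed_closure.
move=> p; rewrite (closure_region HS) => /HM[h1 h2].
by split; rewrite /= in_itv /= -ler_norml.
Qed.

Lemma argmax_nonempty : argmax_energy C !=set0.
Proof.
have n0 : closure (region C) !=set0.
  have [p ip] := inner_nonempty HS; exists p.
  by apply: subset_closure; rewrite (region_inner HS).
have [p Kp H] := compact_EVT_max n0 compact_closure_region (energy_continuous HS HC).
by exists p; split; [rewrite -in_setE|move=> p' Kp'; apply: H; rewrite in_setE].
Qed.

Lemma argmax_compact : compact (argmax_energy C).
Proof.
have [p0 [Kp0 H0]] := argmax_nonempty.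
apply: (subclosed_compact _ compact_closure_region) => [|p []//].
move=> p clp.
have Kp : closure (region C) p.
  by apply: (@closed_closure _ (region C)); apply: closureS clp => p' [].
split; first exact: Kp.
move=> p' /H0 h; apply: (le_trans h); rewrite leNgt; apply/negP => lt.
have /subspace_continuousP/(_ _ Kp) cE := energy_continuous HS HC.
have /clp[p1 [[Kp1 H1] /(_ Kp1)]] : within (closure (region C)) (nbhs p) (fun p1 => energy C p1 < energy C p0).
  exact: (cvgr_lt _ cE).
by rewrite ltNge H1.
Qed.

End EnergySign.

(** * Affine maps *)

Section AffineArea.
Context {R : realType}.
Local Notation plane := (R * R)%type.
Local Notation mu := (@lebesgue_measure R).

Lemma lebesgue_affine_image (a k : R) (A : set R) : a != 0 -> measurable A ->
  mu ((fun t => a * t + k) @` A) = (`|a|%:E * mu A)%E.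
Proof.
move=> a0 mA.
pose g (t : R) := (t - k) / a.
have mg : measurable_fun [set: measurableTypeR R] (g : measurableTypeR R -> measurableTypeR R).
  apply: continuous_measurable_fun => t.
  by apply: cvgM; [apply: cvgB; [exact: cvg_id|exact: cvg_cst]|exact: cvg_cst].
have imE (B : set R) : (fun t => a * t + k) @` B = g @^-1` B.
  rewrite eqEsubset; split => [_ [t Bt <-]|t Bt].
    by rewrite /g /= addrK mulrAC divff// mul1r.
  by exists (g t) => //; rewrite /g mulrC divfK// subrK.
have a1 : 0 <= `|a|^-1 by rewrite invr_ge0.
pose nu := mscale (NngNum a1) (measure_function_pushforward__canonical__measure_function_Measure mu mg).
have nuE (B : set R) : nu B = (`|a|^-1%:E * mu ((fun t : R => a * t + k)%R @` B))%E.
  by rewrite imE.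
have -> : mu A = nu A.
  apply: lebesgue_measure_unique => // X /ocitvP[->|[[x y] /= xy ->]].
    by rewrite !measure0.
  have xyE : mu `]x, y]%classic = (y - x)%:E by rewrite lebesgue_measure_itv /= lte_fin xy.
  rewrite xyE -[RHS]/(nu `]x, y]%classic) nuE imE.
  case: (ltgtP a 0) a0 => // [an|ap] _.
    have -> : g @^-1` `]x, y]%classic = `[a * y + k, a * x + k[%classic.
      apply/seteqP; split => t /=; rewrite !in_itv /= /g ltr_ndivlMr// ler_ndivrMr// ltrBlDr lerBrDr;
        by rewrite ![_ * a]mulrC andbC.
    rewrite lebesgue_measure_itv /= lte_fin ltrD2r ltr_nM2l// xy -EFinB -EFinM ltr0_norm//.
    by congr EFin; field; rewrite lt_eqF.
  have -> : g @^-1` `]x, y]%classic = `]a * x + k, a * y + k]%classic.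
    apply/seteqP; split => t /=; rewrite !in_itv /= /g ltr_pdivlMr// ler_pdivrMr// ltrBrDr lerBlDr;
      by rewrite ![_ * a]mulrC.
  rewrite lebesgue_measure_itv /= lte_fin ltrD2r ltr_pM2l// xy -EFinB -EFinM gtr0_norm//.
  by congr EFin; field; rewrite gt_eqF.
by rewrite nuE muleA -EFinM divff ?normr_eq0// mul1e.
Qed.

Local Notation area := (mu \x mu)%E.

Lemma area_swap (X : set plane) : measurable X -> area X = (mu \x^ mu)%E X.
Proof.
move=> mX; apply: product_measure_unique => // A B mA mB.
exact: product_measure2E.
Qed.

Lemma area_vertical (a c k : R) (X : set plane) : a != 0 -> measurable X ->
  area ((fun z => (z.1, c * z.1 + a * z.2 + k)) @` X) = (`|a|%:E * area X)%E.
Proof.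
move=> a0 mX; rewrite /product_measure1.
rewrite -ge0_integralZl//; last by exact: measurable_fun_xsection.
apply: eq_integral => x _ /=.
rewrite -(lebesgue_affine_image (c * x + k) a0); last exact: measurable_xsection.
congr (mu _); apply/seteqP; split => y.
  rewrite /xsection /= inE => -[[u v] Xuv [<- <-]]; exists v; last by ring.
  by rewrite /xsection /= inE.
rewrite /xsection /= => -[v]; rewrite /= inE => Xv <-; rewrite inE.
by exists (x, v) => //=; congr pair; ring.
Qed.

Lemma area_horizontal (a c k : R) (X : set plane) : a != 0 -> measurable X ->
  measurable ((fun z : plane => (a * z.1 + c * z.2 + k, z.2)) @` X) ->
  area ((fun z => (a * z.1 + c * z.2 + k, z.2)) @` X) = (`|a|%:E * area X)%E.
Proof.
move=> a0 mX mY; rewrite !area_swap// /product_measure2.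
rewrite -ge0_integralZl//; last by exact: measurable_fun_ysection.
apply: eq_integral => y _ /=.
rewrite -(lebesgue_affine_image (c * y + k) a0); last exact: measurable_ysection.
congr (mu _); apply/seteqP; split => x.
  rewrite /ysection /= inE => -[[u v] Xuv [<- <-]]; exists u; last by ring.
  by rewrite /ysection /= inE.
rewrite /ysection /= => -[u]; rewrite /= inE => Xu <-; rewrite inE.
by exists (u, y) => //=; congr pair; ring.
Qed.

End AffineArea.

Section AffineMaps.
Context {R : realType}.
Local Notation plane := (R * R)%type.
Local Notation mu := (@lebesgue_measure R).
Local Notation area := (mu \x mu)%E.
Implicit Types (A : 'M[R]_2) (b p v : plane).

Definition mx2 (a b c d : R) : 'M[R]_2 :=
  \matrix_(i, j) if i == 0 then if j == 0 then a else b else if j == 0 then c else d.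

Lemma det_mx2 A : \det A = A 0 0 * A 1 1 - A 0 1 * A 1 0.
Proof.
rewrite (expand_det_row _ 0) !big_ord_recl big_ord0 addr0 /cofactor.
rewrite !det_mx11 !mxE /= expr0 mul1r expr1 mulN1r mulrN.
by congr (_ * A _ _ - A _ _ * A _ _); apply/val_inj.
Qed.

Lemma affine_inverse A b : \det A != 0 -> exists A' b',
  [/\ \det A' = (\det A)^-1, cancel (affine A b) (affine A' b') & cancel (affine A' b') (affine A b)].
Proof.
move=> d0; set d := \det A in d0 *.
have dE : d = A 0 0 * A 1 1 - A 0 1 * A 1 0 by rewrite /d det_mx2.
pose A' := mx2 (A 1 1 / d) (- A 0 1 / d) (- A 1 0 / d) (A 0 0 / d).
exists A', (- (A' 0 0 * b.1 + A' 0 1 * b.2), - (A' 1 0 * b.1 + A' 1 1 * b.2)).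
clearbody d; split.
- rewrite det_mx2 !mxE /=; apply: (mulIf d0); rewrite mulVf//.
  apply: (mulIf d0); rewrite mul1r.
  by transitivity (A 0 0 * A 1 1 - A 0 1 * A 1 0); [field|rewrite -dE].
- move=> p; rewrite /affine !mxE /= [RHS]surjective_pairing; congr pair; apply: (mulIf d0).
    by transitivity (p.1 * (A 0 0 * A 1 1 - A 0 1 * A 1 0)); [field|rewrite -dE].
  by transitivity (p.2 * (A 0 0 * A 1 1 - A 0 1 * A 1 0)); [field|rewrite -dE].
- move=> p; rewrite /affine !mxE /= [RHS]surjective_pairing; congr pair; apply: (mulIf d0).
    transitivity (p.1 * (A 0 0 * A 1 1 - A 0 1 * A 1 0) + b.1 * (d - (A 0 0 * A 1 1 - A 0 1 * A 1 0))); first by field.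
    by rewrite -dE subrr mulr0 addr0.
  transitivity (p.2 * (A 0 0 * A 1 1 - A 0 1 * A 1 0) + b.2 * (d - (A 0 0 * A 1 1 - A 0 1 * A 1 0))); first by field.
  by rewrite -dE subrr mulr0 addr0.
Qed.

Lemma affine_continuous A b : continuous (affine A b).
Proof.
move=> p; have c1 : (fun x : plane => x.1) @ nbhs p --> p.1 by exact: cvg_fst.
have c2 : (fun x : plane => x.2) @ nbhs p --> p.2 by exact: cvg_snd.
have lin (u v w : R) : (fun x : plane => u * x.1 + v * x.2 + w) @ nbhs p --> u * p.1 + v * p.2 + w.
  by apply: cvgD; [apply: cvgD; apply: cvgM => //; exact: cvg_cst|exact: cvg_cst].
exact: cvg_pair (lin _ _ _) (lin _ _ _).
Qed.

Lemma cancel_image (T U : Type) (f : T -> U) g (X : set T) :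
  cancel f g -> cancel g f -> f @` X = g @^-1` X.
Proof.
move=> fK gK; apply/seteqP; split => [_ [x Xx <-]|y Xy]; first by rewrite /= fK.
by exists (g y).
Qed.

Lemma affine_open A b (X : set plane) : \det A != 0 -> open X -> open (affine A b @` X).
Proof.
move=> d0 oX; have [A' [b' [_ FK GK]]] := affine_inverse b d0.
rewrite (cancel_image _ FK GK); apply: open_comp => // p _; exact: affine_continuous.
Qed.

Lemma open_plane_measurable (X : set plane) : open X -> measurable X.
Proof.
move=> oX.
pose rect (k : (rat * rat) * (rat * rat)) : set plane :=
  `](ratr k.1.1 : R), ratr k.1.2[%classic `*` `](ratr k.2.1 : R), ratr k.2.2[%classic.
have -> : X = \bigcup_(k in [set k | rect k `<=` X]) rect k.
  apply/seteqP; split => [p Xp|p [k kX]]; last exact: kX.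
  have /nbhs_ballP[e /= e0 He] : nbhs p X by exact: open_nbhs_nbhs.
  have itv (x : R) : exists q1 q2 : rat, x - e < ratr q1 < x /\ x < ratr q2 < x + e.
    have h1 : x - e < x by rewrite ltrBlDr ltrDl.
    have h2 : x < x + e by rewrite ltrDl.
    have [q1] := rat_in_itvoo h1; have [q2] := rat_in_itvoo h2.
    by rewrite !in_itv /= => H2 H1; exists q1, q2.
  have [a1 [a2 [/andP[u1 u2] /andP[u3 u4]]]] := itv p.1.
  have [c1 [c2 [/andP[v1 v2] /andP[v3 v4]]]] := itv p.2.
  exists ((a1, a2), (c1, c2)); last by split; rewrite /= in_itv /=; apply/andP.
  move=> z [] /=; rewrite !in_itv /= => /andP[z1 z2] /andP[z3 z4]; apply: He.
  by split; rewrite /ball /= ltr_norml; apply/andP; split; lra.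
rewrite bigcup_mkcond; apply: countable_bigcupT_measurable => // k.
case: ifP => _ //; apply: measurableX; exact: measurable_itv.
Qed.

Lemma area_affine A b (X : set plane) : \det A != 0 -> open X ->
  area (affine A b @` X) = (`|\det A|%:E * area X)%E.
Proof.
have H A0 b0 (X0 : set plane) : \det A0 != 0 -> A0 1 1 != 0 -> open X0 ->
    area (affine A0 b0 @` X0) = (`|\det A0|%:E * area X0)%E.
  move=> d0 e0 oX.
  pose V (z : plane) : plane := (z.1, A0 1 0 * z.1 + A0 1 1 * z.2 + b0.2).
  pose a := \det A0 / A0 1 1; pose c := A0 0 1 / A0 1 1.
  pose H (z : plane) : plane := (a * z.1 + c * z.2 + (b0.1 - c * b0.2), z.2).
  have FE : affine A0 b0 = H \o V.
    apply/funext => z; rewrite /affine /H /V /a /c /=; congr pair.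
    by rewrite det_mx2; field.
  have a0 : a != 0 by rewrite mulf_neq0// invr_eq0.
  have oV : open (V @` X0).
    have -> : V = affine (mx2 1 0 (A0 1 0) (A0 1 1)) (0, b0.2).
      by apply/funext => z; rewrite /affine !mxE /V /=; congr pair; ring.
    by apply: affine_open => //; rewrite det_mx2 !mxE /= mul1r mul0r subr0.
  have oH : open (H @` (V @` X0)) by rewrite image_comp -FE; exact: affine_open.
  rewrite FE -image_comp area_horizontal//; try exact: open_plane_measurable.
  rewrite area_vertical//; last exact: open_plane_measurable.
  by rewrite muleA -EFinM -normrM /a divfK.
move=> d0 oX; have [e0|] := eqVneq (A 1 1) 0; last by move=> e0; exact: H.
have c0 : A 1 0 != 0.
  by apply: contra_neq d0 => e1; rewrite det_mx2 e0 e1 !mulr0 subrr.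
pose P (z : plane) : plane := (1 * z.1 + 1 * z.2 + 0, z.2).
have PE : P = affine (mx2 1 1 0 1) (0, 0).
  by apply/funext => z; rewrite /affine !mxE /P /=; congr pair; ring.
have oP : open (P @` X).
  by rewrite PE; apply: affine_open => //; rewrite det_mx2 !mxE /= mulr1 mulr0 subr0 oner_neq0.
pose A2 := mx2 (A 0 0) (A 0 1 - A 0 0) (A 1 0) (- A 1 0).
have dA2 : \det A2 = \det A by rewrite !det_mx2 !mxE /= e0; ring.
have FE : affine A b = affine A2 b \o P.
  by apply/funext => z; rewrite /affine !mxE /P /= e0; congr pair; ring.
rewrite FE -image_comp H ?dA2//; last by rewrite mxE /= oppr_eq0.
rewrite area_horizontal ?oner_neq0 ?normr1 ?mul1e//; exact: open_plane_measurable.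
Qed.

End AffineMaps.

Section AffineOvals.
Context {R : realType}.
Local Notation plane := (R * R)%type.
Implicit Types (A : 'M[R]_2) (b p v : plane) (C : set plane) (g : R -> plane).

Definition lin A (v : plane) : plane := affine A (0, 0) v.

Lemma affineB A b (x y : plane) : affine A b x - affine A b y = lin A (x - y).
Proof. by congr pair => /=; ring. Qed.

Lemma cross_lin A (u v : plane) : cross (lin A u) (lin A v) = \det A * cross u v.
Proof. by rewrite det_mx2 /cross /lin /affine /=; ring. Qed.

Lemma crossZZ (a c : R) (u v : plane) : cross (a *: u) (c *: v) = (a * c) * cross u v.
Proof. by rewrite /cross /= /GRing.scale /=; ring. Qed.

Lemma affine_inj A b : \det A != 0 -> injective (affine A b).
Proof. by move=> d0; have [A' [b' [_ FK _]]] := affine_inverse b d0; exact: can_inj FK. Qed.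

Lemma lin_neq0 A v : \det A != 0 -> v != 0 -> lin A v != 0.
Proof.
move=> d0; apply: contra_neq => e; apply: (affine_inj d0 (b := (0, 0))).
by rewrite -/(lin A v) e /affine /= !mulr0 !addr0.
Qed.

Lemma is_derive_affine A b (e : R) g (t : R) v : is_derive (e * t) 1 g v ->
  is_derive t 1 (fun u => affine A b (g (e * u))) (e *: lin A v).
Proof.
move=> dg.
have de : is_derive t 1 (fun u => e * u) e.
  by apply: (is_deriveW (is_deriveMl_fun e (is_derive_id t (1 : R)))); rewrite mulr1.
have d1 := is_derive_comp_fun de (is_derive_fst dg).
have d2 := is_derive_comp_fun de (is_derive_snd dg).
have lind (a c w : R) : is_derive t 1 (fun u => a * (g (e * u)).1 + c * (g (e * u)).2 + w)
    (e * (a * v.1 + c * v.2 + 0)).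
  apply: (is_deriveW (is_deriveD_fun (is_deriveD_fun (is_deriveMl_fun a d1) (is_deriveMl_fun c d2)) (is_derive_cst w _ _))).
  by ring.
exact: is_derive_pair (lind _ _ _) (lind _ _ _).
Qed.

Lemma scale_lin A (a : R) v : a *: lin A v = affine (a *: A) (0, 0) v.
Proof. by rewrite /lin /affine !mxE; congr pair; rewrite /GRing.scale /=; ring. Qed.

Lemma dotp_gt0 v : v != 0 -> 0 < dotp v v.
Proof.
move=> v0; rewrite lt_neqAle addr_ge0 -?expr2 ?sqr_ge0// andbT eq_sym.
apply: contra_neq v0 => /eqP; rewrite /dotp -!expr2 paddr_eq0 ?sqr_ge0// !sqrf_eq0.
by move=> /andP[/eqP e1 /eqP e2]; rewrite [v]surjective_pairing e1 e2.
Qed.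

Lemma curvature_gt0 g (t : R) : derive1 g t != 0 ->
  (0 < curvature g t) = (0 < cross (derive1 g t) (derive1n 2 g t)).
Proof.
move=> g0; rewrite /curvature pmulr_lgt0// invr_gt0 exprn_gt0// sqrtr_gt0.
exact: dotp_gt0.
Qed.

Lemma oval_param_affine C A b (e T : R) g : (e = 1 \/ e = -1) -> 0 < e * \det A ->
  oval_param C T g -> oval_param (affine A b @` C) T (fun t => affine A b (g (e * t))).
Proof.
move=> e1 ed [[T0 gT] [ginj gr] [sg g0] kg cg].
have ee : e * e = 1 by case: e1 => ->; rewrite ?mulr1// mulrNN mulr1.
have d0 : \det A != 0 by apply: contraTneq ed => ->; rewrite mulr0 ltxx.
have e0 : e != 0 by apply: contraTneq ed => ->; rewrite mul0r ltxx.
have dg (t : R) : is_derive t 1 g (derive1 g t) by split; [exact: (sg 0%N)|rewrite derive1E].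
have dg' (t : R) : is_derive t 1 (derive1 g) (derive1n 2 g t).
  by split; [exact: (sg 1%N)|rewrite derive1nS derive1E].
have D (t : R) : derive1 (fun t => affine A b (g (e * t))) t = e *: lin A (derive1 g (e * t)).
  by rewrite derive1E; have [_ ->] := is_derive_affine A b (dg (e * t)).
have DE : derive1 (fun t => affine A b (g (e * t))) = fun t => affine (e *: A) (0, 0) (derive1 g (e * t)).
  by apply/funext => t; rewrite D scale_lin.
have D2 (t : R) : derive1n 2 (fun t => affine A b (g (e * t))) t = lin A (derive1n 2 g (e * t)).
  rewrite derive1nS /= DE derive1E.
  have [_ ->] := is_derive_affine (e *: A) (0, 0) (dg' (e * t)).
  by rewrite /lin -/(lin (e *: A) _) scale_lin scalerA ee scale1r.
have D0 (t : R) : derive1 (fun t => affine A b (g (e * t))) t != 0.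
  by rewrite D scaler_eq0 negb_or e0 lin_neq0.
split.
- split=> // t; congr affine; case: e1 => ->; rewrite mulrDr ?mul1r ?gT// mulN1r mulN1r.
  by rewrite -[LHS]gT subrK.
- split; last first.
    rewrite -gr; apply/seteqP; split => [_ [t _ <-]|_ [_ [t _ <-] <-]].
      by exists (g (e * t)) => //; exists (e * t).
    by exists (e * t) => //; rewrite mulrA ee mul1r.
  move=> s t /andP[s0 sT] /andP[t0 tT] /(affine_inj d0); case: e1 => ->.
    by rewrite !mul1r => /ginj; apply; apply/andP.
  have gN (u : R) : g (- u) = g (- u + T) by rewrite gT.
  rewrite !mulN1r; move: s0 t0; rewrite !le_eqVlt => /predU1P[<-|s0] /predU1P[<-//|t0].
  + rewrite oppr0 (gN t) => /(ginj 0 (- t + T)) H.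
    have : 0 = - t + T by apply: H; apply/andP; split; lra.
    by move=> ?; lra.
  + rewrite oppr0 (gN s) => /(ginj (- s + T) 0) H.
    have : - s + T = 0 by apply: H; apply/andP; split; lra.
    by move=> ?; lra.
  + rewrite (gN t) (gN s) => /(ginj (- s + T) (- t + T)) H.
    have : - s + T = - t + T by apply: H; apply/andP; split; lra.
    by move=> ?; lra.
- split; last exact: D0.
  apply/smooth_curveP; have [s1 s2] := (smooth_curveP g).1 sg.
  have se : smooth (fun t => e * t) by exact: smoothM (smooth_cst e) (@smooth_id _).
  have c1 := smooth_comp s1 se; have c2 := smooth_comp s2 se.
  by split; apply: smoothD (smooth_cst _); apply: smoothD; apply: smoothM => //; exact: smooth_cst.
- move=> t; rewrite curvature_gt0// D D2 -[lin A (derive1n _ _ _)]scale1r crossZZ mulr1 cross_lin.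
  by rewrite mulrA mulr_gt0// -curvature_gt0.
- move=> s t ne; rewrite D affineB -[lin A (_ - _)]scale1r crossZZ mulr1 cross_lin mulrA mulr_gt0//.
  by apply: cg => E; apply: ne; rewrite E.
Qed.

Definition orient A : R := if 0 < \det A then 1 else -1.

Lemma orientP A : \det A != 0 -> (orient A = 1 \/ orient A = -1) /\ 0 < orient A * \det A.
Proof.
rewrite /orient; case: ltgtP => // h _.
  by split; [left|rewrite mul1r].
by split; [right|rewrite mulN1r oppr_gt0].
Qed.

Lemma oval_affine C A b : \det A != 0 -> oval C -> oval (affine A b @` C).
Proof.
move=> /orientP[e1 ed] [T [g Hg]]; exists T, (fun t => affine A b (g (orient A * t))).
exact: oval_param_affine.
Qed.

Lemma tangent_affine C A b x v : \det A != 0 -> tangent_vector C x v ->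
  tangent_vector (affine A b @` C) (affine A b x) (orient A *: lin A v).
Proof.
move=> /orientP[e1 ed] [T [g [t [Hg gt gv]]]].
have ee : orient A * orient A = 1 by case: e1 => ->; rewrite ?mulr1// mulrNN mulr1.
exists T, (fun t => affine A b (g (orient A * t))), (orient A * t).
split; first exact: oval_param_affine.
  by rewrite mulrA ee mul1r gt.
rewrite derive1E; have [_ [_ _] [sg _] _ _] := Hg.
have dg : is_derive (orient A * (orient A * t)) 1 g v.
  by rewrite mulrA ee mul1r -gv; split; [exact: (sg 0%N)|rewrite derive1E].
by have [_ ->] := is_derive_affine A b dg.
Qed.

(* [region C] through the tangent lines, a form that affine maps visibly respect *)
Lemma tangent_gap C (g1 g2 rho : R -> R) : support_param C g1 g2 rho -> oval C ->
  (region C = [set p | forall x v, tangent_vector C x v -> 0 < cross v (p - x)]) /\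
  (closure (region C) = [set p | forall x v, tangent_vector C x v -> 0 <= cross v (p - x)]).
Proof.
move=> HS HC.
have H1 x v : tangent_vector C x v -> exists s l : R, [/\ 0 < l, x = gam g1 g2 s &
    forall p, cross v (p - x) = l * gap g1 g2 p s].
  move=> tv; have Cx : C x.
    by have [T [g [t [[_ [_ <-] _ _ _] <- _]]]] := tv; exists t.
  have [s xs] := gam_surj HS Cx; rewrite xs in tv *.
  have [v0 [l vE]] := tangent_vector_direction HS tv.
  have cE p : cross v (p - gam g1 g2 s) = l * gap g1 g2 p s.
    by rewrite vE /cross /gap /gam /=; ring.
  exists s, l; split=> //.
  have [T [g [t [[_ [_ gr] _ _ cg] gt gv]]]] := tv.
  have p0 := pi_gt0 R.
  have [u _ gu] : range g (gam g1 g2 (s + pi)) by rewrite gr; exact: (gam_in HS).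
  have := cg u t; rewrite gu gt gv => /(_ (@gam_antipode _ _ _ _ _ HS s)); rewrite cE.
  by rewrite pmulr_lgt0//; apply: (gap_gam HS); rewrite mulr2n; apply/andP; split; lra.
have H2 s : exists v, exists2 l : R, 0 < l & tangent_vector C (gam g1 g2 s) v /\
    forall p, cross v (p - gam g1 g2 s) = l * gap g1 g2 p s.
  have [v tv] := tangent_vector_exists HC (gam_in HS s).
  have [s' [l [l0 xE cE]]] := H1 _ _ tv; exists v, l => //; split=> // p.
  rewrite cE; congr (_ * _); have [k ->] := gam_inj HS xE.
  by apply: periodic_int => y; exact: (gap_period HS).
split; apply/seteqP; rewrite ?(region_inner HS) ?(closure_inner HS); split => p /=.
- by move=> ip x v /H1[s [l [l0 -> ->]]]; rewrite mulr_gt0.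
- move=> H s; have [v [l l0 [tv cE]]] := H2 s; have := H _ _ tv.
  by rewrite cE pmulr_rgt0.
- by move=> ip x v /H1[s [l [l0 -> ->]]]; rewrite mulr_ge0// ltW.
- move=> H s; have [v [l l0 [tv cE]]] := H2 s; have := H _ _ tv.
  by rewrite cE pmulr_rge0.
Qed.

End AffineOvals.

Section Equivariance.
Context {R : realType}.
Local Notation plane := (R * R)%type.
Implicit Types (A : 'M[R]_2) (b p v : plane) (C L M : set plane).

Lemma image_cancel (T U : Type) (f : T -> U) g (X : set T) : cancel f g -> g @` (f @` X) = X.
Proof.
move=> fK; rewrite image_comp; apply/seteqP; split => [_ [x Xx <-]|x Xx]; first by rewrite /= fK.
by exists x => //=; rewrite fK.
Qed.

Lemma region_affine C A b : \det A != 0 -> oval C ->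
  region (affine A b @` C) = affine A b @` region C /\
  closure (region (affine A b @` C)) = affine A b @` closure (region C).
Proof.
have H C0 A0 b0 p : \det A0 != 0 -> oval C0 ->
   (region (affine A0 b0 @` C0) (affine A0 b0 p) -> region C0 p) /\
   (closure (region (affine A0 b0 @` C0)) (affine A0 b0 p) -> closure (region C0) p).
  move=> d0 HC0.
  have [g1 [g2 [rho HS]]] := oval_support HC0.
  have HC1 := oval_affine b0 d0 HC0; have [h1 [h2 [sig HS1]]] := oval_support HC1.
  have [-> ->] := tangent_gap HS HC0; have [-> ->] := tangent_gap HS1 HC1.
  have [_ ed] := orientP d0.
  have E x v : cross (orient A0 *: lin A0 v) (affine A0 b0 p - affine A0 b0 x) =
      (orient A0 * \det A0) * cross v (p - x).
    by rewrite affineB -[lin A0 (_ - _)]scale1r crossZZ mulr1 cross_lin mulrA.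
  split=> H x v tv.
    by have := H _ _ (tangent_affine b0 d0 tv); rewrite E pmulr_rgt0.
  by have := H _ _ (tangent_affine b0 d0 tv); rewrite E pmulr_rge0.
move=> d0 HC; have [A' [b' [dA' FK GK]]] := affine_inverse b d0.
have d1 : \det A' != 0 by rewrite dA' invr_eq0.
have HC1 := oval_affine b d0 HC.
split; apply/seteqP; split => [p|_ [p rp <-]].
- rewrite -{1}[p]GK => /(proj1 (H _ _ _ _ d0 HC)) r; exists (affine A' b' p) => //; exact: GK.
- apply: (proj1 (H _ _ b' _ d1 HC1)).
  by rewrite (image_cancel _ FK) FK.
- rewrite -{1}[p]GK => /(proj2 (H _ _ _ _ d0 HC)) r; exists (affine A' b' p) => //; exact: GK.
- apply: (proj2 (H _ _ b' _ d1 HC1)).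
  by rewrite (image_cancel _ FK) FK.
Qed.

Lemma iota_affine C A b x : \det A != 0 -> oval C -> C x ->
  iota_of (affine A b @` C) (affine A b x) = affine A b (iota_of C x) /\ C (iota_of C x).
Proof.
move=> d0 HC Cx; have [g1 [g2 [rho HS]]] := oval_support HC.
have HC1 := oval_affine b d0 HC; have [h1 [h2 [sig HS1]]] := oval_support HC1.
have [s xs] := gam_surj HS Cx; have Cx1 : (affine A b @` C) (affine A b x) by exists x.
have [s1 xs1] := gam_surj HS1 Cx1.
have : [set y | [/\ C y, y <> gam g1 g2 s & exists u v,
   [/\ tangent_vector C (gam g1 g2 s) u, tangent_vector C y v & cross u v = 0]]] (gam g1 g2 (s + pi)).
  by rewrite (iotaP HS HC).
move=> [Cy ney [u [v [tu tv uv]]]].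
rewrite xs (iota_gam HS HC); split=> //; rewrite -xs xs1 (iota_gam HS1 HC1).
have : [set y | [/\ (affine A b @` C) y, y <> gam h1 h2 s1 & exists u v,
   [/\ tangent_vector (affine A b @` C) (gam h1 h2 s1) u, tangent_vector (affine A b @` C) y v
     & cross u v = 0]]] (affine A b (gam g1 g2 (s + pi))).
  rewrite -xs1; split.
  - by exists (gam g1 g2 (s + pi)).
  - by move=> /(affine_inj d0) E; apply: ney; rewrite E.
  - exists (orient A *: lin A u), (orient A *: lin A v); split.
    + by apply: tangent_affine => //; rewrite xs.
    + exact: tangent_affine.
    + by rewrite crossZZ cross_lin uv !mulr0.
by rewrite (iotaP HS1 HC1) => ->.
Qed.

Lemma affine_line A b (x y : plane) : affine A b @` line x y = line (affine A b x) (affine A b y).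
Proof.
have E t : affine A b (x + t *: (y - x)) = affine A b x + t *: (affine A b y - affine A b x).
  by congr pair; rewrite /= /GRing.scale /=; ring.
apply/seteqP; split => [_ [_ [t ->] <-]|_ [t ->]]; first by exists t; rewrite E.
by exists (x + t *: (y - x)); [exists t|rewrite E].
Qed.

Lemma Phi_affine C A b L : \det A != 0 -> oval C ->
  Phi (affine A b @` C) (affine A b @` L) = affine A b @` Phi C L.
Proof.
move=> d0 HC; have inj := affine_inj d0 (b := b).
have [A' [b' [_ FK GK]]] := affine_inverse b d0.
apply/seteqP; split => [z [_ [_ [[x Cx <-] [y Cy <-] ne LE]]]|_ [z [x [y [Cx Cy ne LE zl]]] <-]].
  have [-> _] := iota_affine b d0 HC Cx; have [-> _] := iota_affine b d0 HC Cy.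
  rewrite -affine_line => -[z0 zl <-]; exists z0 => //; exists x, y; split=> //.
    by move=> E; apply: ne; rewrite E.
  by rewrite -(image_cancel L FK) LE -affine_line (image_cancel _ FK).
exists (affine A b x), (affine A b y); split; [by exists x|by exists y|by move=> /inj| |].
  by rewrite LE affine_line.
have [-> _] := iota_affine b d0 HC Cx; have [-> _] := iota_affine b d0 HC Cy.
by rewrite -affine_line; exists z.
Qed.

Lemma image_pencil_affine C A b p M : \det A != 0 -> oval C -> (Phi C @` pencil p) M ->
  (Phi (affine A b @` C) @` pencil (affine A b p)) (affine A b @` M).
Proof.
move=> d0 HC [L [[x [y [ne LE]]] Lp] <-]; exists (affine A b @` L); last exact: Phi_affine.
split; last by exists p.
exists (affine A b x), (affine A b y); split; first by move=> /(affine_inj d0).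
by rewrite LE affine_line.
Qed.

End Equivariance.

Section AffineEnergy.
Context {R : realType}.
Local Notation plane := (R * R)%type.

(* The substitution [phi] turns [Q'^2 - Q^2] into a multiple of [q'^2 - q^2] up
   to the exact derivative of [q^2 m'/m], because [m'' = d^-2 m^-3 - m]. *)
Lemma density_change (d : R) (v1 v2 w1 w2 phi phi' m q q' Q Q' K K1 : R -> R) :
  d != 0 -> smooth m -> (forall x, 0 < m x) ->
  (forall x : R, is_derive x 1 v1 (w1 x)) -> (forall x : R, is_derive x 1 v2 (w2 x)) ->
  (forall x : R, is_derive x 1 w1 (- v1 x)) -> (forall x : R, is_derive x 1 w2 (- v2 x)) ->
  (forall x, v1 x * w2 x - v2 x * w1 x = d^-1) ->
  (forall x : R, is_derive x 1 phi (phi' x)) ->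
  (forall x, v1 x = m x * cos (phi x) /\ v2 x = m x * sin (phi x)) ->
  (forall x : R, is_derive x 1 q (q' x)) -> (forall x : R, is_derive x 1 Q (Q' x)) ->
  (forall x, Q (phi x) * m x = q x) ->
  (forall x : R, is_derive x 1 K (q' x ^+ 2 - q x ^+ 2)) ->
  (forall x : R, is_derive x 1 K1 (Q' x ^+ 2 - Q x ^+ 2)) ->
  exists2 m' : R -> R, (forall x, m x * m' x = v1 x * w1 x + v2 x * w2 x) &
  forall x, K1 (phi x) - d * K x + d * (q x ^+ 2 * (m' x * (m x)^-1)) =
            K1 (phi 0) - d * K 0 + d * (q 0 ^+ 2 * (m' 0 * (m 0)^-1)).
Proof.
move=> d0 sm m0 dv1 dv2 dw1 dw2 vw dphi vE dq dQ QE dK dK1.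
have mn0 x : m x != 0 by rewrite gt_eqF.
have [m' dm _] := smooth_ex_derive sm.
have mm x : m x ^+ 2 = v1 x ^+ 2 + v2 x ^+ 2.
  by have [-> ->] := vE x; rewrite !exprMn -mulrDr cos2Dsin2 mulr1.
have mm' x : m x * m' x = v1 x * w1 x + v2 x * w2 x.
  have e1 := is_deriveM_fun (dm x) (dm x).
  have e2 := is_deriveD_fun (is_deriveM_fun (dv1 x) (dv1 x)) (is_deriveM_fun (dv2 x) (dv2 x)).
  have E : (fun y => m y * m y) = (fun y => v1 y * v1 y + v2 y * v2 y).
    by apply/funext => y; rewrite -!expr2 mm.
  rewrite E in e1; have [_ E1] := e1; have [_ E2] := e2; rewrite E1 in E2.
  have two0 : (2 : R) != 0 by rewrite pnatr_eq0.
  apply: (mulfI two0); transitivity (m' x * m x + m x * m' x); first by ring.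
  by rewrite E2; ring.
exists m' => //.
have m'E : m' = fun y => (v1 y * w1 y + v2 y * w2 y) * (m y)^-1.
  by apply/funext => y; rewrite -mm' mulrAC divff// mul1r.
have dm' (x : R) : is_derive x 1 m' ((d ^+ 2 * m x ^+ 3)^-1 - m x).
  rewrite m'E; apply: (is_deriveW (is_deriveM_fun (is_deriveD_fun
    (is_deriveM_fun (dv1 x) (dw1 x)) (is_deriveM_fun (dv2 x) (dw2 x))) (is_deriveV_fun (mn0 x) (dm x)))).
  have ww : m x ^+ 2 * (w1 x ^+ 2 + w2 x ^+ 2) = (m x * m' x) ^+ 2 + (d^-1) ^+ 2.
    by rewrite mm mm' -(vw x); ring.
  have {}ww : w1 x ^+ 2 + w2 x ^+ 2 = m' x ^+ 2 + (d * m x) ^- 2.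
    apply: (mulfI (expf_neq0 2 (mn0 x))); rewrite ww.
    by field; rewrite d0 mn0.
  transitivity ((w1 x ^+ 2 + w2 x ^+ 2 - (v1 x ^+ 2 + v2 x ^+ 2)) * (m x)^-1
    - (v1 x * w1 x + v2 x * w2 x) * m' x * ((m x)^-1 * (m x)^-1)); first by ring.
  by rewrite -mm' -mm ww; field; rewrite d0 mn0.
have phi'E x : phi' x = d^-1 * (m x) ^- 2.
  have := @derive_of_polar _ _ _ _ _ _ _ _ x sm dv1 dv2 dphi vE; rewrite vw => E.
  by rewrite E mulfK// expf_neq0.
have QqE : (fun y => Q (phi y)) = fun y => q y * (m y)^-1.
  by apply/funext => y; rewrite -QE mulfK.
have Q'E x : Q' (phi x) = d * (q' x * m x - q x * m' x).
  have [_ E1] := is_derive_comp_fun (dphi x) (dQ (phi x)).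
  have [_ E2] := is_deriveM_fun (dq x) (is_deriveV_fun (mn0 x) (dm x)).
  rewrite QqE E2 phi'E in E1.
  have z0 : d^-1 * (m x) ^- 2 != 0 by rewrite mulf_neq0// invr_eq0// expf_neq0.
  apply: (mulIf z0); rewrite -E1; by field; rewrite d0 mn0.
have D (x : R) : is_derive x 1
    (fun y => K1 (phi y) - d * K y + d * (q y ^+ 2 * (m' y * (m y)^-1))) 0.
  have -> : (fun y => K1 (phi y) - d * K y + d * (q y ^+ 2 * (m' y * (m y)^-1))) =
     (fun y => K1 (phi y) - d * K y + d * (q y * q y * (m' y * (m y)^-1))).
    by apply/funext => y; rewrite expr2.
  apply: (is_deriveW (is_deriveD_fun (is_deriveB_fun (is_derive_comp_fun (dphi x) (dK1 (phi x)))
    (is_deriveMl_fun d (dK x))) (is_deriveMl_fun d (is_deriveM_fun (is_deriveM_fun (dq x) (dq x))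
    (is_deriveM_fun (dm' x) (is_deriveV_fun (mn0 x) (dm x))))))).
  rewrite Q'E phi'E.
  have -> : Q (phi x) = q x * (m x)^-1 by rewrite -[LHS]/((fun y => Q (phi y)) x) QqE.
  by field; rewrite d0 mn0.
by move=> x; exact: (derive0_cst D).
Qed.

Lemma period_int (f : R -> R) (c : R) : (forall x, f (x + pi) = f x + c) ->
  forall (k : int) x, f (x + k%:~R * pi) = f x + k%:~R * c.
Proof.
move=> fp; have H (n : nat) x : f (x + n%:R * pi) = f x + n%:R * c.
  elim: n => [|n IH]; first by rewrite !mul0r !addr0.
  by rewrite -natr1 !mulrDl !mul1r addrA fp IH addrA.
case=> n x; first exact: H.
rewrite NegzE mulrNz !mulNr; have := H n.+1 (x - n.+1%:R * pi).
by rewrite subrK => ->; rewrite addrK.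
Qed.

Variables (C : set plane) (A : 'M[R]_2) (b : plane).
Hypotheses (d0 : \det A != 0) (HC : oval C).
Local Notation d := (\det A).

(* [N] is the number of half turns of [phi] over [0, pi]. That it is [1] or [-1]
   follows only later, by applying this also to the inverse map. *)
Lemma energy_affine_int p : region C p -> exists2 N : int, N != 0 &
  N%:~R * energy (affine A b @` C) (affine A b p) = d * energy C p.
Proof.
move=> rp; have [g1 [g2 [rho HS]]] := oval_support HC.
have HC1 := oval_affine b d0 HC; have [h1 [h2 [sig HS1]]] := oval_support HC1.
have ip : inner g1 g2 p by rewrite -(region_inner HS).
have ip1 : inner h1 h2 (affine A b p).
  by rewrite -(region_inner HS1) (region_affine b d0 HC).1; exists p.
pose v1 x : R := d^-1 * (A 1 1 * cos x - A 1 0 * sin x).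
pose v2 x : R := d^-1 * (A 0 0 * sin x - A 0 1 * cos x).
pose w1 x : R := d^-1 * (- A 1 1 * sin x - A 1 0 * cos x).
pose w2 x : R := d^-1 * (A 0 0 * cos x + A 0 1 * sin x).
have lind (a c x : R) : is_derive x 1 (fun y => d^-1 * (a * cos y + c * sin y)) (d^-1 * (- a * sin x + c * cos x)).
  apply: (is_deriveW (is_deriveMl_fun _ (is_deriveD_fun (is_deriveMl_fun a (is_derive_cos x)) (is_deriveMl_fun c (is_derive_sin x))))).
  by ring.
have dv1 (x : R) : is_derive x 1 v1 (w1 x).
  have := lind (A 1 1) (- A 1 0) x.
  rewrite (_ : (fun y => _) = v1); last by apply/funext => y; rewrite /v1; ring.
  by move=> h; apply: (is_deriveW h); rewrite /w1; ring.
have dv2 (x : R) : is_derive x 1 v2 (w2 x).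
  have := lind (- A 0 1) (A 0 0) x.
  rewrite (_ : (fun y => _) = v2); last by apply/funext => y; rewrite /v2; ring.
  by move=> h; apply: (is_deriveW h); rewrite /w2; ring.
have dw1 (x : R) : is_derive x 1 w1 (- v1 x).
  have := lind (- A 1 0) (- A 1 1) x.
  rewrite (_ : (fun y => _) = w1); last by apply/funext => y; rewrite /w1; ring.
  by move=> h; apply: (is_deriveW h); rewrite /v1; ring.
have dw2 (x : R) : is_derive x 1 w2 (- v2 x).
  have := lind (A 0 0) (A 0 1) x.
  rewrite (_ : (fun y => _) = w2); last by apply/funext => y; rewrite /w2; ring.
  by move=> h; apply: (is_deriveW h); rewrite /v2; ring.
have vw x : v1 x * w2 x - v2 x * w1 x = d^-1.
  have e : v1 x * w2 x - v2 x * w1 x = d^-1 * d^-1 * d * (cos x ^+ 2 + sin x ^+ 2).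
    by rewrite {3}det_mx2 /v1 /v2 /w1 /w2; ring.
  by rewrite e cos2Dsin2; field.
have vpi x : v1 (x + pi) = - v1 x /\ v2 (x + pi) = - v2 x.
  by rewrite /v1 /v2 sinDpi cosDpi; split; ring.
have wpi x : w1 (x + pi) = - w1 x /\ w2 (x + pi) = - w2 x.
  by rewrite /w1 /w2 sinDpi cosDpi; split; ring.
have sv1 : smooth v1.
  apply: smoothM; first exact: smooth_cst.
  by apply: smoothD; [|apply: smoothN]; apply: smoothM; try exact: smooth_cst;
    [exact: smooth_cos|exact: smooth_sin].
have sv2 : smooth v2.
  apply: smoothM; first exact: smooth_cst.
  by apply: smoothD; [|apply: smoothN]; apply: smoothM; try exact: smooth_cst;
    [exact: smooth_sin|exact: smooth_cos].
have vn0 x : v1 x ^+ 2 + v2 x ^+ 2 != 0.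
  rewrite paddr_eq0 ?sqr_ge0// !sqrf_eq0; apply/negP => /andP[/eqP e1 /eqP e2].
  by have := vw x; rewrite e1 e2 !mul0r subrr => /esym/eqP; rewrite invr_eq0 (negPf d0).
have [phi [phi' [m [sphi sm dphi m0 vE]]]] := angle_lift sv1 sv2 vn0.
have mn0 x : m x != 0 by rewrite gt_eqF.
pose q x := image_dist g1 g2 (p, x).
pose Q x := image_dist h1 h2 (affine A b p, x).
have QE x : Q (phi x) * m x = q x.
  suff H : q x / m x = Q (phi x) by rewrite -H divfK.
  apply/(chord_lineP HS1 HC1 _ _ ip1).
  have /(image_pencil_affine b d0 HC) := (chord_lineP HS HC x (q x) ip).2 erefl.
  congr ((_ @` _) _); have [A' [b' [_ FK GK]]] := affine_inverse b d0.
  have E z : m x * dotp (nvec (phi x)) (affine A b z - affine A b p) = dotp (nvec x) (z - p).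
    have [e1 e2] := vE x; rewrite /dotp /nvec /= mulrDr !mulrA -e1 -e2 /v1 /v2.
    apply: (mulfI d0).
    transitivity ((A 0 0 * A 1 1 - A 0 1 * A 1 0) * (cos x * (z.1 - p.1) + sin x * (z.2 - p.2))).
      by field.
    by rewrite -det_mx2.
  apply/seteqP; split => [_ [z /= zq <-]|z /= zq].
    by rewrite -zq -E mulrAC divff// mul1r.
  by exists (affine A' b' z) => //=; rewrite -E GK zq mulrC divfK.
have dq (x : R) : is_derive x 1 q (contact g1 g2 rho (p, x)) := image_dist_derive HS x ip.
have dQ (x : R) : is_derive x 1 Q (contact h1 h2 sig (affine A b p, x)) := image_dist_derive HS1 x ip1.
have prim (h1' h2' r' : R -> R) C0 p0 : support_param C0 h1' h2' r' -> inner h1' h2' p0 ->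
    exists K : R -> R, forall x : R, is_derive x 1 K (contact h1' h2' r' (p0, x) ^+ 2 - image_dist h1' h2' (p0, x) ^+ 2).
  move=> H0 i0; have cf := chord_fun_continuous H0 (chord_fun_density H0) i0.
  have [K dK] := continuous_primitive cf; exists (fun y => 2 * K y) => x.
  by apply: (is_deriveW (is_deriveMl_fun _ (dK x))) => /=; field.
have [K dK] := prim _ _ _ _ _ HS ip; have [K1 dK1] := prim _ _ _ _ _ HS1 ip1.
have [m' mm' /(_ pi) KE] := density_change d0 sm m0 dv1 dv2 dw1 dw2 vw dphi vE dq dQ QE dK dK1.
rewrite (energy_primitive HS HC ip dK) (energy_primitive HS1 HC1 ip1 dK1).
have qa x : q (x + pi) = - q x by exact: image_dist_antiperiodic HS HC _ _ ip.
have [vp1 vp2] := vpi 0; have [wp1 wp2] := wpi 0; rewrite !add0r in vp1 vp2 wp1 wp2.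
have mm x : m x ^+ 2 = v1 x ^+ 2 + v2 x ^+ 2.
  by have [-> ->] := vE x; rewrite !exprMn -mulrDr cos2Dsin2 mulr1.
have mpi : m pi = m 0.
  apply/eqP; rewrite -(@eqrXn2 _ 2) ?ltW//; by rewrite !mm vp1 vp2 !sqrrN.
have m'pi : m' pi = m' 0.
  by apply: (mulfI (mn0 0)); rewrite -{1}mpi !mm' vp1 vp2 wp1 wp2 !mulrNN.
have qpi : q pi = - q 0 by rewrite -[LHS](congr1 q (add0r pi)) qa.
rewrite mpi m'pi -/(q pi) -/(q 0) qpi sqrrN in KE.
have {}KE : K1 (phi pi) - K1 (phi 0) = d * (K pi - K 0) by lra.
have c1 : cos (phi pi) = cos (phi 0 + pi).
  have [e1 _] := vE pi; have [e2 _] := vE 0.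
  by apply: (mulfI (mn0 0)); rewrite -{1}mpi -e1 vp1 e2 cosDpi mulrN.
have s1 : sin (phi pi) = sin (phi 0 + pi).
  have [_ e1] := vE pi; have [_ e2] := vE 0.
  by apply: (mulfI (mn0 0)); rewrite -{1}mpi -e1 vp2 e2 sinDpi mulrN.
have [k kE] := cos_sin_eq c1 s1.
exists (1 + 2 * k).
  by lia.
have phE : phi pi = phi 0 + (1 + 2 * k)%:~R * pi.
  by rewrite kE intrD intrM -[_ *+ 2]mulr_natl; ring.
have K1p x : K1 (x + pi) = K1 x + (K1 pi - K1 0).
  have ca := contact_antiperiodic HS1 HC1; have Qa := image_dist_antiperiodic HS1 HC1.
  have : K1 (x + pi) - K1 x = K1 (0 + pi) - K1 0.
    apply: (derive0_cst (f := fun x => K1 (x + pi) - K1 x)) => y.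
    apply: (is_deriveW (is_deriveB_fun (is_derive_shift_fun (dK1 (y + pi))) (dK1 y))).
    by rewrite ca// Qa// !sqrrN subrr.
  by rewrite add0r => <-; ring.
move: KE; rewrite phE (period_int K1p) => KE.
have {}KE : (1 + 2 * k)%:~R * (K1 pi - K1 0) = d * (K pi - K 0) by rewrite -KE; ring.
by rewrite mulrCA KE; ring.
Qed.

End AffineEnergy.

Section EnclosedArea.
Context {R : realType}.
Local Notation plane := (R * R)%type.
Local Notation mu := (@lebesgue_measure R).
Local Notation area := (mu \x mu)%E.

Lemma area_region_fin (C : set plane) : oval C -> area (region C) \is a fin_num /\ (0 < area (region C))%E.
Proof.
move=> HC; have [g1 [g2 [rho HS]]] := oval_support HC.
rewrite (region_inner HS); have oI := open_inner HS.
have mI := open_plane_measurable oI.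
split.
  have [M HM] := gap_ge0_bounded g1 g2.
  pose B : set plane := `[- M, M]%classic `*` `[- M, M]%classic.
  have IB : inner g1 g2 `<=` B.
    move=> p ip; have [h1 h2] := HM p (fun x => ltW (ip x)).
    by split; rewrite /= in_itv /= -ler_norml.
  rewrite ge0_fin_numE//; apply: (@le_lt_trans _ _ (area B)).
    apply: le_measure; rewrite ?inE//.
    by apply: measurableX; exact: measurable_itv.
  have -> : area B = (mu `[(- M)%R, M]%classic * mu `[(- M)%R, M]%classic)%E.
    by apply: product_measure1E; exact: measurable_itv.
  rewrite lebesgue_measure_itv /=; case: ifP => _; last by rewrite mule0.
  by rewrite -EFinD -EFinM ltry.
have [p ip] := inner_nonempty HS.
have /nbhs_ballP[e /= e0 He] : nbhs p (inner g1 g2) by exact: open_nbhs_nbhs.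
pose B : set plane := `](p.1 - e), (p.1 + e)[%classic `*` `](p.2 - e), (p.2 + e)[%classic.
have BI : B `<=` inner g1 g2.
  move=> z [] /=; rewrite !in_itv /= => /andP[z1 z2] /andP[z3 z4]; apply: He.
  by split; rewrite /ball /= ltr_norml; apply/andP; split; lra.
apply: (@lt_le_trans _ _ (area B)); last first.
  apply: le_measure; rewrite ?inE//.
  by apply: measurableX; exact: measurable_itv.
have -> : area B = (mu `](p.1 - e)%R, (p.1 + e)%R[%classic * mu `](p.2 - e)%R, (p.2 + e)%R[%classic)%E.
  by apply: product_measure1E; exact: measurable_itv.
have l1 : p.1 - e < p.1 + e by lra.
have l2 : p.2 - e < p.2 + e by lra.
rewrite !lebesgue_measure_itv /= !lte_fin l1 l2 -!EFinD -EFinM lte_fin.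
by rewrite mulr_gt0// subr_gt0.
Qed.

End EnclosedArea.

Lemma sup_energy {R : realType} (C : set (R * R)) (p : R * R) : argmax_energy C p ->
  sup (energy C @` closure (region C)) = energy C p.
Proof.
move=> [clp H]; apply/eqP; rewrite eq_le; apply/andP; split.
  apply: ge_sup; first by exists (energy C p); exists p.
  by move=> _ [p' clp' <-]; exact: H.
apply: ub_le_sup; last by exists p.
by exists (energy C p) => _ [p' clp' <-]; exact: H.
Qed.

Lemma deltaE {R : realType} (C : set (R * R)) (p : R * R) : argmax_energy C p ->
  delta_ART C = energy C p / enclosed_area C.
Proof. by move=> /sup_energy <-. Qed.

Section AffineInvariance.
Context {R : realType}.
Local Notation plane := (R * R)%type.
Variables (C : set plane) (A : 'M[R]_2) (b : plane).
Hypotheses (d0 : \det A != 0) (HC : oval C).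
Local Notation F := (affine A b).

Lemma energy_affine p : closure (region C) p ->
  energy (F @` C) (F p) = `|\det A| * energy C p.
Proof.
have [g1 [g2 [rho HS]]] := oval_support HC.
have HC1 := oval_affine b d0 HC; have [h1 [h2 [sig HS1]]] := oval_support HC1.
move=> clp; have := clp; rewrite (closure_region HS) => /(gap_ge0_cases HS)[ip|Cp]; last first.
  rewrite (energy_curve Cp) mulr0 energy_curve//; by exists p.
have rp : region C p by rewrite (region_inner HS).
have [A' [b' [dA' FK GK]]] := affine_inverse b d0.
have d1 : \det A' != 0 by rewrite dA' invr_eq0.
have rp1 : region (F @` C) (F p) by rewrite (region_affine b d0 HC).1; exists p.
have [N N0 NE] := energy_affine_int b d0 HC rp.
have [M M0 ME] := energy_affine_int b' d1 HC1 rp1.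
rewrite (image_cancel _ FK) FK dA' in ME.
have e1 := energy_ge0 HS HC clp.
have e2 : 0 <= energy (F @` C) (F p) by apply: (energy_ge0 HS1 HC1); exact: subset_closure.
have int1 (k : int) : k != 0 -> 1 <= `|k%:~R : R|.
  by move=> k0; rewrite -intr_norm -[1]/(1%:~R) ler_int; lia.
have {}NE : `|N%:~R| * energy (F @` C) (F p) = `|\det A| * energy C p.
  by rewrite -(ger0_norm e2) -(ger0_norm e1) -!normrM NE.
have {}ME : `|M%:~R| * energy C p = `|\det A|^-1 * energy (F @` C) (F p).
  by rewrite -(ger0_norm e2) -(ger0_norm e1) -normfV -!normrM ME.
have a0 : 0 < `|\det A| by rewrite normr_gt0.
apply/eqP; rewrite eq_le; apply/andP; split.
  by rewrite -NE; exact: ler_peMl e2 (int1 _ N0).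
have := ler_peMl e1 (int1 _ M0); rewrite ME ler_pdivlMl; last exact: a0.
by apply.
Qed.

Lemma argmax_affine : argmax_energy (F @` C) = F @` argmax_energy C.
Proof.
have a0 : 0 < `|\det A| by rewrite normr_gt0.
have cE := (region_affine b d0 HC).2.
rewrite /argmax_energy; apply/seteqP; split => [y []|_ [p [clp H] <-]]; rewrite /= cE.
  move=> [p clp <-] H; exists p; last exact: erefl.
  split; first exact: clp.
  move=> p' clp'; have := H (F p') (ex_intro2 _ _ p' clp' erefl).
  by rewrite (energy_affine clp') (energy_affine clp) ler_pM2l.
split; first by exists p.
move=> y [p' clp' <-]; rewrite (energy_affine clp') (energy_affine clp) ler_pM2l; last exact: a0.
exact: H.
Qed.

Lemma delta_affine : delta_ART (F @` C) = delta_ART C.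
Proof.
have [g1 [g2 [rho HS]]] := oval_support HC.
have HC1 := oval_affine b d0 HC.
have a0 : `|\det A| != 0 by rewrite normr_eq0.
have [p Hp] := argmax_nonempty HS HC.
have Hp1 : argmax_energy (F @` C) (F p) by rewrite argmax_affine; exists p.
rewrite (deltaE Hp1); apply/esym; rewrite (deltaE Hp); apply/esym.
rewrite (energy_affine (proj1 Hp)).
rewrite /enclosed_area (region_affine b d0 HC).1 area_affine//; last first.
  by rewrite (region_inner HS); exact: (open_inner HS).
have [fin gt0] := area_region_fin HC.
have f0 : fine ((lebesgue_measure \x lebesgue_measure)%E (region C)) != 0.
  by rewrite gt_eqF// fine_gt0// gt0 ltey_eq fin.
rewrite fineM; [|by []|exact: fin].
by rewrite -mulf_div divff// mul1r.
Qed.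

End AffineInvariance.

(** * Central symmetry *)

Section CentralSymmetry.
Context {R : realType}.
Local Notation plane := (R * R)%type.
Variables (C : set plane) (g1 g2 rho : R -> R).
Hypothesis HS : support_param C g1 g2 rho.
Hypothesis HC : oval C.
Implicit Types (p : plane) (x y th s t : R).
Local Notation gm := (gam g1 g2).
Local Notation gp := (gap g1 g2).
Local Notation inn := (inner g1 g2).
Local Notation q := (image_dist g1 g2).
Local Notation cont := (contact g1 g2 rho).
Local Notation S := (chord_start g1 g2).
Local Notation T := (chord_stop g1 g2).
Local Notation det := (chord_det g1 g2 rho).

Lemma rho_period x : rho (x + pi *+ 2) = rho x.
Proof.
have [d1 d2 _ [p1 p2] _] := HS.
have E1 : (fun y => g1 (y + pi *+ 2)) = g1 by apply/funext.
have E2 : (fun y => g2 (y + pi *+ 2)) = g2 by apply/funext.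
have := is_derive_shift_fun (d1 (x + pi *+ 2)); rewrite E1 sinD2pi => -[_ e1].
have := is_derive_shift_fun (d2 (x + pi *+ 2)); rewrite E2 cosD2pi => -[_ e2].
have [_ e3] := d1 x; have [_ e4] := d2 x; rewrite e3 in e1; rewrite e4 in e2.
have E : cos x ^+ 2 + sin x ^+ 2 = 1 := cos2Dsin2 x.
rewrite -[LHS]mulr1 -[RHS]mulr1 -E !mulrDr.
have -> : rho (x + pi *+ 2) * cos x ^+ 2 = (rho (x + pi *+ 2) * cos x) * cos x by ring.
have -> : rho (x + pi *+ 2) * sin x ^+ 2 = - (- (rho (x + pi *+ 2) * sin x)) * sin x by ring.
by rewrite -e1 -e2; ring.
Qed.

Lemma image_dist_symmetric (c : plane) : (forall x, gm (x + pi) = c + c - gm x) ->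
  forall p th, inn p -> q (p, th) = dotp (nvec th) ((c - p) + (c - p)).
Proof.
move=> H p th ip; have az := inner_admissible th ip.
have cz := chord_endsP HS (z := (p, th)) az; have [p0 _ _] := az.
have [l [_ _ pE _ _]] := chord_coef2_param HS p0 cz.
have e1 := erefl (q (p, th)); rewrite {2}/image_dist /= in e1.
have e2 := image_dist_stop HS (z := (p, th)) az; rewrite /= in e2.
have [a1 a2] : g1 (S (p, th) + pi) = c.1 + c.1 - g1 (S (p, th)) /\ g2 (S (p, th) + pi) = c.2 + c.2 - g2 (S (p, th)).
  by have := H (S (p, th)) => -[].
have [b1 b2] : g1 (T (p, th) + pi) = c.1 + c.1 - g1 (T (p, th)) /\ g2 (T (p, th) + pi) = c.2 + c.2 - g2 (T (p, th)).
  by have := H (T (p, th)) => -[].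
have -> : q (p, th) = l * q (p, th) + (1 - l) * q (p, th) by ring.
rewrite {1}e1 e2 a1 a2 b1 b2 /dotp /nvec /=.
have p1E := congr1 fst pE; have p2E := congr1 snd pE; rewrite /= in p1E p2E.
transitivity (cos th * (c.1 + c.1 - p.1 - (g1 (T (p, th)) + l * (g1 (S (p, th)) - g1 (T (p, th)))))
  + sin th * (c.2 + c.2 - p.2 - (g2 (T (p, th)) + l * (g2 (S (p, th)) - g2 (T (p, th)))))).
  by ring.
by rewrite -p1E -p2E; ring.
Qed.

Lemma energy_symmetric (c : plane) : (forall x, gm (x + pi) = c + c - gm x) ->
  forall p, inn p -> energy C p = 0.
Proof.
move=> H p ip; pose v := (c - p) + (c - p).
have qE th : q (p, th) = v.1 * cos th + v.2 * sin th.
  by rewrite (image_dist_symmetric H)// /dotp /nvec /v /=; ring.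
have qf : (fun th => q (p, th)) = fun th => v.1 * cos th + v.2 * sin th by apply/funext.
have dq (th : R) : is_derive th 1 (fun y => v.1 * cos y + v.2 * sin y) (- v.1 * sin th + v.2 * cos th).
  apply: (is_deriveW (is_deriveD_fun (is_deriveMl_fun _ (is_derive_cos th)) (is_deriveMl_fun _ (is_derive_sin th)))).
  by ring.
have cE th : cont (p, th) = - v.1 * sin th + v.2 * cos th.
  have := image_dist_derive HS th ip; rewrite qf => -[_ <-].
  by have [_ ->] := dq th.
have dq' (th : R) : is_derive th 1 (fun y => - v.1 * sin y + v.2 * cos y) (- (v.1 * cos th + v.2 * sin th)).
  apply: (is_deriveW (is_deriveD_fun (is_deriveMl_fun _ (is_derive_sin th)) (is_deriveMl_fun _ (is_derive_cos th)))).
  by ring.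
have dK (th : R) : is_derive th 1
    (fun y => (v.1 * cos y + v.2 * sin y) * (- v.1 * sin y + v.2 * cos y)) (cont (p, th) ^+ 2 - q (p, th) ^+ 2).
  by rewrite cE qE; apply: (is_deriveW (is_deriveM_fun (dq th) (dq' th))); ring.
rewrite (energy_primitive HS HC ip dK) cospi sinpi cos0 sin0; ring.
Qed.

Lemma symmetric_antipode (c : plane) : (fun z : plane => c - (z - c)) @` C = C ->
  forall x, gm (x + pi) = c + c - gm x.
Proof.
move=> Csym x.
pose A : 'M[R]_2 := mx2 (-1) 0 0 (-1).
have FE : affine A (c + c) = fun z : plane => c - (z - c).
  by apply/funext => z; rewrite /affine !mxE /=; congr pair => /=; ring.
have dA : \det A = 1 by rewrite det_mx2 !mxE /=; ring.
have d0 : \det A != 0 by rewrite dA oner_neq0.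
have CF : affine A (c + c) @` C = C by rewrite FE.
have [v tv] := tangent_vector_exists HC (gam_in HS x).
have := tangent_affine (c + c) d0 tv; rewrite CF FE => tv'.
have Cy : C (c - (gm x - c)) by rewrite -Csym; exists (gm x) => //; exact: gam_in HS x.
have ne : c - (gm x - c) <> gm x.
  move=> E.
  have cx : c = gm x.
    have e1 := congr1 fst E; have e2 := congr1 snd E; rewrite /= in e1 e2.
    by rewrite [c]surjective_pairing /gam; congr pair; lra.
  have h1 : 0 < gp (gm (x + pi)) x.
    by have pp := pi_gt0 R; apply: (gap_gam HS); rewrite mulr2n; apply/andP; split; lra.
  have : C (c - (gm (x + pi) - c)) by rewrite -Csym; exists (gm (x + pi)) => //; exact: gam_in HS _.
  move=> /(gam_surj HS)[u uE]; have := gap_gam_ge0 HS x u; rewrite -uE cx.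
  by move: h1; rewrite /gap /gam /=; lra.
rewrite -(iota_unique HS Cy ne tv tv'); first by rewrite opprB addrA.
by rewrite -[v]scale1r; rewrite /cross /lin /affine !mxE /= /GRing.scale /=; ring.
Qed.

Lemma energy0_symmetric : centrally_symmetric C -> forall p, closure (region C) p -> energy C p = 0.
Proof.
move=> [c /symmetric_antipode H] p; rewrite (closure_region HS) => /(gap_ge0_cases HS)[ip|Cp].
  exact: energy_symmetric H p ip.
exact: energy_curve.
Qed.

End CentralSymmetry.

Section Asymmetry.
Context {R : realType}.
Local Notation plane := (R * R)%type.
Variables (C : set plane) (g1 g2 rho : R -> R).
Hypothesis HS : support_param C g1 g2 rho.
Hypothesis HC : oval C.
Implicit Types (p : plane) (x y th s t : R).
Local Notation gm := (gam g1 g2).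
Local Notation gp := (gap g1 g2).
Local Notation inn := (inner g1 g2).
Local Notation q := (image_dist g1 g2).
Local Notation cont := (contact g1 g2 rho).
Local Notation S := (chord_start g1 g2).
Local Notation T := (chord_stop g1 g2).

Lemma gam_antipode2 x : gm (x + pi + pi) = gm x.
Proof. by rewrite -addrA -mulr2n (gam_period HS). Qed.

Lemma diameter_normal x : exists th r : R, [/\ 0 < r,
  cos th * r = - (g2 (x + pi) - g2 x) & sin th * r = g1 (x + pi) - g1 x].
Proof.
pose w1 := g1 (x + pi) - g1 x; pose w2 := g2 (x + pi) - g2 x.
have w0 : 0 < w1 ^+ 2 + w2 ^+ 2.
  rewrite lt_neqAle addr_ge0 ?sqr_ge0// andbT eq_sym paddr_eq0 ?sqr_ge0// !sqrf_eq0 !subr_eq0.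
  apply/negP => /andP[/eqP e1 /eqP e2]; apply: (@gam_antipode _ _ _ _ _ HS x).
  by rewrite /gam e1 e2.
pose r := Num.sqrt (w1 ^+ 2 + w2 ^+ 2).
have r0 : 0 < r by rewrite sqrtr_gt0.
have [|th [c s]] := @unit_angle R (- w2 / r) (w1 / r).
  rewrite !expr_div_n sqrrN -mulrDl [w2 ^+ 2 + _]addrC sqr_sqrtr ?ltW// divff//.
  by rewrite gt_eqF.
by exists th, r; split; [exact: r0|rewrite -c divfK// gt_eqF|rewrite -s divfK// gt_eqF].
Qed.

(* A diameter is fixed by [Phi], and it touches the envelope of all diameters
   at the point dividing it in the ratio of the radii of curvature. *)
Lemma diameter_ratio p x th : inn p -> (forall y, q (p, y) = 0) ->
  dotp (nvec th) (gm x - p) = 0 -> dotp (nvec th) (gm (x + pi) - p) = 0 ->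
  rho x * (g1 (x + pi) - p.1) + rho (x + pi) * (g1 x - p.1) = 0 /\
  rho x * (g2 (x + pi) - p.2) + rho (x + pi) * (g2 x - p.2) = 0.
Proof.
move=> ip q0 n1 n2; have az := inner_admissible th ip.
have cz := chord_endsP HS (z := (p, th)) az; have [p0 _ _] := az.
set s := S (p, th) in cz *; set t := T (p, th) in cz *.
have xx : gm x <> gm (x + pi) by move=> /esym; exact: (@gam_antipode _ _ _ _ _ HS).
have LE := line_normal xx n1 n2.
have Ls : line (gm x) (gm (x + pi)) (gm (s + pi)).
  by rewrite LE /=; exact: q0.
have Lt : line (gm x) (gm (x + pi)) (gm (t + pi)).
  by rewrite LE /=; rewrite -(q0 th) (image_dist_stop HS).
have st : gm (s + pi) <> gm (t + pi).
  move=> /esym; apply: (gam_neq HS); case: cz => /andP[a b] /andP[a' b'] _ _ /=.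
  by apply/andP; split; lra.
have rz y z : gm y = gm z -> [/\ rho z = rho y, cos z = cos y & sin z = sin y] /\
    rho (z + pi) = rho (y + pi).
  move=> /(gam_inj HS)[k ->]; rewrite [_ + _ + pi]addrAC.
  rewrite !(periodic_int (rho_period HS)).
  by rewrite (periodic_int (f := cos) (@cosD2pi R)) (periodic_int (f := sin) (@sinD2pi R)).
have tE : gm t = gm (s + pi) /\ gm s = gm (t + pi).
  have sh y z : gm y = gm z -> gm (y + pi) = gm (z + pi).
    by move=> /(gam_inj HS)[k ->]; rewrite addrAC (gam_periodz HS).
  have [e|e] := line_gam2 HS xx Ls; have [e'|e'] := line_gam2 HS xx Lt.
  - by case: st; rewrite e e'.
  - by have := sh _ _ e'; have := sh _ _ e; rewrite !gam_antipode2 e e' => -> ->.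
  - by have := sh _ _ e'; have := sh _ _ e; rewrite !gam_antipode2 e e' => -> ->.
  - by case: st; rewrite e e'.
suff [h1 h2] : rho s * (g1 (s + pi) - p.1) + rho (s + pi) * (g1 s - p.1) = 0 /\
  rho s * (g2 (s + pi) - p.2) + rho (s + pi) * (g2 s - p.2) = 0.
  have [e|e] := line_gam2 HS xx Ls.
    have [[r1 _ _] r2] := rz _ _ e; rewrite r1 r2.
    have [e1 e2] : gm x = gm (s + pi) /\ gm (x + pi) = gm s.
      split; first by rewrite e.
      by move: (e) => /(gam_inj HS)[k ->]; rewrite addrAC (gam_periodz HS) gam_antipode2.
    have -> : rho (s + pi + pi) = rho s by rewrite -addrA -mulr2n (rho_period HS).
    have [-> ->] := e1; have [-> ->] := e2.
    by split; rewrite addrC.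
  have e2 : gm x = gm s.
    by move: (esym e) => /(gam_inj HS)[k E]; rewrite -(gam_periodz HS k); congr gm; lra.
  have [[-> _ _] ->] := rz _ _ (esym e2).
  have [-> ->] := e2; have : gm (x + pi) = gm (s + pi) by rewrite e.
  by case=> -> ->.
have [l [_ /(_ ip)/andP[l0 l1] pE E1 E2]] := chord_coef2_param HS p0 cz.
have c0 : cont (p, th) = 0.
  have := image_dist_derive HS th ip.
  rewrite (_ : (fun y => q (p, y)) = cst 0); last by apply/funext.
  by move=> [_ <-]; have [_ ->] := is_derive_cst (0 : R) th (1 : R).
have [m [_ cE mE]] := contact_convex HS (z := (p, th)) az.
have d0 := chord_det_gt0 HS (z := (p, th)) az.
have a1 := chord_coef1_start_lt0 HS cz.
rewrite c0 /along /= -/s -/t in cE; rewrite /= -/s -/t in mE.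
have [tE1 sE1] := tE; have [t1 t2] := tE1; have [s1 s2] := sE1.
have p1E := congr1 fst pE; have p2E := congr1 snd pE; rewrite /= in p1E p2E.
pose w := - sin th * (g1 s - g1 t) + cos th * (g2 s - g2 t).
have w0 : w != 0.
  apply/eqP => w0.
  have n0 : cos th * (g1 s - g1 t) + sin th * (g2 s - g2 t) = 0.
    have u1 : dotp (nvec th) (gm (s + pi) - p) = 0 by have := Ls; rewrite LE.
    have u2 : dotp (nvec th) (gm (t + pi) - p) = 0 by have := Lt; rewrite LE.
    move: u1 u2; rewrite /dotp /nvec /= -t1 -t2 -s1 -s2 => u1 u2.
    have -> : cos th * (g1 s - g1 t) + sin th * (g2 s - g2 t) =
       (cos th * (g1 s - p.1) + sin th * (g2 s - p.2)) - (cos th * (g1 t - p.1) + sin th * (g2 t - p.2)) by ring.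
    by rewrite u1 u2 subrr.
  have E : cos th ^+ 2 + sin th ^+ 2 = 1 := cos2Dsin2 th.
  apply: st; rewrite -tE1 -sE1 /gam; congr pair; apply/esym/eqP; rewrite -subr_eq0; apply/eqP.
    have -> : g1 s - g1 t = (cos th ^+ 2 + sin th ^+ 2) * (g1 s - g1 t) by rewrite E mul1r.
    have -> : (cos th ^+ 2 + sin th ^+ 2) * (g1 s - g1 t) =
      cos th * (cos th * (g1 s - g1 t) + sin th * (g2 s - g2 t)) - sin th * w by rewrite /w; ring.
    by rewrite n0 w0 !mulr0 subrr.
  have -> : g2 s - g2 t = (cos th ^+ 2 + sin th ^+ 2) * (g2 s - g2 t) by rewrite E mul1r.
  have -> : (cos th ^+ 2 + sin th ^+ 2) * (g2 s - g2 t) =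
    sin th * (cos th * (g1 s - g1 t) + sin th * (g2 s - g2 t)) + cos th * w by rewrite /w; ring.
  by rewrite n0 w0 !mulr0 addr0.
have ml : m = l.
  apply: (mulIf w0); apply/eqP; rewrite -subr_eq0; apply/eqP.
  rewrite [RHS]cE -t1 -t2 -s1 -s2 p1E p2E /w; ring.
rewrite ml /chord_det /= -/s -/t E1 E2 in mE.
have [[rt ct sit] rt'] := rz _ _ tE1.
have [[rs cs sis] rs'] := rz _ _ sE1.
have coefT : chord_coef1 rho th t * rho (s + pi) = - (chord_coef1 rho th s * rho s).
  rewrite /chord_coef1 -ct -sit cosDpi sinDpi -rs; ring.
have [G0 _] := chord_gaps_gt0 HS cz; rewrite pmulr_rgt0 ?(rho_gt0 HS)// in G0.
have GE : gp (gm s) t = gp (gm t) s.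
  by rewrite /gap /gam /= -ct -sit cosDpi sinDpi; ring.
have r1 := rho_gt0 HS s; have r2 := rho_gt0 HS (s + pi).
rewrite GE -rt in mE.
move: a1 mE coefT G0; move: (gp (gm t) s) (chord_coef1 _ th s) (chord_coef1 _ th t) => G k k' a1 mE kk G0.
have kG : - k * G != 0 by rewrite gt_eqF// mulr_gt0// oppr_gt0.
have sq : (l * rho s) ^+ 2 = ((1 - l) * rho (s + pi)) ^+ 2.
  apply: (mulfI kG); apply/eqP; rewrite -subr_eq0; apply/eqP.
  transitivity (rho (s + pi) * (l * (k' * (l * (rho s * G)) - k * ((1 - l) * (rho (s + pi) * G)))
     - - (k * ((1 - l) * (rho (s + pi) * G)))) - l * l * rho s * G * (k' * rho (s + pi) - - (k * rho s))).
    by ring.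
  by rewrite mE kk !subrr !mulr0 subrr.
have lr : l * rho s = (1 - l) * rho (s + pi).
  apply/eqP; rewrite -(@eqrXn2 _ 2) ?sq//; apply: mulr_ge0; apply: ltW => //.
  by rewrite subr_gt0.
rewrite -t1 -t2; split.
  transitivity (((1 - l) * rho (s + pi) - l * rho s) * (g1 s - g1 t)); last by rewrite lr subrr mul0r.
  by rewrite p1E; ring.
transitivity (((1 - l) * rho (s + pi) - l * rho s) * (g2 s - g2 t)); last by rewrite lr subrr mul0r.
by rewrite p2E; ring.
Qed.

Lemma diameters_cross x y : x < y < x + pi -> exists p, [/\ inn p,
  cross (gm x - p) (gm (x + pi) - p) = 0, cross (gm y - p) (gm (y + pi) - p) = 0 &
  0 < cross (gm (x + pi) - gm x) (gm (y + pi) - gm y)].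
Proof.
move=> /andP[xy yx]; have pp := pi_gt0 R.
have c1 : 0 < cross (gm (x + pi) - gm y) (gm (y + pi) - gm y).
  by apply: (triple_cross HS) => //; rewrite ?mulr2n; lra.
have c2 : 0 < cross (gm (y + pi) - gm y) (gm x - gm y).
  rewrite -(gam_period HS x); by apply: (triple_cross HS) => //; rewrite ?mulr2n; lra.
pose a := cross (gm (x + pi) - gm y) (gm (y + pi) - gm y).
pose b := cross (gm (y + pi) - gm y) (gm x - gm y).
have ab : a + b = cross (gm (x + pi) - gm x) (gm (y + pi) - gm y).
  by rewrite /a /b /cross /gam /=; ring.
have ab0 : 0 < a + b by rewrite addr_gt0.
pose l := b / (a + b).
pose p : plane := (g1 x + l * (g1 (x + pi) - g1 x), g2 x + l * (g2 (x + pi) - g2 x)).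
exists p; split.
- apply: (inner_chord HS); first by rewrite mulr2n; apply/andP; split; lra.
  by rewrite divr_gt0//= ltr_pdivrMr// mul1r ltrDr.
- by rewrite /p /cross /gam /=; ring.
- transitivity (b - l * (a + b)); last by rewrite divfK ?subrr// gt_eqF.
  by rewrite ab /b /p /cross /gam /=; ring.
- by rewrite -ab.
Qed.

Lemma diameter_image p x th : inn p -> cross (gm x - p) (gm (x + pi) - p) = 0 ->
  (exists r : R, [/\ 0 < r, cos th * r = - (g2 (x + pi) - g2 x) & sin th * r = g1 (x + pi) - g1 x]) ->
  [/\ dotp (nvec th) (gm x - p) = 0, dotp (nvec th) (gm (x + pi) - p) = 0 & q (p, th) = 0].
Proof.
move=> ip cr [r [r0 rc rs]].
have rn0 : r != 0 by rewrite gt_eqF.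
have n1 : dotp (nvec th) (gm x - p) = 0.
  apply: (mulIf rn0); rewrite mul0r -[RHS]oppr0 -cr.
  transitivity ((cos th * r) * (g1 x - p.1) + (sin th * r) * (g2 x - p.2)).
    by rewrite /dotp /nvec /=; ring.
  by rewrite rc rs /cross /gam /=; ring.
have n2 : dotp (nvec th) (gm (x + pi) - p) = 0.
  apply: (mulIf rn0); rewrite mul0r -[RHS]oppr0 -cr.
  transitivity ((cos th * r) * (g1 (x + pi) - p.1) + (sin th * r) * (g2 (x + pi) - p.2)).
    by rewrite /dotp /nvec /=; ring.
  by rewrite rc rs /cross /gam /=; ring.
split=> //; apply/esym/(chord_lineP HS HC _ _ ip).
have xx : gm x <> gm (x + pi) by move=> /esym; exact: (@gam_antipode _ _ _ _ _ HS).
rewrite -(line_normal xx n1 n2); exists (line (gm x) (gm (x + pi))).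
  split; first by exists (gm x), (gm (x + pi)).
  by rewrite (line_normal xx n1 n2) /= /dotp /= !subrr !mulr0 addr0.
by rewrite (Phi_secant HS HC xx) gam_antipode2 lineC.
Qed.

Lemma energy0_diameters x y : (forall p, inn p -> energy C p = 0) -> x < y < x + pi ->
  exists p, forall z, z = x \/ z = y ->
  rho z * (g1 (z + pi) - p.1) + rho (z + pi) * (g1 z - p.1) = 0 /\
  rho z * (g2 (z + pi) - p.2) + rho (z + pi) * (g2 z - p.2) = 0.
Proof.
move=> E0 /diameters_cross[p [ip cx cy cxy]]; exists p.
have [_ /(_ (E0 p ip))[a [b qE]]] := energy_sign HS HC ip.
have [th1 [r1 H1]] := diameter_normal x; have [th2 [r2 H2]] := diameter_normal y.
have [n1 n1' q1] := diameter_image ip cx (ex_intro _ r1 H1).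
have [n2 n2' q2] := diameter_image ip cy (ex_intro _ r2 H2).
have [r10 c1 s1] := H1; have [r20 c2 s2] := H2.
have z1 : - a * (g2 (x + pi) - g2 x) + b * (g1 (x + pi) - g1 x) = 0.
  rewrite mulNr -mulrN -c1 -s1; transitivity ((a * cos th1 + b * sin th1) * r1); first by ring.
  by rewrite -qE q1 mul0r.
have z2 : - a * (g2 (y + pi) - g2 y) + b * (g1 (y + pi) - g1 y) = 0.
  rewrite mulNr -mulrN -c2 -s2; transitivity ((a * cos th2 + b * sin th2) * r2); first by ring.
  by rewrite -qE q2 mul0r.
have cn0 : cross (gm (x + pi) - gm x) (gm (y + pi) - gm y) != 0 by rewrite gt_eqF.
have a0 : a = 0.
  apply: (mulIf cn0); rewrite mul0r.
  transitivity ((- a * (g2 (x + pi) - g2 x) + b * (g1 (x + pi) - g1 x)) * (g1 (y + pi) - g1 y)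
    - (- a * (g2 (y + pi) - g2 y) + b * (g1 (y + pi) - g1 y)) * (g1 (x + pi) - g1 x)).
    by rewrite /cross /gam /=; ring.
  by rewrite z1 z2 !mul0r subrr.
have b0 : b = 0.
  apply: (mulIf cn0); rewrite mul0r.
  transitivity ((- a * (g2 (x + pi) - g2 x) + b * (g1 (x + pi) - g1 x)) * (g2 (y + pi) - g2 y)
    - (- a * (g2 (y + pi) - g2 y) + b * (g1 (y + pi) - g1 y)) * (g2 (x + pi) - g2 x)).
    by rewrite /cross /gam /=; ring.
  by rewrite z1 z2 !mul0r subrr.
have q0 z : q (p, z) = 0 by rewrite qE a0 b0 !mul0r addr0.
by move=> z [->|->]; [exact: diameter_ratio ip q0 n1 n1'|exact: diameter_ratio ip q0 n2 n2'].
Qed.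

Lemma energy0_centre : (forall p, inn p -> energy C p = 0) -> exists c : plane, forall x,
  rho x * (g1 (x + pi) - c.1) + rho (x + pi) * (g1 x - c.1) = 0 /\
  rho x * (g2 (x + pi) - c.2) + rho (x + pi) * (g2 x - c.2) = 0.
Proof.
move=> E0; have pp := pi_gt0 R.
have rp x : 0 < rho x + rho (x + pi) by rewrite addr_gt0// (rho_gt0 HS).
have rn0 x : rho x + rho (x + pi) != 0 by rewrite gt_eqF.
pose f (g : R -> R) x : R := (rho x * g (x + pi) + rho (x + pi) * g x) / (rho x + rho (x + pi)).
have fE (g : R -> R) x c : rho x * (g (x + pi) - c) + rho (x + pi) * (g x - c) = 0 <-> c = f g x.
  have -> : rho x * (g (x + pi) - c) + rho (x + pi) * (g x - c) =
     rho x * g (x + pi) + rho (x + pi) * g x - c * (rho x + rho (x + pi)) by ring.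
  split=> [/eqP|->]; last by rewrite divfK// subrr.
  by rewrite subr_eq0 => /eqP E; rewrite /f E mulfK.
have fxy x y : x < y < x + pi -> f g1 x = f g1 y /\ f g2 x = f g2 y.
  move=> /(energy0_diameters E0)[p Hp].
  have [/fE <- /fE <-] := Hp x (or_introl erefl); by have [/fE <- /fE <-] := Hp y (or_intror erefl).
have fpi (g : R -> R) x : (forall y, g (y + pi *+ 2) = g y) -> f g (x + pi) = f g x.
  move=> gP; rewrite /f -addrA -mulr2n gP (rho_period HS) [rho (x + pi) + _]addrC.
  by congr (_ / _); rewrite addrC.
have fhalf x : f g1 (x + pi / 2) = f g1 x /\ f g2 (x + pi / 2) = f g2 x.
  by have [|-> ->] := fxy x (x + pi / 2); first by apply/andP; split; lra.
exists (f g1 0, f g2 0) => x /=.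
suff [e1 e2] : f g1 0 = f g1 x /\ f g2 0 = f g2 x by split; apply/fE.
pose h : R := pi / 2; have h0 : 0 < h by rewrite divr_gt0.
pose k := Num.floor (x / h); pose y := x - k%:~R * h.
have yE : x = y + k%:~R * h by rewrite /y subrK.
have /andP[y0 yh] : 0 <= y < h.
  have := Num.Theory.floor_itv (x / h); rewrite -/k => /andP[k1 k2].
  rewrite /y subr_ge0 -ler_pdivlMr// k1 /= ltrBlDl -[X in _ + X]mul1r -mulrDl -ltr_pdivrMr//.
  by rewrite -[1]/(1%:~R) -intrD.
rewrite yE (periodic_int (fun x => (fhalf x).1)) (periodic_int (fun x => (fhalf x).2)).
move: y0; rewrite le_eqVlt => /predU1P[<-//|y0].
by apply: fxy; rewrite add0r y0 (lt_trans yh)// /h; lra.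
Qed.

Lemma centre_symmetric (c : plane) : (forall x,
  rho x * (g1 (x + pi) - c.1) + rho (x + pi) * (g1 x - c.1) = 0 /\
  rho x * (g2 (x + pi) - c.2) + rho (x + pi) * (g2 x - c.2) = 0) ->
  centrally_symmetric C.
Proof.
move=> H; have [rho' dr _] := smooth_ex_derive (smooth_rho HS).
have rn0 x : rho x != 0 by rewrite gt_eqF// (rho_gt0 HS).
pose k x := rho (x + pi) * (rho x)^-1.
have sx x : sin (x + pi) = - sin x := sinDpi x.
have cx x : cos (x + pi) = - cos x := cosDpi x.
have key (x : R) : (rho' x * (g1 (x + pi) - c.1) + rho' (x + pi) * (g1 x - c.1) = 0) /\
   (rho' x * (g2 (x + pi) - c.2) + rho' (x + pi) * (g2 x - c.2) = 0).
  split.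
    have [_ e1] := is_deriveD_fun (is_deriveM_fun (dr x) (is_deriveBr_fun c.1 (is_derive_shift_fun (dg1 HS (x + pi)))))
      (is_deriveM_fun (is_derive_shift_fun (dr (x + pi))) (is_deriveBr_fun c.1 (dg1 HS x))).
    move: e1; rewrite (_ : (fun y => _) = cst 0); last by apply/funext => y; have [-> _] := H y.
    have [_ ->] := is_derive_cst (0 : R) x (1 : R); rewrite sx => e1.
    by rewrite [RHS]e1; ring.
  have [_ e1] := is_deriveD_fun (is_deriveM_fun (dr x) (is_deriveBr_fun c.2 (is_derive_shift_fun (dg2 HS (x + pi)))))
    (is_deriveM_fun (is_derive_shift_fun (dr (x + pi))) (is_deriveBr_fun c.2 (dg2 HS x))).
  move: e1; rewrite (_ : (fun y => _) = cst 0); last by apply/funext => y; have [_ ->] := H y.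
  have [_ ->] := is_derive_cst (0 : R) x (1 : R); rewrite cx => e1.
  by rewrite [RHS]e1; ring.
have dk (x : R) : is_derive x 1 k 0.
  apply: (is_deriveW (is_deriveM_fun (is_derive_shift_fun (dr (x + pi))) (is_deriveV_fun (rn0 x) (dr x)))).
  suff E : rho' (x + pi) * rho x = rho (x + pi) * rho' x.
    apply: (mulIf (rn0 x)); apply: (mulIf (rn0 x)); rewrite !mul0r.
    transitivity (rho' (x + pi) * rho x - rho (x + pi) * rho' x); first by field.
    by rewrite E subrr.
  have [h1 h2] := H x; have [k1 k2] := key x.
  apply/eqP; rewrite -subr_eq0; apply/negPn/negP => n0.
  have cE : c = gm x.
    have z1 : (rho' (x + pi) * rho x - rho (x + pi) * rho' x) * (g1 x - c.1) = 0.
      transitivity (rho x * (rho' x * (g1 (x + pi) - c.1) + rho' (x + pi) * (g1 x - c.1))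
        - rho' x * (rho x * (g1 (x + pi) - c.1) + rho (x + pi) * (g1 x - c.1))); first by ring.
      by rewrite h1 k1 !mulr0 subrr.
    have z2 : (rho' (x + pi) * rho x - rho (x + pi) * rho' x) * (g2 x - c.2) = 0.
      transitivity (rho x * (rho' x * (g2 (x + pi) - c.2) + rho' (x + pi) * (g2 x - c.2))
        - rho' x * (rho x * (g2 (x + pi) - c.2) + rho (x + pi) * (g2 x - c.2))); first by ring.
      by rewrite h2 k2 !mulr0 subrr.
    move: z1 z2 => /eqP; rewrite mulf_eq0 (negPf n0) /= subr_eq0 => /eqP z1.
    move=> /eqP; rewrite mulf_eq0 (negPf n0) /= subr_eq0 => /eqP z2.
    by rewrite [c]surjective_pairing /gam z1 z2.
  apply: (@gam_antipode _ _ _ _ _ HS x).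
  move: h1 h2; rewrite cE /gam /= !subrr !mulr0 !addr0 => /eqP; rewrite mulf_eq0 (negPf (rn0 x)) /= subr_eq0.
  move=> /eqP -> /eqP; rewrite mulf_eq0 (negPf (rn0 x)) /= subr_eq0.
  by move=> /eqP ->.
have k1 x : rho (x + pi) = rho x.
  have kk : k x = k (x + pi) by exact: (derive0_cst dk).
  move: kk; rewrite /k -addrA -mulr2n (rho_period HS) => kk.
  have sq : rho (x + pi) ^+ 2 = rho x ^+ 2.
    apply: (mulIf (invr_neq0 (rn0 x))); rewrite [rho (x + pi) ^+ 2]expr2 -mulrA kk.
    by field; rewrite !rn0.
  by apply/eqP; rewrite -(@eqrXn2 _ 2) ?sq// ltW// (rho_gt0 HS).
have aE x : gm (x + pi) = c - (gm x - c).
  have [h1 h2] := H x; rewrite k1 -mulrDr in h1; rewrite k1 -mulrDr in h2.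
  move: h1 h2 => /eqP; rewrite mulf_eq0 (negPf (rn0 x)) /= => /eqP h1.
  move=> /eqP; rewrite mulf_eq0 (negPf (rn0 x)) /= => /eqP h2.
  by rewrite /gam; apply/pair_equal_spec; split => /=; lra.
exists c; apply/seteqP; split => [_ [z Cz <-]|z Cz].
  by have [x ->] := gam_surj HS Cz; rewrite -aE; exact: (gam_in HS).
have [x zE] := gam_surj HS Cz; exists (gm (x + pi)); first exact: (gam_in HS).
by rewrite -aE gam_antipode2 zE.
Qed.

End Asymmetry.

Section Final.
Context {R : realType}.
Local Notation plane := (R * R)%type.
Variables (C : set plane).
Hypothesis HC : oval C.

Lemma enclosed_area_gt0 : 0 < enclosed_area C.
Proof.
have [fin pos] := area_region_fin HC; apply: fine_gt0.
by rewrite pos ltey_eq fin.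
Qed.

Lemma energy_outside p : ~ region C p -> energy C p = 0.
Proof. by move=> np; rewrite /energy memNset. Qed.

Lemma delta_eq0 p : argmax_energy C p -> (delta_ART C = 0) <-> (energy C p = 0).
Proof.
move=> Hp; rewrite (deltaE Hp); have a0 := enclosed_area_gt0.
split=> [/eqP|->]; last by rewrite mul0r.
by rewrite mulf_eq0 invr_eq0 (gt_eqF a0) orbF => /eqP.
Qed.

Lemma energy0_region_symmetric : (forall p, region C p -> energy C p = 0) -> centrally_symmetric C.
Proof.
move=> E0; have [g1 [g2 [rho HS]]] := oval_support HC.
have [|c Hc] := energy0_centre HS HC; last exact: (centre_symmetric HS Hc).
by move=> p ip; apply: E0; rewrite (region_inner HS).
Qed.

End Final.

Theorem theorem4p11 (R : realType) (C : set (R * R)) (HC : oval C) :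
  (* (a) *)
  ([/\ smooth_on (region C) (energy C),
       {within closure (region C), continuous (energy C)},
       (forall p, closure (region C) p -> 0 <= energy C p)
     & (forall p, C p -> energy C p = 0)]
   /\ (argmax_energy C !=set0 /\ compact (argmax_energy C)))
  /\
  (* (b) *)
  (forall (A : 'M[R]_2) (b : R * R), \det A != 0 ->
     [/\ (forall p, closure (region C) p ->
            energy (affine A b @` C) (affine A b p) = `|\det A| * energy C p),
         delta_ART (affine A b @` C) = delta_ART C
       & argmax_energy (affine A b @` C) = affine A b @` argmax_energy C])
  /\
  (* (c) *)
  [/\ (delta_ART C = 0 <-> centrally_symmetric C),
      (centrally_symmetric C ->
         (forall p, closure (region C) p -> energy C p = 0)
         /\ argmax_energy C = closure (region C))
    & (~ centrally_symmetric C ->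
         0 < delta_ART C /\ argmax_energy C `<=` region C)]
  /\
  (* (d) *)
  ((forall (A : 'M[R]_2) (b : R * R), affine_symmetry C A b ->
      affine A b @` argmax_energy C = argmax_energy C)
   /\
   (forall c : R * R, argmax_energy C = [set c] ->
      (forall (A : 'M[R]_2) (b : R * R), \det A != 0 ->
         argmax_energy (affine A b @` C) = [set affine A b c])
      /\
      (forall (A : 'M[R]_2) (b : R * R), affine_symmetry C A b ->
         affine A b c = c))).
Proof.
have [g1 [g2 [rho HS]]] := oval_support HC.
have sym : forall (A : 'M[R]_2) (b : R * R), affine_symmetry C A b ->
    affine A b @` argmax_energy C = argmax_energy C.
  by move=> A b [d0 FC]; rewrite -(argmax_affine b d0 HC) FC.
have ge0 p : closure (region C) p -> 0 <= energy C p := @energy_ge0 _ _ _ _ _ HS HC p.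
have [p Hp] := argmax_nonempty HS HC; have [clp maxp] := Hp.
have E0 : energy C p = 0 -> forall p', closure (region C) p' -> energy C p' = 0.
  by move=> pE p' clp'; apply/eqP; rewrite eq_le ge0// andbT -pE; exact: maxp.
have E0sym : energy C p = 0 -> centrally_symmetric C.
  move=> /E0 H; apply: (energy0_region_symmetric HC) => p' rp'.
  by apply: H; exact: subset_closure.
split; [split; [split|split]|split; [|split; [split|split]]].
- exact: energy_smooth HS HC.
- exact: energy_continuous HS HC.
- exact: ge0.
- by move=> p'; exact: energy_curve.
- exact: argmax_nonempty HS HC.
- exact: argmax_compact HS HC.
- move=> A b d0; split; [|exact: delta_affine|exact: argmax_affine].
  by move=> p' clp'; exact: energy_affine.
- split; first by move=> /(delta_eq0 HC Hp); exact: E0sym.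
  by move=> /(energy0_symmetric HS HC) H; apply/(delta_eq0 HC Hp); exact: H.
- move=> /(energy0_symmetric HS HC) H; split; first exact: H.
  apply/seteqP; split => [p' []|p' clp']; first by move=> h _; exact: h.
  split; first exact: clp'.
  by move=> p'' clp''; rewrite (H _ clp') (H _ clp'').
- move=> nsym; have pos : 0 < energy C p.
    rewrite lt_neqAle ge0// andbT eq_sym; apply/eqP => /E0sym; exact: nsym.
  split; first by rewrite (deltaE Hp) divr_gt0//; exact: enclosed_area_gt0.
  move=> p' [clp' max']; apply: contrapT => /energy_outside E.
  by have := max' _ clp; rewrite E leNgt pos.
- exact: sym.
- move=> c cE; split=> A b; first by move=> d0; rewrite (argmax_affine b d0 HC) cE image_set1.
  move=> /sym; rewrite cE image_set1 => E.
  have : [set affine A b c] (affine A b c) by [].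
  by rewrite E.
Qed.
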